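(* Let $0<\alpha<1<\beta$ and let $p\in\mathcal{P}_W^{\alpha,\beta}$ be given. Assume that one of the following holds: (i) $W=L^\infty(\Omega)$ and $V=L^q(\Omega)$ with $q\in(1,\infty]$; (ii) $W=H^2(\Omega)$ and $V=H^{-2}_*(\Omega)$. Then the problem $$\mathcal{G}^\infty_p:=\max_{f\in\mathcal{F}_V}\mathcal{G}^\infty_{f,p}$$ admits a solution, i.e. the supremum of $f\mapsto\mathcal{G}^\infty_{f,p}$ over $\mathcal{F}_V$ is attained by some $f\in\mathcal{F}_V$.
   Context: Let $\Omega=(0,\pi)\times(-\ell,\ell)\subset\mathbb{R}^2$ with $\ell>0$ fixed (a narrow rectangle, $2\ell\ll\pi$; no quantitative condition is imposed) and let $\sigma\in(0,1/2)$ be fixed. Energy space: $H^2_*(\Omega)=\{u\in H^2(\Omega): u=0 \text{ on } \{0,\pi\}\times(-\ell,\ell)\}$ (functions in it are continuous on $\overline\Omega$), with scalar product $$(u,v)_{H^2_*}=\int_\Omega\big[\Delta u\,\Delta v+(1-\sigma)(2u_{xy}v_{xy}-u_{xx}v_{yy}-u_{yy}v_{xx})\big]\,dx\,dy,$$ whose norm $\|\cdot\|_{H^2_*}$ is equivalent to the usual $H^2(\Omega)$ norm on $H^2_*(\Omega)$. $H^{-2}_*(\Omega)$ is the dual of $H^2_*(\Omega)$, with duality $\langle\cdot,\cdot\rangle$ and norm $\|f\|_{H^{-2}_*}=\sup_{\|v\|_{H^2_*}=1}\langle f,v\rangle$. Forces: $\mathcal{F}_V=\{f\in V:\|f\|_V=1\}$.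 Weights: $\mathcal{P}_{L^\infty}^{\alpha,\beta}$ is the set of $p\in L^\infty(\Omega)$ with $\alpha\le p\le\beta$ a.e., $p(x,y)=p(x,-y)$ a.e. in $\Omega$, and $\int_\Omega p\,dx\,dy=|\Omega|$. For a fixed constant $\kappa>1$, $\mathcal{P}_{H^2}^{\alpha,\beta}=\{p\in H^2(\Omega): p\in\mathcal{P}_{L^\infty}^{\alpha,\beta},\ \|p\|_{H^2}\le\kappa\sqrt{|\Omega|}\}$. $\mathcal{P}_W^{\alpha,\beta}$ denotes $\mathcal{P}_{L^\infty}^{\alpha,\beta}$ if $W=L^\infty(\Omega)$ and $\mathcal{P}_{H^2}^{\alpha,\beta}$ if $W=H^2(\Omega)$. Weak problem: given $f\in V$ and $p\in\mathcal{P}_W^{\alpha,\beta}$, $u\in H^2_*(\Omega)$ is the unique solution of $(u,v)_{H^2_*}=\langle pf,v\rangle$ for all $v\in H^2_*(\Omega)$, where $\langle pf,v\rangle=\int_\Omega pfv\,dx\,dy$ if $V=L^q(\Omega)$, and $\langle pf,v\rangle:=\langle f,pv\rangle$ if $V=H^{-2}_*(\Omega)$ and $p\in\mathcal{P}_{H^2}^{\alpha,\beta}$ (note $pv\in H^2_*(\Omega)$). Gap function: $\mathcal{G}_{f,p}(x)=u(x,\ell)-u(x,-\ell)$ for $x\in[0,\pi]$, and $\mathcal{G}^\infty_{f,p}=\max_{x\in(0,\pi)}|\mathcal{G}_{f,p}(x)|$. *)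

(* Defs.v *)
From HB Require Import structures.
From mathcomp Require Import all_boot all_order all_algebra.
From mathcomp Require Import all_classical all_reals all_analysis.

Set Implicit Arguments.
Unset Strict Implicit.
Unset Printing Implicit Defensive.
Import Order.TTheory GRing.Theory Num.Theory.
Import numFieldNormedType.Exports.

Local Open Scope classical_set_scope.
Local Open Scope ring_scope.

Section plate.
Context {R : realType}.
Local Notation plane := (R * R)%type.
(* The same carrier, with the sigma-algebra on which lebesgue_measure is
   declared. *)
Local Notation mplane := (measurableTypeR R * measurableTypeR R)%type.

Definition area : {measure set mplane -> \bar R} :=
  (@lebesgue_measure R \x @lebesgue_measure R)%E.

Definition Omega (l : R) : set plane :=
  `]0, pi[%classic `*` `]- l, l[%classic.

(** * Lebesgue spaces on Omega *)

(* Elements of the function spaces are represented by functions on the whole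
   plane.  Only their values on Omega matter, and only up to a null set. *)

Definition LqNorm (l : R) (q : \bar R) (f : plane -> R) : \bar R :=
  ('N[area]_q[EFin \o (f \_ (Omega l))])%E.

Definition Lq (l : R) (q : \bar R) (f : plane -> R) : Prop :=
  measurable_fun (Omega l : set mplane) f /\ (LqNorm l q f < +oo)%E.

(** * Sobolev spaces *)

Definition Dx (phi : plane -> R) : plane -> R := 'D_((1, 0) : plane) phi.
Definition Dy (phi : plane -> R) : plane -> R := 'D_((0, 1) : plane) phi.

Fixpoint Ck (k : nat) (phi : plane -> R) : Prop :=
  continuous phi /\
  (if k is k'.+1 then
     [/\ forall z, derivable phi z ((1, 0) : plane),
         forall z, derivable phi z ((0, 1) : plane),
         Ck k' (Dx phi) & Ck k' (Dy phi)]
   else True).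

Definition test_function (l : R) (phi : plane -> R) : Prop :=
  (forall k, Ck k phi) /\
  exists K : set plane,
    [/\ compact K, K `<=` Omega l & forall z, ~ K z -> phi z = 0].

Definition is_weak_deriv (l : R) (i j : nat) (u g : plane -> R) : Prop :=
  forall phi, test_function l phi ->
    \int[area]_(z in Omega l) (u z * iter i Dx (iter j Dy phi) z) =
    (- 1) ^+ (i + j) * \int[area]_(z in Omega l) (g z * phi z).

Definition is_L2_deriv (l : R) (i j : nat) (u g : plane -> R) : Prop :=
  Lq l 2%:E g /\ is_weak_deriv l i j u g.

Definition H2 (l : R) (u : plane -> R) : Prop :=
  Lq l 2%:E u /\
  forall i j, (i + j <= 2)%N -> exists g, is_L2_deriv l i j u g.

(* A representative of the weak derivative d_x^i d_y^j u, which is unique up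
   to a null set; all uses below are under an integral sign. *)
Definition wD (l : R) (i j : nat) (u : plane -> R) : plane -> R :=
  xget (cst 0) [set g | is_L2_deriv l i j u g].

Definition H2norm (l : R) (u : plane -> R) : R :=
  Num.sqrt (\sum_(i < 3) \sum_(j < 3 | (i + j <= 2)%N)
              \int[area]_(z in Omega l) (wD l i j u z ^+ 2)).

Definition continuous_version (l : R) (u w : plane -> R) : Prop :=
  {within closure (Omega l), continuous w} /\
  {ae area, forall z, Omega l z -> w z = u z}.

(* H^2(Omega) embeds in the continuous functions on the closed rectangle, so
   that the boundary values of u are those of its continuous version, which is
   unique on the closed rectangle. *)
Definition cont_rep (l : R) (u : plane -> R) : plane -> R :=
  xget (cst 0) [set w | continuous_version l u w].

Definition H2star (l : R) (u : plane -> R) : Prop :=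
  H2 l u /\
  exists2 w, continuous_version l u w &
    forall y, y \in `]- l, l[ -> w (0, y) = 0 /\ w (pi, y) = 0.

Definition laplacian (l : R) (u : plane -> R) (z : plane) : R :=
  wD l 2 0 u z + wD l 0 2 u z.

Definition H2star_prod (l sigma : R) (u v : plane -> R) : R :=
  \int[area]_(z in Omega l)
    (laplacian l u z * laplacian l v z +
     (1 - sigma) * (2 * wD l 1 1 u z * wD l 1 1 v z
                    - wD l 2 0 u z * wD l 0 2 v z
                    - wD l 0 2 u z * wD l 2 0 v z)).

Definition H2star_norm (l sigma : R) (u : plane -> R) : R :=
  Num.sqrt (H2star_prod l sigma u u).

(* Bounded linear functionals on H2star; the bound makes f compatible with
   almost everywhere equality.  Values outside H2star are irrelevant. *)
Definition H2star_dual (l sigma : R) (f : (plane -> R) -> R) : Prop :=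
  (forall (a : R) u v, H2star l u -> H2star l v ->
     f (fun z => a * u z + v z) = a * f u + f v) /\
  exists C : R, forall v, H2star l v -> `|f v| <= C * H2star_norm l sigma v.

Definition H2star_dual_norm (l sigma : R) (f : (plane -> R) -> R) : R :=
  sup [set f v | v in [set v | H2star l v /\ H2star_norm l sigma v = 1]].

(** * Forces and weights *)

Definition forces_Lq (l : R) (q : \bar R) : set (plane -> R) :=
  [set f | Lq l q f /\ LqNorm l q f = 1%E].

Definition forces_dual (l sigma : R) : set ((plane -> R) -> R) :=
  [set f | H2star_dual l sigma f /\ H2star_dual_norm l sigma f = 1].

Definition weights_Linfty (l alpha beta : R) : set (plane -> R) :=
  [set p | [/\ Lq l +oo%E p,
     {ae area, forall z, Omega l z -> alpha <= p z <= beta},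
     {ae area, forall z : plane, Omega l z -> p z = p (z.1, - z.2)} &
     (\int[area]_(z in Omega l) (p z)%:E = area (Omega l))%E]].

Definition weights_H2 (l kappa alpha beta : R) : set (plane -> R) :=
  [set p | [/\ H2 l p, weights_Linfty l alpha beta p &
     H2norm l p <= kappa * Num.sqrt (fine (area (Omega l)))]].

(** * Weak solutions and gap function *)

Definition pairing_Lq (l : R) (p f v : plane -> R) : R :=
  \int[area]_(z in Omega l) (p z * f z * v z).

Definition pairing_dual (p : plane -> R) (f : (plane -> R) -> R)
    (v : plane -> R) : R :=
  f (fun z => p z * v z).

Definition is_weak_solution (l sigma : R) (F : (plane -> R) -> R)
    (u : plane -> R) : Prop :=
  H2star l u /\ forall v, H2star l v -> H2star_prod l sigma u v = F v.

Definition weak_solution (l sigma : R) (F : (plane -> R) -> R) : plane -> R :=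
  xget (cst 0) [set u | is_weak_solution l sigma F u].

Definition gap (l : R) (u : plane -> R) (x : R) : R :=
  cont_rep l u (x, l) - cont_rep l u (x, - l).

(* The supremum is a maximum: gap l u is continuous on [0, pi] and vanishes at
   the end points. *)
Definition gap_max (l : R) (u : plane -> R) : R :=
  sup [set `|gap l u x| | x in `]0, pi[%classic].

Definition gap_max_Lq (l sigma : R) (p f : plane -> R) : R :=
  gap_max l (weak_solution l sigma (pairing_Lq l p f)).

Definition gap_max_dual (l sigma : R) (p : plane -> R)
    (f : (plane -> R) -> R) : R :=
  gap_max l (weak_solution l sigma (pairing_dual p f)).

End plate.

(* Main.v *)
(* The gap at [x] of the solution for the force [f] is the pairing of [p f] with
   the Riesz representer [g_x] in H2star of the functional [u |-> gap u x].  For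
   fixed [x] the force that maximizes this linear functional over the unit
   sphere is explicit: the equality case of Hoelder's inequality for [p g_x] in
   the Lebesgue case, the normalized scalar product with [p g_x] in the dual
   case.  The gap is moreover the integral of the mixed derivative [u_xy] over
   ]0, x[ x ]- l, l[, so it is Hoelder continuous in [x], uniformly over the unit
   sphere, and vanishes at [0] and [pi]: the pointwise maximum over all forces
   attains its maximum at some interior [x] (or is zero), and the force optimal
   at this [x] solves the problem.  No weak compactness is needed.

   Sobolev functions are handled through absolute continuity on almost every
   line, the sections being related to weak derivatives by a countable family
   of tensor product test functions. *)
Require Import Defs.
From mathcomp Require Import all_boot all_order all_algebra.
From mathcomp Require Import all_classical all_reals all_analysis.
From mathcomp Require Import measurable_realfun ess_sup_inf ring lra.
Set Implicit Arguments.
Unset Strict Implicit.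
Unset Printing Implicit Defensive.
Import Order.TTheory GRing.Theory Num.Theory.
Import numFieldNormedType.Exports.
Local Open Scope classical_set_scope.
Local Open Scope ring_scope.

(** * Integrable and square-integrable functions *)

(** The obstacle is that boundary values, gap and energy are all given through representatives and
    weak derivatives. Pointwise information is therefore turned into integrals. The condition on the
    sides [x = 0] and [x = pi] becomes the vanishing of two integrals over almost every horizontal
    line ([hinged]), a linear condition that survives L2 limits; the continuous version of [u] is
    written with integrals over boxes ([cversion]), from which boundary values and gap are read off.
    The energy only contains second derivatives: [u] and its gradient are controlled by Poincare
    inequalities, whose line means are known from the boundary condition. In the dual case [p v]
    must stay in [H2star], with a bound. A product of two first derivatives is the delicate term,
    since neither factor is bounded; a Ladyzhenskaya type estimate handles it. Finally, the unit
    sphere is not convex and omits 0, so a force must still be exhibited when [p g_x] vanishes. *)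

Lemma discriminant_le (R : realType) (a b c : R) : 0 <= a ->
  (forall t, 0 <= t ^+ 2 * a + 2 * t * c + b) -> c ^+ 2 <= a * b.
Proof.
move=> a0 H; have [a00|an0] := eqVneq a 0.
  rewrite a00 mul0r; have [->|c0] := eqVneq c 0; first by rewrite expr0n.
  (* With [a = 0] the quadratic is affine in [t], and this [t] gives it the value -1. *)
  have := H (- (b + 1) / (2 * c)); rewrite a00 mulr0 add0r.
  have -> : 2 * (- (b + 1) / (2 * c)) * c = - (b + 1) by field.
  by move=> h; exfalso; lra.
have fp : 0 < a by rewrite lt0r an0.
have := mulr_ge0 (H (- c / a)) (ltW fp).
have -> : ((- c / a) ^+ 2 * a + 2 * (- c / a) * c + b) * a = a * b - c ^+ 2.
  by field.
by rewrite subr_ge0.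
Qed.

Section integrals.
Context d (T : measurableType d) (R : realType).
Variables (mu : {measure set T -> \bar R}) (D : set T).
Hypothesis mD : measurable D.
Implicit Types f g h : T -> R.

Definition intg f := mu.-integrable D (EFin \o f).

Lemma intg_meas f : intg f -> measurable_fun D f.
Proof. by move=> /measurable_int /measurable_EFinP. Qed.

Lemma intgD f g : intg f -> intg g -> intg (fun x => f x + g x).
Proof. by move=> fi gi; have := integrableD mD fi gi. Qed.

Lemma intgB f g : intg f -> intg g -> intg (fun x => f x - g x).
Proof. by move=> fi gi; have := integrableB mD fi gi. Qed.

Lemma intgZ (a : R) f : intg f -> intg (fun x => a * f x).
Proof. by move=> fi; have := integrableZl mD a fi. Qed.

Lemma intg_abs f : intg f -> intg (fun x => `|f x|).
Proof. exact: integrable_norm. Qed.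

Lemma intg0 : intg (fun=> 0).
Proof. exact: integrable0. Qed.

Lemma intg_le f g : measurable_fun D f -> (forall x, D x -> `|f x| <= g x) ->
  intg g -> intg f.
Proof.
move=> mf fg; apply: le_integrable => //; first exact/measurable_EFinP.
by move=> x Dx /=; rewrite lee_fin (le_trans (fg x Dx))// ler_norm.
Qed.

Lemma intg_ae f g : intg f -> measurable_fun D g ->
  {ae mu, forall x, D x -> f x = g x} -> intg g.
Proof.
move=> /integrableP[mf fi] mg fg; apply/integrableP; split.
  exact/measurable_EFinP.
rewrite (_ : (\int[mu]_(x in D) _)%E = (\int[mu]_(x in D) `|(f x)%:E|)%E)//.
apply: ae_eq_integral => //.
- by apply: measurableT_comp => //; exact/measurable_EFinP.
- by apply: measurableT_comp.
- by apply: filterS fg => x /= h /h ->.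
Qed.

Lemma Rint_ae f g : measurable_fun D f -> measurable_fun D g ->
  {ae mu, forall x, D x -> f x = g x} ->
  \int[mu]_(x in D) f x = \int[mu]_(x in D) g x.
Proof.
move=> mf mg fg; congr fine; apply: ae_eq_integral => //.
- exact/measurable_EFinP.
- exact/measurable_EFinP.
- by apply: filterS fg => x /= h /h ->.
Qed.

(** Pointwise monotonicity is applied to [Num.min (f x) (g x)], which is everywhere below [g] and
    almost everywhere equal to [f]. *)
Lemma Rint_le_ae f g : intg f -> intg g ->
  {ae mu, forall x, D x -> f x <= g x} ->
  \int[mu]_(x in D) f x <= \int[mu]_(x in D) g x.
Proof.
move=> fi gi fg.
have mf := intg_meas fi; have mg := intg_meas gi.
have mm : measurable_fun D (fun x => Num.min (f x) (g x)).
  exact: measurable_minr.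
have ae : {ae mu, forall x, D x -> f x = Num.min (f x) (g x)}.
  by apply: filterS fg => x h /h fgx; rewrite min_l.
rewrite (Rint_ae mf mm ae); apply: le_Rintegral => //.
  exact: intg_ae ae.
by move=> x _; rewrite ge_min lexx orbT.
Qed.

Lemma Rint_abs_eq0 f : intg f -> \int[mu]_(x in D) `|f x| = 0 ->
  {ae mu, forall x, D x -> f x = 0}.
Proof.
move=> fi f0.
have mf : measurable_fun D (EFin \o f) by exact: measurable_int fi.
have : (\int[mu]_(x in D) `|(EFin \o f) x| = 0)%E.
  have := integrable_fin_num mD (intg_abs fi).
  move=> fn; rewrite -[LHS](fineK fn); congr (_%:E).
  exact: f0.
move/(ae_eq_integral_abs mu mD mf); apply: filterS => x h Dx.
by have /= := h Dx; case.
Qed.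

Lemma intgMl f g : measurable_fun D f -> (exists M, forall x, D x -> `|f x| <= M) ->
  intg g -> intg (fun x => f x * g x).
Proof.
move=> mf [M fM] gi; apply: (@intg_le _ (fun x => M * `|g x|)).
- by apply: measurable_funM => //; exact: intg_meas.
- by move=> x Dx; rewrite normrM ler_wpM2r// fM.
- exact/intgZ/intg_abs.
Qed.

Lemma intg_bounded f M : (mu D < +oo)%E -> measurable_fun D f ->
  (forall x, D x -> `|f x| <= M) -> intg f.
Proof.
move=> Dfin mf fM; apply: (@intg_le _ (fun=> M)) => //.
apply/integrableP; split; first exact/measurable_EFinP.
rewrite (eq_integral (fun=> (`|M|%:E)%E))//.
by rewrite integral_cst//= lte_mul_pinfty.
Qed.

Lemma Rint_abs_le f M : (mu D < +oo)%E -> intg f ->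
  {ae mu, forall x, D x -> `|f x| <= M} ->
  `|\int[mu]_(x in D) f x| <= M * fine (mu D).
Proof.
move=> Dfin fi fM; apply: (le_trans (le_normr_Rintegral mD fi)).
rewrite -Rintegral_cst//; apply: Rint_le_ae => //; first exact: intg_abs.
by apply: (@intg_bounded _ `|M|).
Qed.

Definition L2 f := measurable_fun D f /\ intg (fun x => f x ^+ 2).
Definition n2 f := \int[mu]_(x in D) (f x ^+ 2).

Lemma n2_ge0 f : 0 <= n2 f.
Proof. by apply: Rintegral_ge0 => x _; exact: sqr_ge0. Qed.

Lemma L2M f g : L2 f -> L2 g -> intg (fun x => f x * g x).
Proof.
move=> [mf fi] [mg gi]; apply: (@intg_le _ (fun x => f x ^+ 2 + g x ^+ 2)).
- exact: measurable_funM.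
- move=> x _; rewrite normrM -(real_normK (num_real (f x))).
  rewrite -(real_normK (num_real (g x))).
  move: `|f x| `|g x| (normr_ge0 (f x)) (normr_ge0 (g x)) => u v u0 v0; nra.
- exact: intgD.
Qed.

Lemma L2D f g : L2 f -> L2 g -> L2 (fun x => f x + g x).
Proof.
move=> lf lg; split; first exact: measurable_funD lf.1 lg.1.
apply: (@intg_le _ (fun x => 2 * (f x ^+ 2) + 2 * (g x ^+ 2))).
- by apply: measurable_funX; exact: measurable_funD lf.1 lg.1.
- by move=> x _; rewrite ger0_norm ?sqr_ge0//; have := sqr_ge0 (f x - g x); nra.
- by apply: intgD; apply: intgZ; [exact: lf.2|exact: lg.2].
Qed.

Lemma L2Z a f : L2 f -> L2 (fun x => a * f x).
Proof.
move=> [mf fi]; split; first exact: measurable_funM.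
apply: (@intg_le _ (fun x => a ^+ 2 * (f x ^+ 2))) => //.
- by apply: measurable_funX; exact: measurable_funM.
- by move=> x _; rewrite exprMn ger0_norm// mulr_ge0 ?sqr_ge0.
- exact: intgZ.
Qed.

Lemma L2B f g : L2 f -> L2 g -> L2 (fun x => f x - g x).
Proof.
move=> lf lg; rewrite (_ : (fun _ => _) = (fun x => f x + (-1) * g x)).
  by apply: L2D => //; exact: L2Z.
by apply/funext => x; rewrite mulN1r.
Qed.

Lemma L2_abs f : L2 f -> L2 (fun x => `|f x|).
Proof.
move=> [mf fi]; split; first exact: measurableT_comp.
rewrite (_ : (fun x => `|f x| ^+ 2) = (fun x => f x ^+ 2))//.
by apply/funext => x; rewrite real_normK ?num_real.
Qed.

Lemma n2_abs f : n2 (fun x => `|f x|) = n2 f.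
Proof. by apply: eq_Rintegral => x _; rewrite real_normK ?num_real. Qed.

Lemma n2_ae f g : measurable_fun D f -> measurable_fun D g ->
  {ae mu, forall x, D x -> f x = g x} -> n2 f = n2 g.
Proof.
move=> mf mg fg; apply: Rint_ae; [exact: measurable_funX.. |].
by apply: filterS fg => x h /h ->.
Qed.

Lemma L2_le f g : measurable_fun D f -> L2 g ->
  {ae mu, forall x, D x -> `|f x| <= g x} -> L2 f.
Proof.
move=> mf [mg gi] fg.
pose m x := Num.min (`|f x|) (`|g x|).
have mm : measurable_fun D m.
  by apply: measurable_minr; exact: measurableT_comp.
have [? mi] : L2 m.
  split=> //; apply: intg_le gi; first exact: measurable_funX.
  move=> x _; rewrite ger0_norm ?sqr_ge0// -(real_normK (num_real (g x))).
  by rewrite lerXn2r ?nnegrE ?/m ?le_min ?normr_ge0// ge_min lexx orbT.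
split=> //; apply: (intg_ae mi); first exact: measurable_funX.
apply: filterS fg => x h /h fgx; rewrite /m min_l ?real_normK ?num_real//.
exact: le_trans (ler_norm _).
Qed.

Lemma n2_le f g : measurable_fun D f -> L2 g ->
  {ae mu, forall x, D x -> `|f x| <= g x} -> n2 f <= n2 g.
Proof.
move=> mf lg fg; apply: Rint_le_ae; [exact: (L2_le mf lg fg).2|exact: lg.2|].
apply: filterS fg => x h /h fgx; rewrite -(real_normK (num_real (f x))).
by rewrite lerXn2r ?nnegrE// (le_trans _ fgx).
Qed.

Lemma n2Z a f : L2 f -> n2 (fun x => a * f x) = a ^+ 2 * n2 f.
Proof.
move=> lf; rewrite /n2 -RintegralZl//; last exact: lf.2.
by apply: eq_Rintegral => x _; rewrite exprMn.
Qed.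

Lemma n2D_le f g : L2 f -> L2 g ->
  n2 (fun x => f x + g x) <= 2 * n2 f + 2 * n2 g.
Proof.
move=> lf lg; rewrite /n2 -!RintegralZl//; [|exact: lg.2|exact: lf.2].
rewrite -RintegralD//; [|exact/intgZ/lf.2|exact/intgZ/lg.2].
apply: le_Rintegral => //.
- exact: (L2D lf lg).2.
- by apply: intgD; apply: intgZ; [exact: lf.2|exact: lg.2].
- by move=> x _; have := sqr_ge0 (f x - g x); nra.
Qed.

Lemma n2DZ a f g : L2 f -> L2 g -> n2 (fun x => a * f x + g x) =
  a ^+ 2 * n2 f + 2 * a * (\int[mu]_(x in D) (f x * g x)) + n2 g.
Proof.
move=> lf lg; rewrite /n2 -!RintegralZl//; [|exact: L2M|exact: lf.2].
have i1 : intg (fun x => a ^+ 2 * f x ^+ 2) by exact/intgZ/lf.2.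
have i2 : intg (fun x => 2 * a * (f x * g x)) by exact/intgZ/L2M.
rewrite -!RintegralD//; [|exact: intgD|exact: lg.2].
by apply: eq_Rintegral => x _; ring.
Qed.

Lemma cauchy_schwarz f g : L2 f -> L2 g ->
  (\int[mu]_(x in D) (f x * g x)) ^+ 2 <= n2 f * n2 g.
Proof.
move=> lf lg; set c := \int[mu]_(x in D) _.
apply: discriminant_le; first exact: n2_ge0.
by move=> t; rewrite -n2DZ// n2_ge0.
Qed.

Lemma L2_intg f : (mu D < +oo)%E -> L2 f -> intg f.
Proof.
move=> Dfin lf; have l1 : L2 (fun=> 1).
  split => //; apply: (@intg_bounded _ 1) => // x _.
  by rewrite expr1n normr1.
have := L2M lf l1; rewrite (_ : (fun x => f x * 1) = f)//.
by apply/funext => x; rewrite mulr1.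
Qed.

Lemma Rint_abs_sqr_le f : (mu D < +oo)%E -> L2 f ->
  (\int[mu]_(x in D) `|f x|) ^+ 2 <= fine (mu D) * n2 f.
Proof.
move=> Dfin lf; have l1 : L2 (fun=> 1).
  by split => //; apply: (@intg_bounded _ 1) => // x _; rewrite expr1n normr1.
have := cauchy_schwarz l1 (L2_abs lf); rewrite n2_abs.
rewrite (_ : n2 (fun=> 1) = fine (mu D)); last first.
  by rewrite /n2 -[RHS]mul1r -Rintegral_cst//; apply: eq_Rintegral => x _; rewrite expr1n.
by under eq_Rintegral do rewrite mul1r.
Qed.

End integrals.

(** * Completeness of L2 on a set of finite measure *)

Section L2_complete.
Context d (T : measurableType d) (R : realType).
Variables (mu : {measure set T -> \bar R}) (D : set T).
Hypothesis mD : measurable D.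
Hypothesis Dfin : (mu D < +oo)%E.

(* A sequence with [n2 (f (n+1) - f n) <= r_n ^+ 2], [r_n] summable, satisfies
   [sum int |f (n+1) - f n| < oo], hence converges almost everywhere; Fatou's
   lemma upgrades the convergence to L2. *)
Lemma L2_fast_cauchy (f : nat -> T -> R) (C : R) : 0 <= C ->
  (forall n, L2 mu D (f n)) ->
  (forall n m, (n <= m)%N ->
    n2 mu D (fun x => f m x - f n x) <= (C * 2^-1 ^+ n) ^+ 2) ->
  exists g, [/\ L2 mu D g,
    {ae mu, forall x, D x -> f ^~ x @ \oo --> g x} &
    forall n, n2 mu D (fun x => g x - f n x) <= (C * 2^-1 ^+ n) ^+ 2].
Proof.
move=> C0 lf df.
pose del n x : R := `|f n.+1 x - f n x|.
have ldel n : L2 mu D (del n) by apply: L2_abs => //; exact: L2B.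
have mdel n : measurable_fun D (EFin \o del n).
  by apply/measurable_EFinP; exact: (ldel n).1.
(* By Cauchy-Schwarz on a set of finite measure, [K * 2^-1 ^+ n] bounds the L1 norm of the [n]-th
   increment. *)
pose K : R := Num.sqrt (fine (mu D)) * C.
have K0 : 0 <= K by rewrite mulr_ge0// sqrtr_ge0.
have idel n : (\int[mu]_(x in D) (del n x)%:E <= (K * 2^-1 ^+ n)%:E)%E.
  have fn := integrable_fin_num mD (L2_intg mD Dfin (ldel n)).
  rewrite -(fineK fn) lee_fin ?normr_ge0.
  have := Rint_abs_sqr_le mD Dfin (ldel n).
  have -> : \int[mu]_(x in D) `|del n x| = \int[mu]_(x in D) del n x.
    by apply: eq_Rintegral => x _; rewrite /del normr_id.
  rewrite /Rintegral => h.
  have K1 : 0 <= K * 2^-1 ^+ n by rewrite mulr_ge0// exprn_ge0.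
  rewrite -(@ler_pXn2r _ 2)// ?nnegrE//; last first.
    by apply: fine_ge0; apply: integral_ge0 => x _; rewrite lee_fin /del.
  apply: (le_trans h); rewrite /K -[X in _ <= X ^+ 2]mulrA exprMn sqr_sqrtr; last exact: fine_ge0.
  rewrite ler_wpM2l// ?fine_ge0// n2_abs; exact: df.
have sfin : (\int[mu]_(x in D) \sum_(n <oo) (del n x)%:E < +oo)%E.
  rewrite integral_nneseries//; last by move=> n x _; rewrite lee_fin ?normr_ge0.
  apply: (@le_lt_trans _ _ (\sum_(n <oo) (K * 2^-1 ^+ n)%:E)%E).
    by apply: lee_nneseries => // n _ _; apply: integral_ge0 => x _; rewrite lee_fin normr_ge0.
  have cl : (\sum_(0 <= n < k) (K * 2^-1 ^+ n)%:E)%E @[k --> \oo] --> (K * (1 - 2^-1)^-1)%:E.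
    under eq_fun do rewrite sumEFin.
    apply: cvg_EFin; first exact: nearW.
    have := @cvg_geometric_series R K 2^-1.
    by rewrite ger0_norm//; apply; lra.
  by rewrite (cvg_lim _ cl)// ltry.
have msum : measurable_fun D (fun x => \sum_(n <oo) (del n x)%:E)%E.
  apply: ge0_emeasurable_sum; last by move=> n _; exact: mdel.
  by move=> n x Dx _; rewrite lee_fin normr_ge0.
have aecvg : {ae mu, forall x, D x -> cvgn (f ^~ x)}.
  have isum : mu.-integrable D (fun x => \sum_(n <oo) (del n x)%:E)%E.
    apply/integrableP; split=> //.
    rewrite (eq_integral (fun x => \sum_(n <oo) (del n x)%:E)%E)// => x _.
    by rewrite gee0_abs// nneseries_ge0// => n _ _; rewrite lee_fin ?normr_ge0.
  have := integrable_ae mD isum.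
  apply: filterS => x h Dx; have {}h := h Dx.
  have cs : cvgn (series (fun n => del n x)).
    apply: nnseries_is_cvg; [by move=> n; rewrite normr_ge0|].
    by move: h; rewrite fin_numE => /andP[_]; rewrite -ltey.
  have cs2 : cvgn (series (fun n => f n.+1 x - f n x)).
    exact: normed_cvg.
  have e : (fun n => f n x) = (fun n => series (fun n => f n.+1 x - f n x) n + f 0%N x).
    apply/funext => n; rewrite /series/= telescope_sumr// subrK//.
  by rewrite /= e; apply: is_cvgD => //; exact: is_cvg_cst.
(* The upper limit is measurable whether or not the sequence converges; the default value of [fine]
   can only matter on the null set of divergence. *)
pose g := fun x => fine (limn_esup (fun n => (f n x)%:E)).
have mg : measurable_fun D g.
  apply: (measurableT_comp (fine_measurable measurableT)) => //.
  apply: measurable_fun_limn_esup => n; apply/measurable_EFinP; exact: (lf n).1.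
have cg : {ae mu, forall x, D x -> f ^~ x @ \oo --> g x}.
  apply: filterS aecvg => x h Dx; have {}h := h Dx.
  rewrite /g.
  have ce : EFin \o (f ^~ x) @ \oo --> (limn (f ^~ x))%:E.
    by apply: cvg_EFin; [exact: nearW|].
  have -> : limn_esup (fun n => (f n x)%:E) = (limn (f ^~ x))%:E.
    exact: (cvg_limn_einf_sup ce).2.
  exact: h.
have fat n : (\int[mu]_(x in D) ((g x - f n x) ^+ 2)%:E <= ((C * 2^-1 ^+ n) ^+ 2)%:E)%E.
  (* The shift by [n] puts every index in the range of [df], so that Fatou's lemma keeps the bound
     of stage [n]. *)
  pose h m x := ((f (m + n)%N x - f n x) ^+ 2)%:E.
  have mh m : measurable_fun D (h m).
    apply/measurable_EFinP; apply: measurable_funX; apply: measurable_funB.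
      exact: (lf _).1.
    exact: (lf _).1.
  have -> : (\int[mu]_(x in D) ((g x - f n x) ^+ 2)%:E =
     \int[mu]_(x in D) (limn_einf (h^~ x)))%E.
    apply: ae_eq_integral => //.
    - apply/measurable_EFinP; apply: measurable_funX; apply: measurable_funB => //.
      exact: (lf _).1.
    - rewrite /limn_einf; apply: measurableT_comp => //.
      by apply: measurable_fun_limn_esup => m; exact: measurableT_comp.
    - apply: filterS cg => x c Dx; have {}c := c Dx.
      apply/esym; apply: (cvg_limn_einf_sup _).1.
      apply: cvg_EFin; first exact: nearW.
      have c' : (fun m => f (m + n)%N x) @ \oo --> g x.
        by move: c; rewrite -(cvg_shiftn n).
      by rewrite /h; apply: cvgM; apply: cvgB => //; exact: cvg_cst.
  apply: (le_trans (fatou _ _ mh _)) => //.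
    by move=> m x _; rewrite lee_fin sqr_ge0.
  rewrite limn_einf_lim; apply: lime_le; first exact: is_cvg_einfs.
  apply: nearW => m; apply: (@le_trans _ _ (\int[mu]_(x in D) h m x)%E).
    by apply: ereal_inf_lbound; exists m => /=.
  have fn := integrable_fin_num mD (L2B mD (lf (m + n)%N) (lf n)).2.
  by rewrite -(fineK fn) lee_fin; apply: df; rewrite leq_addl.
have lgf n : L2 mu D (fun x => g x - f n x).
  split; first by apply: measurable_funB => //; exact: (lf _).1.
  apply/integrableP; split.
    apply/measurable_EFinP; apply: measurable_funX; apply: measurable_funB => //.
    exact: (lf _).1.
  rewrite (eq_integral (fun x => ((g x - f n x) ^+ 2)%:E)).
    exact: le_lt_trans (fat n) (ltry _).
  by move=> x _; rewrite /= ger0_norm// sqr_ge0.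
exists g; split => //.
  rewrite (_ : g = (fun x => (g x - f 0%N x) + f 0%N x)).
    exact: L2D.
  by apply/funext => x; rewrite subrK.
move=> n; have fn := integrable_fin_num mD (lgf n).2.
by rewrite -lee_fin (fineK fn); exact: fat.
Qed.

End L2_complete.

(** * Riesz representation *)

Section riesz.
Context (R : realType) (T : Type).
Variable S : (T -> R) -> Prop.
Variable B : (T -> R) -> (T -> R) -> R.
Hypothesis Slin : forall (a : R) u v, S u -> S v -> S (fun z => a * u z + v z).
Hypothesis S0 : exists u, S u.
Hypothesis Blin : forall (a : R) u v w, S u -> S v -> S w ->
  B (fun z => a * u z + v z) w = a * B u w + B v w.
Hypothesis Bsym : forall u v, S u -> S v -> B u v = B v u.
Hypothesis Bge0 : forall u, S u -> 0 <= B u u.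

Lemma form_sqr a u v : S u -> S v ->
  B (fun z => a * u z + v z) (fun z => a * u z + v z) =
  a ^+ 2 * B u u + 2 * a * B u v + B v v.
Proof.
move=> su sv; have sw := Slin a su sv.
rewrite Blin// (Bsym su sw) (Bsym sv sw) !Blin// (Bsym sv su); ring.
Qed.

Lemma form_cauchy_schwarz u v : S u -> S v -> B u v ^+ 2 <= B u u * B v v.
Proof.
move=> su sv; apply: discriminant_le; first exact: Bge0.
by move=> t; rewrite -form_sqr//; apply/Bge0/Slin.
Qed.

Lemma form_abs_le u v : S u -> S v ->
  `|B u v| <= Num.sqrt (B u u) * Num.sqrt (B v v).
Proof.
move=> su sv; rewrite -sqrtrM ?Bge0// -sqrtr_sqr ler_sqrt ?form_cauchy_schwarz//.
by rewrite mulr_ge0 ?Bge0.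
Qed.

(** Completeness is asked for geometric rates only: the minimizing sequence can be chosen with such
    a rate, and [L2_fast_cauchy] needs one. The limit may have a larger constant, because the energy
    and the L2 norms of the derivatives are only equivalent. *)
Hypothesis Bcomplete : forall (u : nat -> T -> R) (C : R), 0 <= C ->
  (forall n, S (u n)) ->
  (forall n m, (n <= m)%N ->
    B (fun z => (-1) * u n z + u m z) (fun z => (-1) * u n z + u m z) <=
    (C * 2^-1 ^+ n) ^+ 2) ->
  exists w C', [/\ 0 <= C', S w & forall n,
    B (fun z => (-1) * u n z + w z) (fun z => (-1) * u n z + w z) <=
    (C' * 2^-1 ^+ n) ^+ 2].

Variables (F : (T -> R) -> R) (K : R).
Hypothesis Flin : forall (a : R) u v, S u -> S v ->
  F (fun z => a * u z + v z) = a * F u + F v.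
Hypothesis Fbnd : forall v, S v -> `|F v| <= K * Num.sqrt (B v v).

(* A minimizing sequence of the energy [B v v - 2 F v] is Cauchy by the
   parallelogram identity. *)
Lemma riesz_representation : exists2 u, S u & forall v, S v -> B u v = F v.
Proof.
pose J v := B v v - 2 * F v.
have Jlow v : S v -> - K ^+ 2 <= J v.
  move=> sv; have := Fbnd sv; have := Bge0 sv.
  rewrite /J; move: (B v v) (F v) => b f b0 fb.
  have := sqr_sqrtr b0; move: (Num.sqrt b) (sqrtr_ge0 b) fb => r r0 fb <-.
  have := ler_norm f; have := sqr_ge0 (r - K); nra.
pose E := [set J v | v in S].
have Einf : has_inf E.
  split; first by case: S0 => u su; exists (J u), u.
  by exists (- K ^+ 2) => _ [v sv <-]; exact: Jlow.
pose m := inf E.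
have mJ v : S v -> m <= J v by move=> sv; apply: ge_inf; [case: Einf|exists v].
(* With an energy excess below [4^-1 ^+ n], the parallelogram identity bounds the squared distance
   by [4 * 4^-1 ^+ n]; hence the constant 2 in [cau]. *)
have /boolp.choice[u_ hu] : forall n, exists u, S u /\ J u < m + 4^-1 ^+ n.
  move=> n.
  have e0 : 0 < 4^-1 ^+ n :> R by rewrite exprn_gt0.
  by have [_ [v sv <-] h] := inf_adherent e0 Einf; exists v.
have su n : S (u_ n) := (hu n).1.
have Ju n : J (u_ n) < m + 4^-1 ^+ n := (hu n).2.
have e4 n : 4^-1 ^+ n = (2^-1 ^+ n) ^+ 2 :> R.
  by rewrite -exprM mulnC exprM; congr (_ ^+ n); field.
have cau n k : (n <= k)%N ->
    B (fun z => (-1) * u_ n z + u_ k z) (fun z => (-1) * u_ n z + u_ k z) <=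
    (2 * 2^-1 ^+ n) ^+ 2.
  move=> nk.
  (* [S] is only closed under [a * u + v]. The midpoint of [u_ n] and [u_ k] is therefore written
     with a zero vector as last summand, on which [F] and [B] vanish. *)
  have s0 : S (fun z => (-1) * u_ n z + u_ n z) by exact: Slin.
  have sh : S (fun z => 2^-1 * u_ n z + (2^-1 * u_ k z + ((-1) * u_ n z + u_ n z))).
    by do 2 apply: Slin => //.
  have F0 : F (fun z => (-1) * u_ n z + u_ n z) = 0 by rewrite Flin//; ring.
  have Bz v : S v -> B (fun z => (-1) * u_ n z + u_ n z) v = 0.
    by move=> sv; rewrite Blin//; ring.
  have := mJ _ sh.
  have sk : S (fun z => 2^-1 * u_ k z + ((-1) * u_ n z + u_ n z)) by exact: Slin.
  rewrite /J Flin// Flin// F0 form_sqr// (form_sqr _ (su k) s0).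
  rewrite (Bsym (su n) sk) (Blin _ (su k) s0 (su n)) (Bsym (su k) s0).
  rewrite (form_sqr _ (su n) (su k)) (Bsym (su k) (su n)).
  rewrite !Bz//.
  have := Ju n; have := Ju k; rewrite /J.
  have : 4^-1 ^+ k <= 4^-1 ^+ n :> R by rewrite ler_wiXn2l//; lra.
  rewrite exprMn -e4; move: (4^-1 ^+ n) (4^-1 ^+ k) => x y.
  move: (B (u_ n) (u_ n)) (B (u_ n) (u_ k)) (B (u_ k) (u_ k)) (F _) (F _) => a b c d e.
  by move=> h1 h2 h3 h4; lra.
have [w [C' [C'0 sw hw]]] := Bcomplete (ler0n R 2) su cau.
exists w => // v sv.
apply/eqP; rewrite -subr_eq0; apply/eqP.
pose M := (1 + B v v) + C' * Num.sqrt (B v v).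
have key n : `|B w v - F v| <= M * 2^-1 ^+ n.
  have d1 : `|B (u_ n) v - F v| <= (1 + B v v) * 2^-1 ^+ n.
    (* As [u_ n] is nearly minimal, moving it along [t v] lowers [J] by at most [4^-1 ^+ n]. The
       choice [t = 2^-1 ^+ n] and its opposite balance this defect against the term in [t ^+ 2]. *)
    have step t : - 4^-1 ^+ n <= 2 * t * (B (u_ n) v - F v) + t ^+ 2 * B v v.
      have := mJ _ (Slin t sv (su n)); have := Ju n.
      rewrite /J Flin// form_sqr// (Bsym sv (su n)); move=> *; lra.
    have := step (2^-1 ^+ n); have := step (- 2^-1 ^+ n).
    have p0 : 0 < 2^-1 ^+ n :> R by rewrite exprn_gt0.
    rewrite e4; move: (2^-1 ^+ n) p0 (B (u_ n) v - F v) (B v v) (Bge0 sv) => x x0 y b b0.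
    move=> h1 h2.
    have k1 : 2 * y <= x + x * b by rewrite -(ler_pM2l x0); lra.
    have k2 : - (2 * y) <= x + x * b by rewrite -(ler_pM2l x0); lra.
    have k3 : 0 <= x * b by rewrite mulr_ge0// ltW.
    by rewrite ler_norml; apply/andP; split; lra.
  have d2 : `|B w v - B (u_ n) v| <= (C' * Num.sqrt (B v v)) * 2^-1 ^+ n.
    have -> : B w v - B (u_ n) v = B (fun z => (-1) * u_ n z + w z) v.
      by rewrite Blin//; ring.
    apply: (le_trans (form_abs_le (Slin _ (su n) sw) sv)).
    rewrite mulrAC ler_wpM2r ?sqrtr_ge0//.
    rewrite -[leRHS]ger0_norm ?mulr_ge0 ?exprn_ge0// -sqrtr_sqr ler_sqrt ?sqr_ge0//.
  rewrite /M mulrDl.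
  have -> : B w v - F v = (B (u_ n) v - F v) + (B w v - B (u_ n) v) by ring.
  exact: (le_trans (ler_normD _ _)) (lerD _ _).
apply/eqP; rewrite -normr_le0; apply/ler_addgt0Pl => e e0; rewrite addr0.
have M0 : 0 <= M by rewrite !addr_ge0 ?mulr_ge0 ?sqrtr_ge0 ?Bge0.
have c0 : (fun n => M * 2^-1 ^+ n) @ \oo --> (0 : R).
  rewrite -(mulr0 M); apply: cvgMr; apply: cvg_expr.
  by rewrite ger0_norm//; lra.
have := cvgr_lt _ c0 _ e0 => -[n _ /(_ n)] /= h.
by apply: (le_trans (key n)); apply/ltW/h.
Qed.

End riesz.

(** * Smooth bump functions *)

Section smooth.
Context {R : realType}.
Implicit Types (a b : R -> R) (p : {poly R}).

Fixpoint smooth1 (k : nat) (a : R -> R) : Prop :=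
  if k is k'.+1 then
    exists2 a', (forall x, is_derive x (1:R) a (a' x)) & smooth1 k' a'
  else continuous a.

Lemma is_derive_continuous (a : R -> R) (x d : R) :
  is_derive x (1:R) a d -> {for x, continuous a}.
Proof. by move=> h; apply/differentiable_continuous/derivable1_diffP/ex_derive. Qed.

Lemma smooth1_continuous k a : smooth1 k a -> continuous a.
Proof.
by case: k => [//|k [a' da _] x]; exact: is_derive_continuous (da x).
Qed.

Lemma smooth1W k a : smooth1 k.+1 a -> smooth1 k a.
Proof.
elim: k a => [a sa|k IH a [a' da sa']]; first exact: smooth1_continuous sa.
by exists a' => //; exact: IH.
Qed.

Lemma smooth1_cst k (c : R) : smooth1 k (cst c).
Proof.
elim: k c => [c x|k IH c]; first exact: cvg_cst.
by exists (cst 0) => // x; exact: is_derive_cst.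
Qed.

Lemma smooth1D k a b : smooth1 k a -> smooth1 k b -> smooth1 k (a + b).
Proof.
elim: k a b => [a b ca cb x|k IH a b [a' da sa] [b' db sb]].
  by apply: cvgD; [exact: ca|exact: cb].
by exists (a' + b'); [move=> x; exact: is_deriveD|exact: IH].
Qed.

Lemma smooth1M k a b : smooth1 k a -> smooth1 k b -> smooth1 k (a * b).
Proof.
elim: k a b => [a b ca cb x|k IH a b sa sb].
  by apply: cvgM; [exact: ca|exact: cb].
have [a' da sa'] := sa; have [b' db sb'] := sb.
exists (a * b' + b * a'); first by move=> x; exact: is_deriveM.
by apply: smooth1D; apply: IH => //; exact: smooth1W.
Qed.

Lemma smooth1_affine k a (c d : R) : smooth1 k a ->
  smooth1 k (fun x => a (c * x + d)).
Proof.
have daff x : is_derive x (1:R) (fun x => c * x + d) c.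
  apply/is_derive1_caratheodory; exists (cst c); split=> //.
  - by move=> z /=; ring.
  - exact: cst_continuous.
elim: k a => [a ca x|k IH a [a' da sa]].
  by apply: (@continuous_comp _ _ _ (fun x => c * x + d) a);
    [exact: is_derive_continuous (daff x)|exact: ca].
exists (cst c * (fun x => a' (c * x + d))); last first.
  by apply: smooth1M; [exact: smooth1_cst|exact: IH].
move=> x; have := @is_derive1_comp R a (fun x => c * x + d) x _ _ (da _) (daff x).
by rewrite mulrC.
Qed.

(** The polynomial factor makes the family closed under differentiation, so that smoothness, also at
    0, is an induction over a single derivative formula. *)
Definition flat p (x : R) : R := if 0 < x then p.[x^-1] * expR (- x^-1) else 0.

Lemma poly_le_expR p : exists2 M, 0 <= M &
  forall u : R, 0 <= u -> `|p.[u]| <= M * expR u.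
Proof.
have Xn n (u : R) : 0 <= u -> u ^+ n <= n`!%:R * expR u.
  move=> u0; case: n => [|n].
    by rewrite expr0 fact0 mul1r; apply: le_trans (expR_ge1Dx u); lra.
  have f0 : 0 < n.+1`!%:R :> R by rewrite ltr0n fact_gt0.
  rewrite mulrC -ler_pdivrMr//; apply: le_trans (expR_ge1Dxn n u0); lra.
exists (\sum_(i < size p) `|p`_i| * i`!%:R).
  by apply: sumr_ge0 => i _; rewrite mulr_ge0.
move=> u u0; rewrite horner_coef mulr_suml; apply: (le_trans (ler_norm_sum _ _ _)).
apply: ler_sum => i _; rewrite normrM -mulrA ler_wpM2l//.
by rewrite ger0_norm ?exprn_ge0// Xn.
Qed.

(** This is [poly_le_expR] for [p * 'X^2] at [x^-1]. Quadratic smallness gives the derivative 0 at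
    the origin. *)
Lemma flat_small p : exists2 M, 0 <= M & forall x, `|flat p x| <= M * (x * x).
Proof.
have [M M0 h] := poly_le_expR (p * 'X^2).
exists M => // x; rewrite /flat; case: ifPn => x0; last first.
  by rewrite normr0 mulr_ge0// -expr2 sqr_ge0.
have := h x^-1; rewrite invr_ge0 (ltW x0) => /(_ isT).
rewrite hornerM hornerXn !normrM => k.
have xx : 0 < x * x by rewrite mulr_gt0.
rewrite -ler_pdivrMr// (ger0_norm (expR_ge0 _)) expRN.
rewrite mulrAC ler_pdivrMr ?expR_gt0//; apply: le_trans k.
by rewrite -normrM -invfM (@gtr0_norm _ (x * x)^-1) ?invr_gt0.
Qed.

Lemma is_derive_flat p x : is_derive x (1:R) (flat p) (flat ('X^2 * (p - p^`())) x).
Proof.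
have [x0|x0|->] := ltgtP x 0.
- have -> : flat ('X^2 * (p - p^`())) x = 0 by rewrite /flat ltNge (ltW x0).
  apply: (@near_eq_is_derive _ _ _ (cst 0)).
  near=> z; rewrite /flat ltNge ifF//; apply/negbTE; rewrite negbK ltW//.
  by near: z; exact: lt_nbhsl.
- apply: (@near_eq_is_derive _ _ _ (fun z : R => p.[z^-1] * expR (- z^-1))).
    near=> z; rewrite /flat ifT//.
    by near: z; exact: lt_nbhsr.
  have xn0 : x != 0 by rewrite gt_eqF.
  have dV : is_derive x (1:R) (fun z : R => z^-1) (- x ^- 2 *: 1).
    exact: (@is_deriveV _ id).
  have dp := is_derive1_comp (is_derive_poly p x^-1) dV.
  have de := @is_derive1_comp R expR (fun z => - z^-1) x _ _ (is_derive_expR _) (is_deriveN dV).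
  refine (is_derive_eq (is_deriveM dp de) _).
  rewrite /flat x0 hornerM hornerXn !hornerE /= /GRing.scale /=; field.
  exact: xn0.
- have -> : flat ('X^2 * (p - p^`())) 0 = 0 by rewrite /flat ltxx.
  have [M M0 h] := flat_small p.
  (* The slope function at 0; division by zero gives it the value 0 there, which is the claimed
     derivative. *)
  apply/is_derive1_caratheodory; exists (fun z => flat p z / z); split.
  + move=> z; rewrite subr0 {2}/flat ltxx subr0.
    by have [->|z0] := eqVneq z 0; [rewrite mulr0 /flat ltxx|rewrite divfK].
  + apply/cvgrPdist_lt => e e0; near=> z.
    rewrite {1}/flat ltxx mul0r sub0r normrN normrM normfV.
    have [->|z0] := eqVneq z 0; first by rewrite normr0 invr0 mulr0.
    rewrite ltr_pdivrMr ?normr_gt0//; apply: (le_lt_trans (h z)).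
    rewrite -expr2 -(real_normK (num_real z)) expr2 mulrA ltr_pM2r ?normr_gt0//.
    rewrite (@le_lt_trans _ _ ((M + 1) * `|z|))// ?ler_wpM2r//; first lra.
    rewrite -ltr_pdivlMl; last lra.
    near: z; apply: (@nbhs0_lt _ R); rewrite mulr_gt0// invr_gt0; lra.
  + by rewrite invr0 mulr0.
Unshelve. all: by end_near. Qed.

Lemma smooth1_flat k p : smooth1 k (flat p).
Proof.
elim: k p => [p x|k IH p]; first exact: is_derive_continuous (is_derive_flat p x).
by exists (flat ('X^2 * (p - p^`()))) => // x; exact: is_derive_flat.
Qed.

(* Equal to [exp (- 1 / (m (t - r)) - 1 / (m (s - t)))] on ]r, s[ with
   [m = n + 1], so that it increases to the indicator of ]r, s[. *)
Definition bump (r s : R) (n : nat) (t : R) : R :=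
  flat 1 (n.+1%:R * (t - r)) * flat 1 (n.+1%:R * (s - t)).

Lemma smooth1_bump r s n k : smooth1 k (bump r s n).
Proof.
apply: smooth1M.
  have := @smooth1_affine k (flat 1) n.+1%:R (- (n.+1%:R * r)) (smooth1_flat k 1).
  by under eq_fun do rewrite -mulrBr.
have := @smooth1_affine k (flat 1) (- n.+1%:R) (n.+1%:R * s) (smooth1_flat k 1).
by under eq_fun do rewrite mulNr addrC -mulrBr.
Qed.

Lemma flat1_bound x : 0 <= flat 1 x <= 1.
Proof.
rewrite /flat; case: ifPn => x0; last by rewrite lexx ler01.
by rewrite hornerE mul1r expR_ge0 expR_le1 oppr_le0 invr_ge0 ltW.
Qed.

Lemma bump_bound r s n t : 0 <= bump r s n t <= 1.
Proof.
have /andP[a0 a1] := flat1_bound (n.+1%:R * (t - r)).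
have /andP[b0 b1] := flat1_bound (n.+1%:R * (s - t)).
by rewrite mulr_ge0//= mulr_ile1.
Qed.

Lemma bump_out r s n t : ~~ (r < t < s) -> bump r s n t = 0.
Proof.
rewrite negb_and /bump /flat => /orP[h|h].
  by rewrite pmulr_rgt0// subr_gt0 (negbTE h) mul0r.
by rewrite [X in _ * (if X then _ else _)]pmulr_rgt0// subr_gt0 (negbTE h) mulr0.
Qed.

Lemma flat1_gt0 (x : R) : 0 < x -> 0 < flat 1 x.
Proof. by move=> x0; rewrite /flat x0 hornerE mulr_gt0 ?expR_gt0 ?ltr01. Qed.

Lemma bump_gt0 r s n t : r < t < s -> 0 < bump r s n t.
Proof. by move=> /andP[rt ts]; rewrite mulr_gt0// flat1_gt0// mulr_gt0// subr_gt0. Qed.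

Lemma flat1_cvg (x : R) : 0 < x -> (fun n => flat 1 (n.+1%:R * x)) @ \oo --> (1 : R).
Proof.
move=> x0.
have -> : (fun n => flat 1 (n.+1%:R * x)) =
    (fun n => expR (- (n.+1%:R^-1 * x^-1))).
  by apply/funext => n; rewrite /flat pmulr_rgt0// x0 hornerE mul1r invfM.
have c0 : (fun n => - (n.+1%:R^-1 * x^-1)) @ \oo --> (0 : R).
  rewrite -[X in _ --> X]oppr0 -[X in _ --> - X](mul0r x^-1).
  by apply: cvgN; apply: cvgMl; exact: cvg_harmonic.
rewrite -[X in _ --> X]expR0.
exact: (cvg_comp _ _ c0 (@continuous_expR R 0)).
Qed.

Lemma bump_cvg r s t : bump r s ^~ t @ \oo --> (\1_`]r, s[%classic t : R).
Proof.
have [h|h] := boolP (r < t < s).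
  rewrite indicE mem_set//= -[X in _ --> X](mulr1 1).
  case/andP: h => rt ts.
  by apply: cvgM; apply: flat1_cvg; rewrite subr_gt0.
rewrite indicE memNset/=; last by rewrite in_itv/=; exact/negP.
under eq_fun do rewrite bump_out//.
exact: cvg_cst.
Qed.

Lemma smooth1_measurable k a (D : set R) : smooth1 k a ->
  measurable_fun (D : set (measurableTypeR R)) a.
Proof.
by move=> /smooth1_continuous ca; apply: measurable_funTS; exact: continuous_measurable_fun.
Qed.

End smooth.

(** * Absolutely continuous functions of one variable *)

#[global] Instance ae_lebesgue_filter (R : realType) :
  Filter (nbhs (almost_everywhere (@lebesgue_measure R))).
Proof.
exact: (@ae_filter_ringOfSetsType _ (measurableTypeR R) R (@lebesgue_measure R)).
Qed.

Section one_dim.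
Context {R : realType}.
Local Notation mu := (@lebesgue_measure R).
Implicit Types (a b c r s x y : R) (f g F G : R -> R).

Lemma itvoo_fin a b : (mu `]a, b[%classic < +oo)%E.
Proof. by rewrite lebesgue_measure_itv/=; case: ifP => _; rewrite ltry. Qed.

Lemma itvoo_fine a b : a <= b -> fine (mu `]a, b[%classic) = b - a.
Proof.
rewrite le_eqVlt => /predU1P[->|ab]; rewrite lebesgue_measure_itv/=.
  by rewrite ltxx subrr.
by rewrite lte_fin ab.
Qed.

Definition prim a g x : R := \int[mu]_(t in `]a, x[) g t.
Definition tailprim b g x : R := \int[mu]_(t in `]x, b[) g t.

Lemma intg_sub a b x y g : intg mu `]a, b[%classic g -> a <= x -> y <= b ->
  intg mu `]x, y[%classic g.
Proof.
move=> gi ax yb; apply: integrableS gi => //.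
by apply: subset_itv; rewrite bnd_simp.
Qed.

Lemma prim_sub a b x y g : intg mu `]a, b[%classic g -> a <= x -> x <= y -> y <= b ->
  prim a g y - prim a g x = \int[mu]_(t in `]x, y[) g t.
Proof.
move=> gi ax xy yb; have [->|xny] := eqVneq x y.
  by rewrite subrr set_itvoo0// Rintegral_set0.
have lxy : x < y by rewrite lt_neqAle xny.
rewrite /prim [X in _ - X]Rintegral_itv_bndo_bndc; last first.
  by apply: (intg_sub gi) => //; exact: le_trans yb.
rewrite Rintegral_itvB//; first exact: (intg_sub gi).
Qed.

Lemma prim_le a b x g : intg mu `]a, b[%classic g -> x <= b ->
  `|prim a g x| <= \int[mu]_(t in `]a, b[) `|g t|.
Proof.
move=> gi xb; have gi' := intg_sub gi (lexx a) xb.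
apply: (le_trans (le_normr_Rintegral _ gi')) => //.
apply: fine_le.
- by apply: integrable_fin_num => //; exact: (intg_abs gi').
- by apply: integrable_fin_num => //; exact: (intg_abs gi).
- apply: ge0_subset_integral => //.
  + by apply: measurable_int (intg_abs gi).
  + by apply: subset_itv; rewrite bnd_simp.
Qed.

Lemma prim_tailprim a b x g : intg mu `]a, b[%classic g -> a <= x -> x <= b ->
  tailprim b g x = prim a g b - prim a g x.
Proof. by move=> gi ax xb; rewrite (prim_sub gi). Qed.

Lemma prim_continuous a b g : a <= b -> intg mu `]a, b[%classic g ->
  {within `[a, b], continuous (prim a g)}.
Proof.
move=> ab gi.
have gi' : mu.-integrable `[a, b] (EFin \o (g \_ `]a, b[%classic)).
  apply: (integrableS measurableT) => //.
  have := (integrable_mkcond _ _).1 gi.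
  by rewrite restrict_EFin; apply.
have := parameterized_integral_continuous ab gi'.
apply: subspace_eq_continuous => x; rewrite inE/= in_itv/= => /andP[ax xb].
rewrite /from_subspace /parameterized_integral /prim.
rewrite -Rintegral_itv_bndo_bndc; last first.
  by apply: (integrableS _ _ _ gi') => //; apply: subset_itv; rewrite bnd_simp.
rewrite -Rintegral_itv_obnd_cbnd; last first.
  by apply: (integrableS _ _ _ gi') => //; apply: subset_itv; rewrite bnd_simp.
apply: eq_Rintegral => t; rewrite inE/= in_itv/= => /andP[at_ tx].
by rewrite patchE mem_set//= in_itv/= at_ (lt_le_trans tx).
Qed.

Lemma prim_measurable a b g : intg mu `]a, b[%classic g ->
  measurable_fun `]a, b[%classic (prim a g).
Proof.
move=> gi; have [ab|ba] := ltP a b; last first.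
  by rewrite (_ : `]a, b[%classic = set0);
    [exact: measurable_fun_set0|apply/seteqP; split=> // x /=];
    rewrite in_itv/= => /andP[ax xb]; lra.
apply: (@measurable_funS _ _ _ _ `[a, b]%classic) => //.
  by apply: subset_itv; rewrite bnd_simp.
apply: subspace_continuous_measurable_fun => //.
by apply: prim_continuous => //; exact: ltW.
Qed.

Lemma intg_restrict (A : set R) g : measurable (A : set (measurableTypeR R)) ->
  intg mu A g -> intg mu setT (g \_ A).
Proof. by move=> mA gi; have := (integrable_mkcond _ mA).1 gi; rewrite restrict_EFin. Qed.

(** Both sides are iterated integrals of [g s * f x] over the triangle [a < s < x < b]. This is
    integration by parts for functions that are merely integrable, and the later forms rest on
    it. *)
Lemma triangle_fubini a b g f :
  intg mu `]a, b[%classic g -> intg mu `]a, b[%classic f ->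
  \int[mu]_(x in `]a, b[) (prim a g x * f x) =
  \int[mu]_(s in `]a, b[) (g s * tailprim b f s).
Proof.
move=> gi fi; set A := `]a, b[%classic.
have gi' := intg_restrict (measurable_itv _) gi.
have fi' := intg_restrict (measurable_itv _) fi.
set g' := g \_ A in gi'; set f' := f \_ A in fi'.
pose h (z : measurableTypeR R * measurableTypeR R) : R :=
  g' z.2 * f' z.1 * ((z.2 : R) < z.1)%R%:R.
have mh : measurable_fun setT h.
  apply: measurable_funM.
    apply: measurable_funM.
      by apply: (measurableT_comp (intg_meas gi')) => //; exact: measurable_snd.
    by apply: (measurableT_comp (intg_meas fi')) => //; exact: measurable_fst.
  apply: (@measurableT_comp _ _ _ _ _ _ (fun b : bool => b%:R : R)) => //.
  by apply: measurable_fun_ltr; [exact: measurable_snd|exact: measurable_fst].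
have hle z : `|h z| <= `|g' z.2| * `|f' z.1|.
  rewrite /h !normrM; case: ((z.2 : R) < z.1); rewrite ?normr1 ?mulr1//.
  by rewrite normr0 mulr0 mulr_ge0.
have ig' : (\int[mu]_s (`|g' s|)%:E < +oo)%E by case/integrableP : gi'.
have if' : (\int[mu]_s (`|f' s|)%:E < +oo)%E by case/integrableP : fi'.
have ih : (mu \x mu)%E.-integrable setT (EFin \o h).
  apply/integrable12ltyP; first exact/measurable_EFinP.
  apply: (@le_lt_trans _ _ (\int[mu]_x ((\int[mu]_s (`|g' s|)%:E) * (`|f' x|)%:E))%E).
    apply: ge0_le_integral => //.
    - by move=> x _; apply: integral_ge0.
    - apply: (@measurable_fun_fubini_tonelli_F _ _ _ _ _ mu (fun z => `|(h z)%:E|%E)) => //.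
      by apply: measurableT_comp => //; exact/measurable_EFinP.
    - apply: measurable_funeM; apply/measurable_EFinP.
      by apply: measurableT_comp => //; exact: intg_meas fi'.
    - move=> x _; rewrite -ge0_integralZr//; last first.
        by apply/measurable_EFinP; apply: measurableT_comp => //; exact: intg_meas gi'.
      apply: ge0_le_integral => //.
        * apply: measurableT_comp => //; apply/measurable_EFinP.
          exact: (measurableT_comp mh (measurable_pair1 _)).
        * apply: emeasurable_funM => //; apply/measurable_EFinP.
          by apply: measurableT_comp => //; exact: intg_meas gi'.
        * by move=> s _ /=; rewrite lee_fin; exact: hle (x, s).
  rewrite ge0_integralZl//.
  - apply: lte_mul_pinfty => //; first exact: integral_ge0.
    by rewrite ge0_fin_numE//; exact: integral_ge0.
  - by apply/measurable_EFinP; apply: measurableT_comp => //; exact: intg_meas fi'.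
  - by apply: integral_ge0.
have := Fubini ih.
have sec1 x : (\int[mu]_s ((EFin \o h) (x, s)) = ((\int[mu]_(s in `]a, x[) g' s) * f' x)%:E)%E.
  rewrite -RintegralZr//; last first.
    by apply: (integrableS measurableT) => //.
  rewrite /Rintegral fineK; last first.
    apply: integrable_fin_num => //; apply: (integrableS measurableT) => //.
    by have := intgZ measurableT (f' x) gi'; under eq_fun do rewrite mulrC.
  rewrite [RHS]integral_mkcond; apply: eq_integral => s _.
  rewrite patchE /h /=; case: ifPn => [|sn].
    by rewrite inE/= in_itv/= => /andP[_ ->]; rewrite mulr1.
  have [sx|_] := ltP s x; last by rewrite mulr0.
  rewrite /g' patchE; case: ifPn => [|_]; last by rewrite !mul0r.
  rewrite /A inE/= in_itv/= => /andP[as_ _]; exfalso; move/negP: sn; apply.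
  by rewrite inE/= in_itv/= as_ sx.
have sec2 s : (\int[mu]_x ((EFin \o h) (x, s)) = (g' s * (\int[mu]_(x in `]s, b[) f' x))%:E)%E.
  rewrite -RintegralZl//; last first.
    by apply: (integrableS measurableT) => //.
  rewrite /Rintegral fineK; last first.
    apply: integrable_fin_num => //; apply: (integrableS measurableT) => //.
    exact: intgZ.
  rewrite [RHS]integral_mkcond; apply: eq_integral => x _.
  rewrite patchE /h /=; case: ifPn => [|sn].
    by rewrite inE/= in_itv/= => /andP[-> _]; rewrite mulr1.
  have [sx|_] := ltP s x; last by rewrite mulr0.
  rewrite /f' patchE; case: ifPn => [|_]; last by rewrite mulr0 mul0r.
  rewrite /A inE/= in_itv/= => /andP[_ as_]; exfalso; move/negP: sn; apply.
  by rewrite inE/= in_itv/= as_ sx.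
under eq_integral do rewrite sec1.
under [in RHS]eq_integral do rewrite sec2.
move=> /(congr1 fine) E.
rewrite [LHS]Rintegral_mkcond [RHS]Rintegral_mkcond.
move: E; rewrite -/(Rintegral _ _ _) -/(Rintegral _ _ _) => E.
transitivity (\int[mu]_x ((\int[mu]_(s in `]a, x[) g' s) * f' x)).
  apply: eq_Rintegral => x _; rewrite /f' !patchE; case: ifPn => [|_]; last by rewrite mulr0.
  rewrite /A inE/= in_itv/= => /andP[_ xb]; congr (_ * _).
  apply: eq_Rintegral => s; rewrite inE/= in_itv/= => /andP[as_ sx].
  by rewrite /g' patchE mem_set// /A /= in_itv/= as_ (lt_trans sx).
rewrite [LHS]E; apply: eq_Rintegral => s _.
rewrite /g' !patchE; case: ifPn => [|_]; last by rewrite mul0r.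
rewrite /A inE/= in_itv/= => /andP[as_ _]; congr (_ * _).
apply: eq_Rintegral => x; rewrite inE/= in_itv/= => /andP[sx xb].
by rewrite /f' patchE mem_set// /A /= in_itv/= xb (lt_trans as_).
Qed.

End one_dim.

(** * Integration by parts and the product rule for absolutely continuous functions *)

Section abs_cont.
Context {R : realType}.
Local Notation mu := (@lebesgue_measure R).
Implicit Types (a b c r s x y : R) (f g F G beta : R -> R).

(* [F] agrees almost everywhere on ]a, b[ with an absolutely continuous function
   of derivative [G]. *)
Definition ac1 a b F G := [/\ measurable_fun (`]a, b[%classic : set (measurableTypeR R)) F,
  intg mu `]a, b[%classic G &
  exists k, {ae mu, forall x, `]a, b[%classic x -> F x = k + prim a G x}].

Lemma intg_prim a b k G : intg mu `]a, b[%classic G ->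
  intg mu `]a, b[%classic (fun x => k + prim a G x).
Proof.
move=> gi.
apply: (@intg_bounded _ _ _ _ _ _ _ (`|k| + \int[mu]_(t in `]a, b[) `|G t|)) => //.
- exact: itvoo_fin.
- by apply: measurable_funD => //; exact: prim_measurable.
- move=> x; rewrite /= in_itv/= => /andP[_ /ltW xb].
  by apply: (le_trans (ler_normD _ _)); rewrite lerD2l; apply: prim_le.
Qed.

Lemma ac1_intg a b F G : ac1 a b F G -> intg mu `]a, b[%classic F.
Proof.
move=> [mF gi [k Fk]]; apply: intg_ae (intg_prim k gi) mF _ => //.
by apply: filterS Fk => x h /h ->.
Qed.

Lemma intg_primM a b k G beta : intg mu `]a, b[%classic G ->
  intg mu `]a, b[%classic beta ->
  intg mu `]a, b[%classic (fun x => (k + prim a G x) * beta x).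
Proof.
move=> gi bi; apply: intgMl => //.
  by apply: measurable_funD => //; exact: prim_measurable.
exists (`|k| + \int[mu]_(t in `]a, b[) `|G t|) => x.
rewrite /= in_itv/= => /andP[_ /ltW xb].
by apply: (le_trans (ler_normD _ _)); rewrite lerD2l; apply: prim_le.
Qed.

Lemma ac1_intgM a b F G beta : ac1 a b F G -> intg mu `]a, b[%classic beta ->
  intg mu `]a, b[%classic (fun x => F x * beta x).
Proof.
move=> [mF gi [k Fk]] bi; apply: intg_ae (intg_primM k gi bi) _ _ => //.
  by apply: measurable_funM => //; exact: intg_meas bi.
by apply: filterS Fk => x h /h ->.
Qed.

(** The zero mean of [beta] removes the unknown constant [k] of [ac1]; what is left is
    [triangle_fubini]. *)
Lemma ac1_pair a b F G beta : ac1 a b F G -> intg mu `]a, b[%classic beta ->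
  \int[mu]_(x in `]a, b[) beta x = 0 ->
  \int[mu]_(x in `]a, b[) (F x * beta x) =
  \int[mu]_(x in `]a, b[) (G x * tailprim b beta x).
Proof.
move=> [mF gi [k Fk]] bi b0.
have mb := intg_meas bi.
have -> : \int[mu]_(x in `]a, b[) (F x * beta x) =
    \int[mu]_(x in `]a, b[) (k * beta x + prim a G x * beta x).
  apply: Rint_ae => //.
  - exact: measurable_funM.
  - apply: measurable_funD; first exact: measurable_funM.
    by apply: measurable_funM => //; exact: prim_measurable.
  - by apply: filterS Fk => x h /h ->; rewrite mulrDl.
rewrite RintegralD//; last 2 first.
- exact: intgZ.
- have := intg_primM 0 gi bi; congr (intg mu _ _).
  by apply/funext => x; rewrite add0r.
by rewrite RintegralZl// b0 mulr0 add0r triangle_fubini.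
Qed.

Lemma prim_shift a b x k G H : intg mu `]a, b[%classic G ->
  intg mu `]a, b[%classic H -> a <= x -> x <= b ->
  \int[mu]_(t in `]a, x[) ((k + prim a G t) * H t) =
  (k + prim a G x) * prim a H x - \int[mu]_(t in `]a, x[) (G t * prim a H t).
Proof.
move=> gi hi ax xb.
have gi' := intg_sub gi (lexx a) xb; have hi' := intg_sub hi (lexx a) xb.
have iGH : intg mu `]a, x[%classic (fun t => prim a G t * H t).
  have := intg_primM 0 gi' hi'; congr (intg mu _ _).
  by apply/funext => t; rewrite add0r.
have iHG : intg mu `]a, x[%classic (fun t => G t * prim a H t).
  have := intg_primM 0 hi' gi'; congr (intg mu _ _).
  by apply/funext => t; rewrite add0r mulrC.
have -> : \int[mu]_(t in `]a, x[) ((k + prim a G t) * H t) =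
  k * prim a H x + \int[mu]_(t in `]a, x[) (prim a G t * H t).
  rewrite /prim -RintegralZl// -RintegralD//; last exact: intgZ.
  by apply: eq_Rintegral => t _; rewrite mulrDl.
rewrite triangle_fubini//.
have -> : \int[mu]_(s in `]a, x[) (G s * tailprim x H s) =
    \int[mu]_(s in `]a, x[) (prim a H x * G s - G s * prim a H s).
  apply: eq_Rintegral => s; rewrite inE/= in_itv/= => /andP[as_ sx].
  by rewrite (prim_tailprim hi')// ?ltW//; ring.
rewrite RintegralB//; last exact: intgZ.
by rewrite RintegralZl// -/(prim a G x); ring.
Qed.

Lemma ac1_mul a b F1 G1 F2 G2 : ac1 a b F1 G1 -> ac1 a b F2 G2 ->
  ac1 a b (fun x => F1 x * F2 x) (fun x => G1 x * F2 x + F1 x * G2 x).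
Proof.
move=> h1 h2; have [mF1 i1 [k1 e1]] := h1; have [mF2 i2 [k2 e2]] := h2.
have iA : intg mu `]a, b[%classic (fun x => G1 x * F2 x).
  have := ac1_intgM h2 i1; congr (intg mu _ _).
  by apply/funext => t; rewrite mulrC.
have iB : intg mu `]a, b[%classic (fun x => F1 x * G2 x).
  exact: ac1_intgM h1 i2.
split; [exact: measurable_funM|exact: intgD|exists (k1 * k2)].
have H x : `]a, b[%classic x -> (k1 + prim a G1 x) * (k2 + prim a G2 x) =
    k1 * k2 + prim a (fun x => G1 x * F2 x + F1 x * G2 x) x.
  rewrite /= in_itv/= => /andP[/ltW ax /ltW xb].
  have i1' := intg_sub i1 (lexx a) xb; have i2' := intg_sub i2 (lexx a) xb.
  have ss : `]a, x[%classic `<=` `]a, b[%classic.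
    by apply: subset_itv; rewrite bnd_simp.
  have iC : intg mu `]a, x[%classic (fun t => (k2 + prim a G2 t) * G1 t).
    exact: intg_primM.
  have iD : intg mu `]a, x[%classic (fun t => (k1 + prim a G1 t) * G2 t).
    exact: intg_primM.
  have -> : prim a (fun x => G1 x * F2 x + F1 x * G2 x) x =
      \int[mu]_(t in `]a, x[) ((k2 + prim a G2 t) * G1 t + (k1 + prim a G1 t) * G2 t).
    apply: Rint_ae => //.
    - exact: measurable_funS (intg_meas (intgD _ iA iB)).
    - exact: intg_meas (intgD _ iC iD).
    - move: e1 e2; apply: filterS2 => t h1' h2' /ss At.
      by rewrite h1'// h2'//; ring.
  rewrite RintegralD// (prim_shift _ i2 i1)// (prim_shift _ i1 i2)//.
  have iP : intg mu `]a, x[%classic (fun t => prim a G1 t * G2 t).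
    have := intg_primM 0 i1' i2'; congr (intg mu _ _).
    by apply/funext => t; rewrite add0r.
  have iQ : intg mu `]a, x[%classic (fun t => G1 t * prim a G2 t).
    have := intg_primM 0 i2' i1'; congr (intg mu _ _).
    by apply/funext => t; rewrite add0r mulrC.
  (* The two integrations by parts above leave two cross integrals. A third one, with constant 0,
     shows that they add up to the product of the primitives. *)
  have := prim_shift 0 i1 i2 ax xb.
  under eq_Rintegral do rewrite add0r.
  rewrite add0r => E.
  have -> : \int[mu]_(t in `]a, x[) (G2 t * prim a G1 t) =
     \int[mu]_(t in `]a, x[) (prim a G1 t * G2 t).
    by apply: eq_Rintegral => t _; rewrite mulrC.
  by rewrite E; ring.
by move: e1 e2; apply: filterS2 => x h1' h2' Ax; rewrite h1'// h2'// H.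
Qed.

(** [F] differs from its mean by at most its oscillation, and the oscillation by at most the
    integral of [|G|]. *)
Lemma ac1_sup_le a b F G : a < b -> ac1 a b F G ->
  {ae mu, forall x, `]a, b[%classic x -> `|F x| <=
     (b - a)^-1 * `|\int[mu]_(t in `]a, b[) F t| + \int[mu]_(t in `]a, b[) `|G t|}.
Proof.
move=> ab h; have Fi := ac1_intg h; have [mF Gi [k Fk]] := h.
set I := \int[mu]_(t in `]a, b[) `|G t|.
apply: filterS (Fk) => x hx Ax; have {}hx := hx Ax.
move: Ax; rewrite /= in_itv/= => /andP[/ltW ax /ltW xb].
have osc y : `]a, b[%classic y -> `|prim a G x - prim a G y| <= I.
  rewrite /= in_itv/= => /andP[/ltW ay /ltW yb].
  wlog xy : x y ax xb ay yb {hx} / y <= x.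
    by move=> W; case/orP: (le_total y x) => [|yx]; [exact: W|rewrite distrC; exact: W].
  rewrite (prim_sub Gi)//; have Gi' := intg_sub Gi ay xb.
  apply: (le_trans (le_normr_Rintegral _ Gi')) => //.
  apply: fine_le.
  - by apply: integrable_fin_num => //; exact: (intg_abs Gi').
  - by apply: integrable_fin_num => //; exact: (intg_abs Gi).
  - apply: ge0_subset_integral => //.
    + by apply: measurable_int (intg_abs Gi).
    + by apply: subset_itv; rewrite bnd_simp.
have ba : 0 < b - a by rewrite subr_gt0.
have ci : intg mu `]a, b[%classic (fun=> F x).
  by apply: (@intg_bounded _ _ _ _ _ _ _ `|F x|) => //; exact: itvoo_fin.
have : `|\int[mu]_(t in `]a, b[) (F x - F t)| <= I * fine (mu `]a, b[%classic).
  apply: Rint_abs_le => //; first exact: itvoo_fin.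
    exact: intgB.
  apply: filterS Fk => y hy Ay; rewrite hy// hx.
  have -> : k + prim a G x - (k + prim a G y) = prim a G x - prim a G y by ring.
  exact: osc.
rewrite RintegralB// Rintegral_cst// itvoo_fine; [move=> h1|exact: ltW].
rewrite -(ler_pM2l ba) mulrDr mulrA divff ?gt_eqF// mul1r [_ * I]mulrC.
set J := \int[mu]_(t in `]a, b[) F t in h1 *.
have -> : (b - a) * `|F x| = `|J + (F x * (b - a) - J)|.
  by rewrite [J + _]addrC subrK normrM (ger0_norm (ltW ba)) mulrC.
by apply: (le_trans (ler_normD _ _)); rewrite lerD2l.
Qed.

End abs_cont.

(** * The du Bois-Reymond lemma *)

Lemma Rint_dominated d (T : measurableType d) (R : realType)
    (mu : {measure set T -> \bar R}) (D : set T) (mD : measurable D)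
    (f_ : nat -> T -> R) (f g : T -> R) :
  (forall n, measurable_fun D (f_ n)) -> measurable_fun D f ->
  {ae mu, forall x, D x -> f_ ^~ x @ \oo --> f x} -> intg mu D g ->
  {ae mu, forall x n, D x -> `|f_ n x| <= g x} ->
  (fun n => \int[mu]_(x in D) f_ n x) @ \oo --> \int[mu]_(x in D) f x.
Proof.
move=> mf_ mf cf gi fg.
have cf' : {ae mu, forall x, D x ->
    (fun n => (f_ n x)%:E) @ \oo --> (f x)%:E}.
  by apply: filterS cf => x h Dx; apply: cvg_EFin; [exact: nearW|exact: h].
have [fi _ C] := @dominated_convergence _ _ R mu D mD (fun n x => (f_ n x)%:E)
  (EFin \o f) (EFin \o g) (fun n => (measurable_EFinP _ _).2 (mf_ n))
  ((measurable_EFinP _ _).2 mf) cf' gi fg.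
by apply: (fine_cvg (a := \int[mu]_(x in D) f x)); rewrite fineK//; exact: integrable_fin_num.
Qed.

Section fundamental1.
Context {R : realType}.
Local Notation mu := (@lebesgue_measure R).
Implicit Types (a b c r s x y : R) (f g F G h : R -> R).

(* A countable family of test functions, so that a statement holding for each
   of them almost everywhere holds almost everywhere for all of them. *)
Definition ratbump a b (i : rat * rat * nat) : R -> R :=
  let r := ratr i.1.1 in let s := ratr i.1.2 in
  if (a < r) && (s < b) then bump r s i.2 else cst 0.

Lemma ratbump_smooth a b i k : smooth1 k (ratbump a b i).
Proof.
rewrite /ratbump; case: ifP => _; [exact: smooth1_bump|exact: smooth1_cst].
Qed.

Lemma ratbump_bound a b i t : `|ratbump a b i t| <= 1.
Proof.
rewrite /ratbump; case: ifP => _; last by rewrite normr0.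
by have /andP[? ?] := bump_bound (ratr i.1.1) (ratr i.1.2) i.2 t; rewrite ger0_norm.
Qed.

Lemma ratbump_meas a b i (D : set (measurableTypeR R)) : measurable_fun D (ratbump a b i).
Proof. exact: (smooth1_measurable (ratbump_smooth a b i 0)). Qed.

Lemma ratbump_supp a b i : a < b -> exists r s, [/\ a < r, s < b &
  forall t, ~~ (r < t < s) -> ratbump a b i t = 0].
Proof.
move=> ab; rewrite /ratbump; case: ifP => [/andP[ar sb]|_].
  by exists (ratr i.1.1), (ratr i.1.2); split=> // t; exact: bump_out.
by exists ((a + b) / 2), ((a + b) / 2); split => //; lra.
Qed.

Lemma intg_ratbumpM a b i h : intg mu `]a, b[%classic h ->
  intg mu `]a, b[%classic (fun x => h x * ratbump a b i x).
Proof.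
move=> hi; have : intg mu `]a, b[%classic (fun x => ratbump a b i x * h x).
  apply: intgMl => //; first exact: ratbump_meas.
  by exists 1 => x _; exact: ratbump_bound.
by congr (intg mu _ _); apply/funext => x; rewrite mulrC.
Qed.

Lemma bump_integral_oo a b r s h : intg mu `]a, b[%classic h -> a < r -> s < b ->
  (forall n, \int[mu]_(x in `]a, b[) (h x * bump r s n x) = 0) ->
  \int[mu]_(x in `]r, s[) h x = 0.
Proof.
move=> hi ar sb h0.
have ss : `]r, s[%classic `<=` `]a, b[%classic.
  by apply: subset_itv; rewrite bnd_simp ltW.
have mh := intg_meas hi.
have i1 : intg mu `]a, b[%classic (fun x => h x * \1_`]r, s[%classic x).
  apply: (@intg_le _ (measurableTypeR R) R mu _ _ _ (fun x => `|h x|)) => //; last exact: intg_abs.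
  - by apply: measurable_funM => //; exact: measurable_indic.
  - by move=> x _; rewrite normrM ler_piMr// indicE; case: (_ \in _); rewrite ?normr1 ?normr0.
have -> : \int[mu]_(x in `]r, s[) h x =
    \int[mu]_(x in `]a, b[) (h x * \1_`]r, s[%classic x).
  rewrite [LHS]Rintegral_mkcond [RHS]Rintegral_mkcond; apply: eq_Rintegral => x _.
  rewrite !patchE indicE; case: ifPn => [xrs|xrs].
    by rewrite mem_set ?mulr1//; apply: ss; rewrite inE in xrs.
  by rewrite mulr0; case: ifP.
have C := @Rint_dominated _ _ R mu `]a, b[%classic (measurable_itv _)
  (fun n x => h x * bump r s n x) (fun x => h x * \1_`]r, s[%classic x)
  (fun x => `|h x|).
have cl : (fun n => \int[mu]_(x in `]a, b[) (h x * bump r s n x)) @ \oo -->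
    \int[mu]_(x in `]a, b[) (h x * \1_`]r, s[%classic x).
  apply: C.
  - move=> n; apply: measurable_funM => //.
    exact: (smooth1_measurable (smooth1_bump r s n 0)).
  - exact: intg_meas i1.
  - by apply: aeW => x _; apply: cvgMr; exact: bump_cvg.
  - exact: intg_abs.
  - apply: aeW => x n _; rewrite normrM ler_piMr//.
    by have /andP[? ?] := bump_bound r s n x; rewrite ger0_norm.
move: cl; under eq_fun do rewrite h0; move=> cl.
by rewrite -(cvg_lim _ cl)//; exact: lim_cst.
Qed.

(** Letting the bumps tend to indicators, the integral of [h] over every interval with rational end
    points vanishes, so its primitive is constant on the rationals of []a, b[]. At a point where
    this primitive has derivative [h x], rationals close to [x] on both sides force [h x = 0]. *)
Lemma ratbump_ae0 a b h : intg mu `]a, b[%classic h ->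
  (forall i, \int[mu]_(x in `]a, b[) (h x * ratbump a b i x) = 0) ->
  {ae mu, forall x, `]a, b[%classic x -> h x = 0}.
Proof.
move=> hi h0.
have rs0 (p q : rat) : a < ratr p -> ratr q < b -> \int[mu]_(x in `]ratr p, ratr q[) h x = 0.
  move=> ap qb; apply: (bump_integral_oo hi ap qb) => n.
  by have := h0 (p, q, n); rewrite /ratbump /= ap qb.
have hi' := intg_restrict (measurable_itv _) hi.
set h' := h \_ `]a, b[%classic in hi'.
have li : locally_integrable [set: R] h' by exact: integrable_locally.
have iy y : mu.-integrable `]-oo, y] (EFin \o h') by exact: integrableS hi'.
have := FTC1Ny iy li; cbv zeta.
set F := (fun x : R => \int[mu]_(t in `]-oo, x]) h' t).
have FE (p q : rat) : a < ratr p -> ratr p < (ratr q : R) -> ratr q < b ->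
    F (ratr q) = F (ratr p).
  move=> ap pq qb; apply/eqP; rewrite -subr_eq0; apply/eqP.
  rewrite /F Rintegral_itvB//; last by rewrite bnd_simp ltW.
  rewrite -Rintegral_itv_bndo_bndc; last by apply: integrableS hi'.
  rewrite -[RHS](rs0 p q ap qb); apply: eq_Rintegral => t; rewrite inE/= in_itv/= => /andP[pt tq].
  by rewrite /h' patchE mem_set//= in_itv/= (lt_trans ap pt) (lt_trans tq qb).
apply: filterS => x [dF Fx] xab; apply/eqP/negP => /negP hx0.
have {}Fx : F^`()%classic x = h x by rewrite Fx /h' patchE mem_set.
have d0 : 0 < `|h x| / 2 by rewrite divr_gt0 ?normr_gt0.
move: dF; rewrite /derivable => dF.
have cF : (fun t => t^-1 *: (F (t *: 1 + x) - F x)) @ 0^' --> h x.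
  by rewrite -Fx derive1E.
have [e /= e0 H] := (@cvgrPdist_lt _ _ _ _ _ _ _).1 cF _ d0.
have {}H t : t != 0 -> `|t| < e -> `|t * h x - (F (t + x) - F x)| < `|t| * (`|h x| / 2).
  move=> t0 te; have := H t; rewrite /ball/= sub0r normrN => /(_ te t0).
  rewrite scaler1 /GRing.scale/= -(@ltr_pM2l _ `|t|) ?normr_gt0//.
  by rewrite -normrM mulrBr mulVKf.
move: xab; rewrite /= in_itv/= => /andP[ax xb].
have [q xq] : exists q : rat, x < ratr q < Num.min b (x + e).
  have : x < Num.min b (x + e) by rewrite lt_min xb; lra.
  by move=> /rat_in_itvoo[q]; rewrite in_itv/= => ?; exists q.
have [p px] : exists p : rat, Num.max a (x - e) < ratr p < x.
  have : Num.max a (x - e) < x by rewrite gt_max ax; lra.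
  by move=> /rat_in_itvoo[q']; rewrite in_itv/= => ?; exists q'.
move: xq px; rewrite lt_min gt_max => /andP[xq /andP[qb qe]] /andP[/andP[ap ep] px].
have := H (ratr q - x); rewrite subrK subr_eq0 gt_eqF// gtr0_norm ?subr_gt0//.
rewrite ltrBlDl => /(_ isT qe) H1.
have := H (ratr p - x); rewrite subrK subr_eq0 lt_eqF// ltr0_norm ?subr_lt0//.
have -> : - (ratr p - x) = x - ratr p by ring.
rewrite ltrBlDl -ltrBlDr => /(_ isT ep).
rewrite -(FE p q ap (lt_trans px xq) qb) => H2.
have := ler_normB ((ratr q - x) * h x - (F (ratr q) - F x)) ((ratr p - x) * h x - (F (ratr q) - F x)).
have -> : (ratr q - x) * h x - (F (ratr q) - F x) - ((ratr p - x) * h x - (F (ratr q) - F x))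
   = (ratr q - ratr p) * h x by ring.
rewrite normrM gtr0_norm ?subr_gt0 ?(lt_trans px)// => H3.
have P : 0 < (ratr q - ratr p) * `|h x|.
  by rewrite mulr_gt0 ?normr_gt0// subr_gt0 (lt_trans px).
have := le_lt_trans H3 (ltrD H1 H2); move: P; clear.
move: (ratr q) (ratr p) `|h x| => u v w; lra.
Qed.

Definition test1 a b (al : R -> R) := (forall k, smooth1 k al) /\
  exists r s, [/\ a < r, s < b & forall t, ~~ (r < t < s) -> al t = 0].

Lemma ratbump_test1 a b i : a < b -> test1 a b (ratbump a b i).
Proof. by move=> ab; split; [exact: ratbump_smooth|exact: ratbump_supp]. Qed.

Lemma continuous_intg a b f : continuous f -> intg mu `]a, b[%classic f.
Proof.
move=> cf; have : mu.-integrable `[a, b] (EFin \o f).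
  apply: continuous_compact_integrable; first exact: segment_compact.
  exact: continuous_subspaceT.
by apply: integrableS => //; apply: subset_itv; rewrite bnd_simp.
Qed.

(** Integration starts at minus infinity and not at [a], so that the result is differentiable on the
    whole line, as a test function has to be. *)
Definition tprim (psi : R -> R) (x : R) : R := \int[mu]_(t in `]-oo, x]) psi t.

(** The zero mean makes the primitive vanish to the right of the support of [psi] as well, hence it
    is again compactly supported in the interval. *)
Lemma tprimP a b psi : test1 a b psi -> \int[mu]_(x in `]a, b[) psi x = 0 ->
  [/\ test1 a b (tprim psi), forall x, is_derive x (1:R) (tprim psi) (psi x) &
      forall x, x \in `]a, b[ -> tprim psi x = prim a psi x].
Proof.
move=> [spsi [r [s [ar sb supp]]]] i0.
have cpsi := smooth1_continuous (spsi 0%N).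
have pab : psi = psi \_ `]a, b[%classic.
  apply/funext => t; rewrite patchE; case: ifPn => // tab.
  rewrite supp//; apply/negP => /andP[rt ts]; move/negP: tab; apply.
  by rewrite inE/= in_itv/= (lt_trans ar rt) (lt_trans ts sb).
have ipsi : intg mu `]a, b[%classic psi by exact: continuous_intg.
have iT : mu.-integrable setT (EFin \o psi).
  rewrite pab; exact: (intg_restrict (measurable_itv _) ipsi).
have dpsi x : is_derive x (1:R) (tprim psi) (psi x).
  have x1 : x < x + 1 by lra.
  have := @continuous_FTC1 R psi -oo%O x (x + 1) x1 (integrableS _ _ _ iT) (ltNyr _) (cpsi x).
  by rewrite derive1E => -[] // d <-; exact: DeriveDef.
have eqprim x : tprim psi x = \int[mu]_(t in `]a, x]) psi t.
  rewrite /tprim Rintegral_mkcond [RHS]Rintegral_mkcond; apply: eq_Rintegral => t _.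
  rewrite !patchE; case: ifPn => [|tx]; case: ifPn => [|tax].
  - by [].
  - rewrite inE/= in_itv/= => tx; apply: supp; apply/negP => /andP[rt ts].
    by move/negP: tax; apply; rewrite inE/= in_itv/= tx (lt_trans ar rt).
  - rewrite inE/= in_itv/= => /andP[_ tx'].
    by move/negP: tx; case; rewrite inE/= in_itv/=.
  - by [].
have outl x : x <= r -> tprim psi x = 0.
  move=> xr; rewrite /tprim (@eq_Rintegral _ _ _ _ _ (fun=> 0)).
    by rewrite Rintegral_cst// mul0r.
  move=> t; rewrite inE/= in_itv/= => tx; apply: supp.
  by rewrite negb_and -leNgt (le_trans tx xr).
have outr x : s <= x -> tprim psi x = 0.
  move=> sx; rewrite -i0 /tprim Rintegral_mkcond [RHS]Rintegral_mkcond.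
  apply: eq_Rintegral => t _; rewrite -[X in _ = X]/((psi \_ `]a, b[%classic) t) -pab patchE.
  case: ifPn => // tx; apply/esym/supp; rewrite negb_and -!leNgt.
  move/negP: tx; rewrite inE/= in_itv/= => /negP; rewrite -ltNge => xt.
  by rewrite (le_trans sx (ltW xt)) orbT.
split=> //.
- split; last first.
    exists r, s; split=> // t; rewrite negb_and -!leNgt => /orP[|]; [exact: outl|exact: outr].
  move=> [|k]; last by exists psi.
  by move=> x; exact: is_derive_continuous (dpsi x).
- move=> x xab; rewrite eqprim /prim Rintegral_itv_bndo_bndc//.
  by apply: integrableS iT.
Qed.

Definition eta0 a b : R -> R := bump ((a + a + b) / 3) ((a + b + b) / 3) 0.

Definition dubois a b (i : rat * rat * nat) : R -> R := fun x =>
  ratbump a b i x - (\int[mu]_(t in `]a, b[) ratbump a b i t) /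
    (\int[mu]_(t in `]a, b[) eta0 a b t) * eta0 a b x.

Lemma eta0_supp a b : a < b -> [/\ a < (a + a + b) / 3, (a + b + b) / 3 < b &
  (a + a + b) / 3 < (a + b + b) / 3].
Proof. by move=> ab; split; lra. Qed.

Lemma intg_eta0 a b : intg mu `]a, b[%classic (eta0 a b).
Proof. apply: continuous_intg; exact: smooth1_continuous (smooth1_bump _ _ _ 0). Qed.

Lemma intg_ratbump a b i : intg mu `]a, b[%classic (ratbump a b i).
Proof. apply: continuous_intg; exact: smooth1_continuous (ratbump_smooth _ _ _ 0). Qed.

Lemma eta0_integral a b : a < b -> \int[mu]_(t in `]a, b[) eta0 a b t != 0.
Proof.
move=> ab; apply/negP => /eqP i0; have [h1 h2 h3] := eta0_supp ab.
have i0' : \int[mu]_(t in `]a, b[) `|eta0 a b t| = 0.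
  rewrite -[RHS]i0; apply: eq_Rintegral => t _.
  by have /andP[? _] := bump_bound ((a + a + b) / 3) ((a + b + b) / 3) 0 t; rewrite ger0_norm.
have := @Rint_abs_eq0 _ (measurableTypeR R) R mu _ (measurable_itv _) _ (intg_eta0 a b) i0'.
move=> [N [mN N0 sub]].
set r0 := (a + a + b) / 3 in h1 h3; set s0 := (a + b + b) / 3 in h2 h3.
have : (mu `]r0, s0[%classic <= mu N)%E.
  apply: le_measure; rewrite ?inE//.
  move=> x; rewrite /= in_itv/= => /andP[x1 x2]; apply: sub => /= /(_ _).
  rewrite in_itv/= (lt_trans h1 x1) (lt_trans x2 h2) => /(_ isT) e.
  by have := @bump_gt0 R _ _ 0 x (introT andP (conj x1 x2)); rewrite -/(eta0 a b) e ltxx.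
rewrite N0 lebesgue_measure_itv/= lte_fin h3 -EFinD lee_fin subr_le0 leNgt.
by rewrite h3.
Qed.

Lemma dubois_test1 a b i : a < b -> test1 a b (dubois a b i).
Proof.
move=> ab; have [h1 h2 h3] := eta0_supp ab.
have [r [s [ar sb supp]]] := ratbump_supp i ab; split.
  move=> k; pose c := (\int[mu]_(t in `]a, b[) ratbump a b i t) /
    (\int[mu]_(t in `]a, b[) eta0 a b t).
  have -> : dubois a b i = ratbump a b i + cst (- c) * eta0 a b.
    by apply/funext => x; rewrite /dubois -/c !fctE /=; ring.
  apply: smooth1D; first exact: ratbump_smooth.
  by apply: smooth1M; [exact: smooth1_cst|exact: smooth1_bump].
exists (Num.min r ((a + a + b) / 3)), (Num.max s ((a + b + b) / 3)); split.
- by rewrite lt_min ar.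
- by rewrite gt_max sb.
- move=> t ht; rewrite /dubois supp; last first.
    by apply: contra ht => /andP[u v]; rewrite gt_min u lt_max v.
  rewrite /eta0 bump_out ?mulr0 ?subrr//.
  by apply: contra ht => /andP[u v]; rewrite gt_min u lt_max v !orbT.
Qed.

Lemma dubois_integral a b i : a < b -> \int[mu]_(t in `]a, b[) dubois a b i t = 0.
Proof.
move=> ab; rewrite RintegralB//.
- by rewrite RintegralZl ?divfK ?subrr ?eta0_integral//; exact: intg_eta0.
- exact: intg_ratbump.
- by apply: intgZ => //; exact: intg_eta0.
Qed.

(* Du Bois-Reymond: the functions [dubois] are the mean zero corrections of the
   test functions [ratbump], and [tprim] integrates them to test functions. *)
Lemma ac1_of_dubois a b F G : a < b -> intg mu `]a, b[%classic F ->
  intg mu `]a, b[%classic G ->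
  (forall i, \int[mu]_(x in `]a, b[) (F x * dubois a b i x) =
    - \int[mu]_(x in `]a, b[) (G x * tprim (dubois a b i) x)) ->
  ac1 a b F G.
Proof.
move=> ab Fi Gi H.
(* Integrating [prim a G] by parts turns the hypothesis into orthogonality of [h] to the functions
   [dubois], that is, to mean zero functions; it remains to see that [h] is constant. *)
pose h x := F x - prim a G x.
have pi : intg mu `]a, b[%classic (prim a G).
  by have := intg_prim 0 Gi; congr (intg mu _ _); apply/funext => x; rewrite add0r.
have hi : intg mu `]a, b[%classic h by exact: intgB.
have bdub i : intg mu `]a, b[%classic (dubois a b i).
  by apply: continuous_intg; exact: smooth1_continuous ((dubois_test1 i ab).1 0%N).
have mulb f (al : R -> R) : intg mu `]a, b[%classic f -> continuous al ->
    (exists M, forall x, `|al x| <= M) -> intg mu `]a, b[%classic (fun x => f x * al x).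
  move=> fi ca [M aM]; have : intg mu `]a, b[%classic (fun x => al x * f x).
    apply: intgMl => //; last by exists M.
    by apply: measurable_funTS; exact: continuous_measurable_fun.
  by congr (intg mu _ _); apply/funext => x; rewrite mulrC.
have ceta : continuous (eta0 a b) by exact: smooth1_continuous (smooth1_bump _ _ _ 0).
have beta x : `|eta0 a b x| <= 1.
  by have /andP[? ?] := bump_bound ((a + a + b) / 3) ((a + b + b) / 3) 0 x; rewrite ger0_norm.
have hd i : \int[mu]_(x in `]a, b[) (h x * dubois a b i x) = 0.
  have iFd : intg mu `]a, b[%classic (fun x => F x * dubois a b i x).
    have -> : (fun x => F x * dubois a b i x) = (fun x => F x * ratbump a b i x -
      ((\int[mu]_(t in `]a, b[) ratbump a b i t) / (\int[mu]_(t in `]a, b[) eta0 a b t)) * (F x * eta0 a b x)).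
      by apply/funext => x; rewrite /dubois; ring.
    apply: intgB => //; first exact: intg_ratbumpM.
    by apply: intgZ => //; apply: mulb => //; exists 1.
  have iPd : intg mu `]a, b[%classic (fun x => prim a G x * dubois a b i x).
    have := intg_primM 0 Gi (bdub i); congr (intg mu _ _).
    by apply/funext => x; rewrite add0r.
  have -> : \int[mu]_(x in `]a, b[) (h x * dubois a b i x) =
     \int[mu]_(x in `]a, b[) (F x * dubois a b i x - prim a G x * dubois a b i x).
    by apply: eq_Rintegral => x _; rewrite mulrBl.
  rewrite RintegralB// H triangle_fubini//.
  have [_ _ tp] := tprimP (dubois_test1 i ab) (dubois_integral i ab).
  have -> : \int[mu]_(s in `]a, b[) (G s * tailprim b (dubois a b i) s) =
      \int[mu]_(s in `]a, b[) (- 1 * (G s * tprim (dubois a b i) s)).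
    apply: eq_Rintegral => s; rewrite inE/= => sab; rewrite tp//.
    move: sab; rewrite in_itv/= => /andP[as_ sb].
    rewrite (prim_tailprim (bdub i)) ?ltW// /prim dubois_integral//; ring.
  rewrite RintegralZl//; first by rewrite mulN1r subrr.
  have tt := (tprimP (dubois_test1 i ab) (dubois_integral i ab)).
  have [tt1 _ _] := tt.
  have -> : (fun x => G x * tprim (dubois a b i) x) = (fun x => G x * tprim (dubois a b i) x) by [].
  have iab x : `]a, b[%classic x -> G x * tprim (dubois a b i) x = G x * prim a (dubois a b i) x.
    by move=> xab; rewrite tp.
  apply: (@eq_integrable _ (measurableTypeR R) R mu _ _ (EFin \o (fun x => G x * prim a (dubois a b i) x))) => //.
    by move=> x; rewrite inE => xab; rewrite /= iab.
  have := intg_primM 0 (bdub i) Gi; congr (intg mu _ _).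
  by apply/funext => x; rewrite add0r mulrC.
split; [exact: intg_meas Fi|by []|].
(* Expanding [dubois], orthogonality says that [h] and the constant [c] have the same integral
   against every [ratbump]. *)
pose c := (\int[mu]_(x in `]a, b[) (h x * eta0 a b x)) / (\int[mu]_(t in `]a, b[) eta0 a b t).
have ihe : intg mu `]a, b[%classic (fun x => h x * eta0 a b x).
  by apply: mulb => //; exists 1.
exists c.
have cst_i : intg mu `]a, b[%classic (fun=> c).
  by apply: continuous_intg => x; exact: cvg_cst.
have : {ae mu, forall x, `]a, b[%classic x -> h x - c = 0}.
  apply: ratbump_ae0; first exact: intgB.
  move=> i; have := hd i.
  have -> : \int[mu]_(x in `]a, b[) (h x * dubois a b i x) =
    \int[mu]_(x in `]a, b[) (h x * ratbump a b i x - ((\int[mu]_(t in `]a, b[) ratbump a b i t) /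
    (\int[mu]_(t in `]a, b[) eta0 a b t)) * (h x * eta0 a b x)).
    by apply: eq_Rintegral => x _; rewrite /dubois; ring.
  rewrite RintegralB//; [|exact: intg_ratbumpM|exact: intgZ].
  rewrite RintegralZl// => E.
  have -> : \int[mu]_(x in `]a, b[) ((h x - c) * ratbump a b i x) =
    \int[mu]_(x in `]a, b[) (h x * ratbump a b i x - c * ratbump a b i x).
    by apply: eq_Rintegral => x _; rewrite mulrBl.
  rewrite RintegralB//; [|exact: intg_ratbumpM|by apply: intgZ => //; exact: intg_ratbump].
  rewrite RintegralZl//; last exact: intg_ratbump.
  rewrite -[RHS]E /c; ring.
by apply: filterS => x hx /hx; rewrite /h => e; lra.
Qed.

End fundamental1.

(** * Lebesgue measure on rectangles *)

#[global] Instance ae_area_filter (R : realType) :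
  Filter (nbhs (almost_everywhere (@area R))).
Proof.
exact: (@ae_filter_ringOfSetsType _ (measurableTypeR R * measurableTypeR R)%type R
  (@area R)).
Qed.

Section plane_measure.
Context {R : realType}.
Local Notation mu := (@lebesgue_measure R).
Local Notation mR := (measurableTypeR R).
Local Notation mplane := (mR * mR)%type.
Local Notation area := (@area R).
Implicit Types (a b c d : R) (f g : R * R -> R) (P : R * R -> Prop).

Definition rect a b c d : set mplane := `]a, b[%classic `*` `]c, d[%classic.

Lemma measurable_rect a b c d : measurable (rect a b c d).
Proof. by apply: measurableX; exact: measurable_itv. Qed.
Hint Resolve measurable_rect : core.

Lemma area_rect_fin a b c d : (area (rect a b c d) < +oo)%E.
Proof.
rewrite /area /= product_measure1E//=.
rewrite lte_mul_pinfty// ?itvoo_fin//.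
by rewrite ge0_fin_numE// itvoo_fin.
Qed.

Lemma area_rect_fine a b c d : a <= b -> c <= d ->
  fine (area (rect a b c d)) = (b - a) * (d - c).
Proof.
move=> ab cd; rewrite /area /= product_measure1E//=.
by rewrite fineM ?ge0_fin_numE ?itvoo_fin// !itvoo_fine.
Qed.

(** Statements about the variable [y] are statements about [x] for [f \o swp] on the exchanged
    rectangle, so most arguments are made in one direction only. *)
Definition swp {X Y : Type} (z : X * Y) : Y * X := (z.2, z.1).

Lemma measurable_swp : measurable_fun setT (@swp mR mR).
Proof.
by apply/measurable_fun_pairP; split;
  [exact: measurable_snd|exact: measurable_fst].
Qed.

Lemma area_swp (X : set mplane) : measurable X -> area (swp @^-1` X) = area X.
Proof.
move=> mX; have := @product_measure_unique _ _ mR mR R mu mu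
  (pushforward area (@swp mR mR)).
move=> /(_ measurable_swp) E; apply/esym; apply: E => // A B mA mB.
transitivity (area (B `*` A)).
  by congr (area _); apply/seteqP; split => -[x y] [].
by rewrite /area /= product_measure1E// muleC.
Qed.

Lemma ae_swp P : {ae area, forall z, P z} -> {ae area, forall z, P (swp z)}.
Proof.
move=> [N [mN N0 sub]]; exists (swp @^-1` N); split.
- by rewrite -[X in measurable X]setTI; exact: measurable_swp.
- by rewrite area_swp.
- by move=> z /= h; apply: sub.
Qed.

Lemma ae_rect_swp a b c d P : {ae area, forall z, rect a b c d z -> P z} ->
  {ae area, forall z, rect c d a b z -> P (swp z)}.
Proof. by move=> /ae_swp; apply: filterS => -[x y] h [/= ? ?]; exact: h. Qed.

Lemma meas_restrict a b c d f : measurable_fun (rect a b c d) f ->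
  measurable_fun setT (f \_ (rect a b c d)).
Proof. by move=> mf; apply/(measurable_restrictT _ _).1. Qed.

Lemma meas_swp a b c d f : measurable_fun (rect a b c d) f ->
  measurable_fun (rect c d a b) (f \o swp).
Proof.
move=> mf; have := measurableT_comp (meas_restrict mf) measurable_swp.
move=> /(@measurable_funS _ _ _ _ setT (rect c d a b) _ measurableT (@subsetT _ _)).
apply: eq_measurable_fun => -[x y]; rewrite inE => -[/= h1 h2].
by rewrite patchE mem_set.
Qed.

Lemma intg_mkcond a b c d f : intg area (rect a b c d) f <->
  intg area setT (f \_ (rect a b c d)).
Proof.
rewrite /intg -restrict_EFin; exact: integrable_mkcond.
Qed.

Lemma swp_restrict a b c d f :
  (f \_ (rect a b c d)) \o swp = (f \o swp) \_ (rect c d a b).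
Proof.
apply/funext => -[x y]; rewrite /= !patchE /=; congr (if _ then _ else _).
by apply/idP/idP; rewrite !inE => -[/= h1 h2].
Qed.

Lemma intg_swp a b c d f : intg area (rect a b c d) f ->
  intg area (rect c d a b) (f \o swp).
Proof.
move=> /intg_mkcond fi; apply/intg_mkcond; rewrite -swp_restrict.
set f' := f \_ _ in fi *.
have mf := intg_meas fi.
have mfs : measurable_fun setT (f' \o swp) by exact: measurableT_comp measurable_swp.
apply/integrableP; split; first exact/measurable_EFinP.
case/integrableP : fi => _; congr (_ < _)%E.
transitivity (\int[pushforward area (@swp mR mR)]_y `|(EFin \o f') y|)%E.
  apply: eq_measure_integral; first exact: measurable_swp.
  by move=> m X mX _; rewrite -[LHS](area_swp mX).
rewrite (ge0_integral_pushforward measurable_swp)//.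
by apply: measurableT_comp => //; exact/measurable_EFinP.
Qed.

Lemma Rint_swp a b c d f : intg area (rect a b c d) f ->
  \int[area]_(z in rect c d a b) f (swp z) = \int[area]_(z in rect a b c d) f z.
Proof.
move=> fi; have fi' := (intg_mkcond _ _ _ _ _).1 fi.
have gi := (intg_mkcond _ _ _ _ _).1 (intg_swp fi).
rewrite [LHS]Rintegral_mkcond [RHS]Rintegral_mkcond -swp_restrict.
set f' := f \_ _ in fi' *.
congr fine; apply/esym.
transitivity (\int[pushforward area (@swp mR mR)]_y ((EFin \o f') y))%E.
  apply: eq_measure_integral; first exact: measurable_swp.
  by move=> m X mX _; rewrite -[LHS](area_swp mX).
rewrite (integral_pushforward measurable_swp)//.
- exact: (measurable_int _ fi').
- by rewrite preimage_setT; move: gi; rewrite -swp_restrict.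
Qed.

(** The measure of a null set is the integral of the measures of its sections, which therefore
    vanish for almost every [y]. *)
Lemma ae_sec a b c d P : {ae area, forall z, rect a b c d z -> P z} ->
  {ae mu, forall y, `]c, d[%classic y ->
    {ae mu, forall x, `]a, b[%classic x -> P (x, y)}}.
Proof.
move=> [N [mN N0 sub]].
have N0' : (\int[mu]_y (mu (ysection N y)) = 0)%E.
  rewrite -N0; apply/esym.
  apply: (@product_measure_unique _ _ mR mR R mu mu (product_measure2 mu mu)) => //.
  by move=> A B mA mB; exact: product_measure2E.
have mN' : measurable_fun setT (fun y => mu (ysection N y)).
  exact: measurable_fun_ysection.
have : ae_eq mu setT (fun y => mu (ysection N y)) (cst 0)%E.
  apply/ae_eq_integral_abs => //.
  by rewrite -[RHS]N0'; apply: eq_integral => y _; rewrite gee0_abs.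
apply: filterS => y /(_ I) Ny0 By; exists (ysection N y); split.
- exact: measurable_ysection.
- exact: Ny0.
- move=> x /= /not_implyP[Ax nP]; rewrite /ysection /= inE; apply: sub => /=.
  by apply/not_implyP; split.
Qed.

Lemma meas_sec a b c d f y : measurable_fun (rect a b c d) f ->
  `]c, d[%classic y -> measurable_fun (`]a, b[%classic : set mR) (fun x => f (x, y)).
Proof.
move=> mf By.
have := measurableT_comp (meas_restrict mf) (@measurable_pair2 _ _ mR mR y).
move=> /(@measurable_funS _ _ _ _ setT `]a, b[%classic _ measurableT (@subsetT _ _)).
apply: eq_measurable_fun => x; rewrite inE => Ax.
by rewrite /= patchE mem_set.
Qed.

Lemma restrict_sec a b c d f x y : `]c, d[%classic y ->
  (f \_ (rect a b c d)) (x, y) = ((fun x => f (x, y)) \_ `]a, b[%classic) x.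
Proof.
move=> By; rewrite !patchE; congr (if _ then _ else _).
by apply/idP/idP; rewrite !inE => // -[].
Qed.

Lemma restrict_sec0 a b c d f x y : ~ `]c, d[%classic y ->
  (f \_ (rect a b c d)) (x, y) = 0.
Proof.
by move=> By; rewrite patchE; case: ifPn => //; rewrite inE => -[].
Qed.

Lemma fubini_rect a b c d f : intg area (rect a b c d) f ->
  [/\ {ae mu, forall y, `]c, d[%classic y -> intg mu `]a, b[%classic (fun x => f (x, y))},
    intg mu `]c, d[%classic (fun y => \int[mu]_(x in `]a, b[) f (x, y)) &
    \int[area]_(z in rect a b c d) f z =
    \int[mu]_(y in `]c, d[) \int[mu]_(x in `]a, b[) f (x, y)].
Proof.
move=> /intg_mkcond fi; set f' := f \_ _ in fi.
have aei := @ae_integrable2 _ _ mR mR R mu mu _ fi.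
pose G y := (\int[mu]_x (f' (x, y))%:E)%E.
have Gi : mu.-integrable setT G.
  have mf' := intg_meas fi.
  have mt : measurable_fun setT (fun y => \int[mu]_x `|(f' (x, y))%:E|)%E.
    apply: (@measurable_fun_fubini_tonelli_G _ _ mR mR R mu (fun z => `|(f' z)%:E|%E)) => //.
    by apply: measurableT_comp => //; exact/measurable_EFinP.
  have h0 y : (0 <= \int[mu]_x `|(f' (x, y))%:E|)%E by apply: integral_ge0.
  have hi : mu.-integrable setT (fun y => \int[mu]_x `|(f' (x, y))%:E|)%E.
    apply/integrableP; split=> //.
    have := (@integrable21ltyP _ _ mR mR R mu mu _ (measurable_int _ fi)).1 fi.
    by congr (_ < _)%E; apply: eq_integral => y _; rewrite gee0_abs.
  apply: (le_integrable measurableT _ _ hi).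
    exact: (@measurable_fubini_G _ _ mR mR R mu mu _ fi).
  move=> y _; rewrite (gee0_abs (h0 y)); apply: le_abse_integral => //.
  apply/measurable_EFinP; apply: (measurableT_comp mf').
  exact: measurable_pair2.
have GE y : `]c, d[%classic y -> fine (G y) = \int[mu]_(x in `]a, b[) f (x, y).
  move=> By; rewrite Rintegral_mkcond; congr fine; apply: eq_integral => x _.
  by rewrite /= /f' restrict_sec.
have G0 y : ~ `]c, d[%classic y -> G y = 0%E.
  by move=> By; rewrite /G integral0_eq// => x _; rewrite /f' restrict_sec0.
have Gfin : {ae mu, forall y, G y \is a fin_num}.
  by have := integrable_ae measurableT Gi; apply: filterS => y; apply.
have GiR : intg mu setT (fun y => fine (G y)).
  apply: (le_integrable measurableT _ _ Gi).
    apply/measurable_EFinP; apply: measurableT_comp => //.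
    exact: measurable_int Gi.
  by move=> y _ /=; case: (G y) => [r| |] //=; rewrite normr0 leey.
split.
- apply: filterS aei => y h By.
  apply/(integrable_mkcond _ _).2 => //; rewrite restrict_EFin.
  apply: eq_integrable h => // x _; by rewrite /= /f' restrict_sec.
- have := @integrableS _ mR R mu _ _ _ measurableT (measurable_itv `]c, d[) (@subsetT _ _) GiR.
  by apply: eq_integrable => // y; rewrite inE => By; rewrite /= GE.
- rewrite Rintegral_mkcond -/f' [RHS]Rintegral_mkcond.
  rewrite {1}/Rintegral -(integral21_prod_meas1 fi) -/G.
  congr fine; apply: ae_eq_integral => //.
  + exact: measurable_int Gi.
  + apply/measurable_EFinP; have := intg_meas GiR.
    apply: eq_measurable_fun => y _; rewrite patchE; case: ifPn => [|/negP].
      by rewrite inE => By; rewrite GE.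
    by rewrite inE => nB; rewrite G0.
  + apply: filterS Gfin => y fy _; rewrite /= patchE; case: ifPn => [|/negP].
      by rewrite inE => By; rewrite -GE// fineK.
    by rewrite inE => nB; rewrite -/(G y) G0.
Qed.

Lemma intg_rect_of a b c d f (K : R -> R) : measurable_fun (rect a b c d) f ->
  intg mu `]c, d[%classic K ->
  {ae mu, forall y, `]c, d[%classic y -> intg mu `]a, b[%classic (fun x => f (x, y)) /\
    \int[mu]_(x in `]a, b[) `|f (x, y)| <= K y} ->
  intg area (rect a b c d) f.
Proof.
move=> mf Ki H; apply/intg_mkcond.
have mf' := meas_restrict mf.
apply/(@integrable21ltyP _ _ mR mR R mu mu); first exact/measurable_EFinP.
set f' := f \_ _ in mf' *.
pose K' y := `|(K \_ `]c, d[%classic) y|.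
have Ki' : intg mu setT K'.
  by apply: intg_abs; exact: (intg_restrict (measurable_itv _) Ki).
apply: (@le_lt_trans _ _ (\int[mu]_y (K' y)%:E)%E); last first.
  have /integrableP[_] := Ki'; congr (_ < _)%E; apply: eq_integral => y _.
  by rewrite /= /K' normr_id.
apply: ae_ge0_le_integral => //.
- by move=> y _; apply: integral_ge0.
- apply: (@measurable_fun_fubini_tonelli_G _ _ mR mR R mu (fun z => `|(f' z)%:E|%E)) => //.
  by apply: measurableT_comp => //; exact/measurable_EFinP.
- by move=> y _; rewrite lee_fin /K' normr_ge0.
- exact: (measurable_int _ Ki').
- apply: filterS H => y h _; have [By|nB] := pselect (`]c, d[%classic y).
    have [fi fK] := h By.
    have -> : (\int[mu]_x `|(EFin \o f') (x, y)| = (\int[mu]_(x in `]a, b[) `|f (x, y)|)%:E)%E.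
      rewrite /Rintegral fineK; last exact: (integrable_fin_num _ (intg_abs fi)).
      rewrite [RHS]integral_mkcond; apply: eq_integral => x _.
      by rewrite /= /f' restrict_sec// !patchE; case: ifP => //; rewrite normr0.
    by rewrite lee_fin /K' patchE mem_set// (le_trans fK)// ler_norm.
  rewrite integral0_eq//; last by move=> x _; rewrite /= /f' restrict_sec0// normr0.
  by rewrite lee_fin /K' normr_ge0.
Qed.

(** A converse of [ae_sec], for equations: the measurability of [f] allows the integral of [|f|]
    over the rectangle to be computed line by line. *)
Lemma ae_rect0 a b c d f : measurable_fun (rect a b c d) f ->
  {ae mu, forall y, `]c, d[%classic y ->
    {ae mu, forall x, `]a, b[%classic x -> f (x, y) = 0}} ->
  {ae area, forall z, rect a b c d z -> f z = 0}.
Proof.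
move=> mf H.
have aei y : `]c, d[%classic y -> {ae mu, forall x, `]a, b[%classic x -> f (x, y) = 0} ->
    intg mu `]a, b[%classic (fun x => f (x, y)) /\
    \int[mu]_(x in `]a, b[) `|f (x, y)| = 0.
  move=> By h; have ms := meas_sec mf By; split.
    apply: (@intg_ae _ mR R mu _ (measurable_itv _) (fun=> 0)) => //; first exact: intg0.
    by apply: filterS h => x h /h ->.
  rewrite (@Rint_ae _ mR R mu _ _ _ (fun=> 0))//.
  - by rewrite Rintegral_cst// mul0r.
  - exact: measurableT_comp.
  - by apply: filterS h => x h /h ->; rewrite normr0.
have fi : intg area (rect a b c d) f.
  apply: (@intg_rect_of _ _ _ _ _ (fun=> 0)) => //; first exact: intg0.
  by apply: filterS H => y h By; have [? ->] := aei y By (h By).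
apply: (Rint_abs_eq0 _ fi) => //.
have [_ i2 ->] := fubini_rect (intg_abs fi).
rewrite (@Rint_ae _ mR R mu _ _ _ (fun=> 0))//.
- by rewrite Rintegral_cst// mul0r.
- exact: intg_meas i2.
- by apply: filterS H => y h By; have [_ ->] := aei y By (h By).
Qed.

End plane_measure.
#[global] Hint Resolve measurable_rect : core.

(** * Absolute continuity on lines and weak derivatives *)

Section sectional.
Context {R : realType}.
Local Notation mu := (@lebesgue_measure R).
Local Notation mR := (measurableTypeR R).
Local Notation mplane := (mR * mR)%type.
Local Notation area := (@area R).
Implicit Types (a b c d : R) (f g h : R * R -> R).

Lemma bigcup_count_measurable (disp : measure_display) (T : measurableType disp) (I : countType) (F : I -> set T) :
  (forall i, measurable (F i)) -> measurable (\bigcup_i F i).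
Proof.
move=> mF.
have -> : \bigcup_i F i = \bigcup_n (if unpickle n is Some i then F i else set0).
  apply/seteqP; split => [x [i _ Fx]|x [n _]]; first by exists (pickle i); rewrite ?pickleK.
  by case: (unpickle n) => // i Fx; exists i.
by apply: bigcupT_measurable => n; case: (unpickle n).
Qed.

(** The plane carries the product topology and the product sigma-algebra; countably many boxes with
    rational corners link the two. *)
Lemma open_plane_measurable (U : set (R * R)) : open U -> measurable (U : set mplane).
Proof.
move=> oU.
pose box (i : (rat * rat) * (rat * rat)) : set mplane :=
  rect (ratr i.1.1 : R) (ratr i.1.2) (ratr i.2.1) (ratr i.2.2).
pose F i : set mplane := if `[< box i `<=` U >] then box i else set0.
have -> : (U : set mplane) = \bigcup_i F i.
  apply/seteqP; split => [[x y] Uxy|z [i _]]; last first.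
    by rewrite /F; case: asboolP => // s /s.
  have /nbhs_ballP[e /= e0 sub] := open_nbhs_nbhs (conj oU Uxy).
  have q1 (t : R) : exists p q : rat, t - e < ratr p < t /\ t < ratr q < t + e.
    have : t - e < t by lra.
    move=> /rat_in_itvoo[p]; rewrite in_itv/= => hp.
    have : t < t + e by lra.
    by move=> /rat_in_itvoo[q]; rewrite in_itv/= => hq; exists p, q.
  have [p [q [hp hq]]] := q1 x; have [r [s [hr hs]]] := q1 y.
  exists ((p, q), (r, s)) => //; rewrite /F asboolT.
    by split; rewrite /= in_itv/=; lra.
  move=> [x' y'] [/=]; rewrite !in_itv/= => h1 h2; apply: sub; split.
    by rewrite /ball/= ltr_norml; lra.
  by rewrite /ball/= ltr_norml; lra.
apply: bigcup_count_measurable => i; rewrite /F.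
by case: ifP => _ //; exact: measurable_rect.
Qed.

Lemma open_rect a b c d : open (rect a b c d : set (R * R)).
Proof.
rewrite /rect; have -> : (`]a, b[%classic `*` `]c, d[%classic : set (R * R)) =
    (fst @^-1` `]a, b[%classic) `&` (snd @^-1` `]c, d[%classic).
  by apply/seteqP; split => -[x y] [].
apply: openI; apply: open_comp => //; try exact: interval_open.
  by move=> z _; exact: cvg_fst.
by move=> z _; exact: cvg_snd.
Qed.

Lemma continuous_plane_measurable (D : set mplane) (phi : R * R -> R) : measurable D ->
  continuous phi -> measurable_fun D phi.
Proof.
move=> mD /continuousP cphi; apply: measurable_funTS.
apply: (measurability _ (RGenOpens.measurableE R)).
move=> _ [_ [a [b ->] <-]]; rewrite setTI.
by apply: open_plane_measurable; apply: cphi; exact: interval_open.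
Qed.

Lemma Rint_FTC (phi phi' : R -> R) s t : s <= t ->
  (forall x, is_derive x (1:R) phi (phi' x)) -> continuous phi' ->
  \int[mu]_(x in `]s, t[) phi' x = phi t - phi s.
Proof.
rewrite le_eqVlt => /predU1P[->|st] dphi cphi'.
  by rewrite set_itvoo0// Rintegral_set0 subrr.
have i1 : intg mu `]s, t[%classic phi' by exact: continuous_intg.
have i2 : mu.-integrable `[s, t] (EFin \o phi').
  apply: continuous_compact_integrable; first exact: segment_compact.
  exact: continuous_subspaceT.
rewrite Rintegral_itv_bndo_bndc// Rintegral_itv_obnd_cbnd//; last first.
  by apply: integrableS i2 => //; apply: subset_itv; rewrite bnd_simp.
have cphi x : {for x, continuous phi} by exact: is_derive_continuous (dphi x).
rewrite /Rintegral (@continuous_FTC2 R phi' phi s t)//.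
- exact: continuous_subspaceT.
- split=> //.
  + exact: cvg_at_right_filter (cphi s).
  + exact: cvg_at_left_filter (cphi t).
- by move=> x _; rewrite derive1E; case: (dphi x).
Qed.

Lemma ac1_test a b (F G phi phi' : R -> R) : a <= b -> ac1 a b F G ->
  (forall x, is_derive x (1:R) phi (phi' x)) -> continuous phi' ->
  phi a = 0 -> phi b = 0 ->
  \int[mu]_(x in `]a, b[) (F x * phi' x) = - \int[mu]_(x in `]a, b[) (G x * phi x).
Proof.
move=> ab h dphi cphi' pa pb; have bi : intg mu `]a, b[%classic phi' by exact: continuous_intg.
rewrite (ac1_pair h bi); last by rewrite (Rint_FTC ab dphi)// pa pb subrr.
have [_ Gi _] := h.
have cphi : continuous phi by move=> x; exact: is_derive_continuous (dphi x).
have GP : intg mu `]a, b[%classic (fun x => G x * phi x).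
  have : intg mu `]a, b[%classic (fun x => (phi a + prim a phi' x) * G x) by exact: intg_primM.
  apply: eq_integrable => // x; rewrite inE/= in_itv/= => /andP[/ltW ax _].
  by rewrite /= /prim (Rint_FTC ax dphi)// mulrC addrC subrK.
rewrite -mulN1r -RintegralZl//; apply: eq_Rintegral => x.
rewrite inE/= in_itv/= => /andP[_ /ltW xb].
rewrite /tailprim (Rint_FTC xb dphi)// pb; ring.
Qed.

(** The ACL form (absolute continuity on lines) of the statement that [g] is the [x]-derivative of
    [f]. The constant hidden in [ac1] may depend on [y] in any manner. *)
Definition sacx a b c d f g :=
  {ae mu, forall y, `]c, d[%classic y -> ac1 a b (fun x => f (x, y)) (fun x => g (x, y))}.

Lemma ae_forall_count (I : countType) (P : I -> R -> Prop) :
  (forall i, {ae mu, forall y, P i y}) -> {ae mu, forall y, forall i, P i y}.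
Proof.
move=> H.
pose Q n y := if unpickle n is Some i then P i y else True.
have : {ae mu, forall y, forall n, Q n y}.
  apply: (@ae_foralln _ mR R mu Q) => n; rewrite /Q.
  by case: (unpickle n) => [i|]; [exact: H|exact: aeW].
by apply: filterS => y h i; have := h (pickle i); rewrite /Q pickleK.
Qed.

Lemma intg_mul_fst a b c d f (al : R -> R) : intg area (rect a b c d) f ->
  continuous al -> (exists M, forall x, `|al x| <= M) ->
  intg area (rect a b c d) (fun z => f z * al z.1).
Proof.
move=> fi ca [M aM].
have : intg area (rect a b c d) (fun z => al z.1 * f z).
  apply: intgMl => //; last by exists M.
  apply: measurable_funTS; apply: (measurableT_comp (f := al)).
    exact: continuous_measurable_fun.
  exact: measurable_fst.
by congr (intg area _ _); apply/funext => z; rewrite mulrC.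
Qed.

Lemma intg_mul_snd a b c d f (al : R -> R) : intg area (rect a b c d) f ->
  continuous al -> (exists M, forall x, `|al x| <= M) ->
  intg area (rect a b c d) (fun z => f z * al z.2).
Proof.
move=> fi ca [M aM].
have : intg area (rect a b c d) (fun z => al z.2 * f z).
  apply: intgMl => //; last by exists M.
  apply: measurable_funTS; apply: (measurableT_comp (f := al)).
    exact: continuous_measurable_fun.
  exact: measurable_snd.
by congr (intg area _ _); apply/funext => z; rewrite mulrC.
Qed.

Lemma sec_integral0 a b c d h : intg area (rect a b c d) h ->
  (forall j, \int[area]_(z in rect a b c d) (h z * ratbump c d j z.2) = 0) ->
  {ae mu, forall y, `]c, d[%classic y -> \int[mu]_(x in `]a, b[) h (x, y) = 0}.
Proof.
move=> hi h0; have [aei i2 _] := fubini_rect hi.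
apply: (ratbump_ae0 i2) => j; rewrite -[RHS](h0 j).
have ij : intg area (rect a b c d) (fun z => h z * ratbump c d j z.2).
  apply: intg_mul_snd => //; first exact: smooth1_continuous (ratbump_smooth _ _ _ 0).
  by exists 1 => x; exact: ratbump_bound.
have [_ i3 ->] := fubini_rect ij.
apply: (@Rint_ae _ mR R mu) => //.
- exact: intg_meas (intg_ratbumpM _ i2).
- exact: intg_meas i3.
- apply: filterS aei => y h1 By; have {}h1 := h1 By.
  by rewrite -RintegralZr.
Qed.

(** The functions [ratbump] in [y] isolate almost every horizontal line, on which those in [x] then
    act. This yields the uniqueness of weak derivatives. *)
Lemma tensor_ae0 a b c d h : a < b -> c < d -> intg area (rect a b c d) h ->
  (forall al be, test1 a b al -> test1 c d be ->
    \int[area]_(z in rect a b c d) (h z * (al z.1 * be z.2)) = 0) ->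
  {ae area, forall z, rect a b c d z -> h z = 0}.
Proof.
move=> ab cd hi H; apply: ae_rect0; first exact: intg_meas hi.
have [aei _ _] := fubini_rect hi.
have : {ae mu, forall y, forall i, `]c, d[%classic y ->
    \int[mu]_(x in `]a, b[) (h (x, y) * ratbump a b i x) = 0}.
  apply: ae_forall_count => i.
  have ii : intg area (rect a b c d) (fun z => h z * ratbump a b i z.1).
    apply: intg_mul_fst => //; first exact: smooth1_continuous (ratbump_smooth _ _ _ 0).
    by exists 1 => x; exact: ratbump_bound.
  apply: (sec_integral0 ii) => j.
  rewrite -[RHS](H _ _ (ratbump_test1 i ab) (ratbump_test1 j cd)).
  by apply: eq_Rintegral => z _; rewrite mulrA.
move: aei; apply: filterS2 => y h1 h2 By; apply: (ratbump_ae0 (h1 By)) => i.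
exact: h2.
Qed.

Lemma test1_bounded a b al : test1 a b al -> exists M, forall x, `|al x| <= M.
Proof.
move=> [sal [r [s [_ _ supp]]]].
have ca : {within `[r, s], continuous al}.
  by apply: continuous_subspaceT; exact: smooth1_continuous (sal 0%N).
have [M0 [_ hM]] := compact_bounded (continuous_compact ca (@segment_compact R r s)).
exists (Num.max 0 (M0 + 1)) => x.
have [/andP[rx xs]|/supp ->] := boolP (r < x < s); last by rewrite normr0 le_max lexx.
rewrite le_max; apply/orP; right; apply: (hM (M0 + 1)); first lra.
by exists x => //=; rewrite in_itv/= !ltW.
Qed.

(** The weak identity is used for [al = tprim (dubois a b i)] and [be = ratbump c d j]. Varying [j]
    localizes it to almost every line, with one null set for all [i], and there the du Bois-Reymond
    lemma applies. *)
Lemma sacx_of_weak a b c d f g : a < b -> c < d ->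
  intg area (rect a b c d) f -> intg area (rect a b c d) g ->
  (forall al al' be, test1 a b al -> test1 a b al' -> test1 c d be ->
    (forall x, is_derive x (1:R) al (al' x)) ->
    \int[area]_(z in rect a b c d) (f z * (al' z.1 * be z.2)) =
    - \int[area]_(z in rect a b c d) (g z * (al z.1 * be z.2))) ->
  sacx a b c d f g.
Proof.
move=> ab cd fi gi H.
have [aef _ _] := fubini_rect fi; have [aeg _ _] := fubini_rect gi.
have tp i := tprimP (dubois_test1 i ab) (dubois_integral i ab).
have itest k (al : R -> R) : intg area (rect a b c d) k -> test1 a b al ->
    intg area (rect a b c d) (fun z => k z * al z.1).
  move=> ki ta; apply: intg_mul_fst => //; last exact: test1_bounded ta.
  exact: smooth1_continuous (ta.1 0%N).
have isec (k al : R -> R) : intg mu `]a, b[%classic k -> test1 a b al ->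
    intg mu `]a, b[%classic (fun x => k x * al x).
  move=> ki ta; have : intg mu `]a, b[%classic (fun x => al x * k x).
    apply: intgMl => //; first exact: (smooth1_measurable (ta.1 0%N)).
    by have [M hM] := test1_bounded ta; exists M.
  by congr (intg mu _ _); apply/funext => x; rewrite mulrC.
have : {ae mu, forall y, forall i, `]c, d[%classic y ->
    \int[mu]_(x in `]a, b[) (f (x, y) * dubois a b i x + g (x, y) * tprim (dubois a b i) x) = 0}.
  apply: ae_forall_count => i; have [t1 t2 _] := tp i.
  have i1 := itest _ _ fi (dubois_test1 i ab); have i2 := itest _ _ gi t1.
  apply: (@sec_integral0 _ _ _ _ (fun z => f z * dubois a b i z.1 + g z * tprim (dubois a b i) z.1)).
    exact: intgD.
  move=> j; have tj := ratbump_test1 j cd.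
  have i3 := intg_mul_snd i1 (smooth1_continuous (tj.1 0%N)) (test1_bounded tj).
  have i4 := intg_mul_snd i2 (smooth1_continuous (tj.1 0%N)) (test1_bounded tj).
  under eq_Rintegral do rewrite mulrDl.
  rewrite RintegralD//.
  have := H _ _ _ t1 (dubois_test1 i ab) tj t2.
  under eq_Rintegral do rewrite mulrA.
  move=> ->; under eq_Rintegral do rewrite mulrA.
  by rewrite addNr.
move: aef aeg; apply: filterS3 => y h1 h2 h3 By.
apply: (ac1_of_dubois ab (h1 By) (h2 By)) => i; have [t1 _ _] := tp i.
have := h3 i By; rewrite RintegralD//; last 2 first.
- exact: isec (h1 By) (dubois_test1 i ab).
- exact: isec (h2 By) t1.
by move=> /eqP; rewrite addr_eq0 => /eqP.
Qed.

(** The way back from lines to weak derivatives, by integration by parts on each line and Fubini. It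
    is not restricted to tensor products, so identities tested on tensor products extend to all test
    functions. *)
Lemma sacx_weak a b c d f g (phi phi' : R * R -> R) : a <= b -> sacx a b c d f g ->
  (forall x y, is_derive x (1:R) (fun x => phi (x, y)) (phi' (x, y))) ->
  (forall y, continuous (fun x => phi' (x, y))) ->
  (forall y, phi (a, y) = 0) -> (forall y, phi (b, y) = 0) ->
  intg area (rect a b c d) (fun z => f z * phi' z) ->
  intg area (rect a b c d) (fun z => g z * phi z) ->
  \int[area]_(z in rect a b c d) (f z * phi' z) =
  - \int[area]_(z in rect a b c d) (g z * phi z).
Proof.
move=> ab h dphi cphi' pa pb i1 i2.
have [_ j1 ->] := fubini_rect i1; have [_ j2 ->] := fubini_rect i2.
rewrite -mulN1r -RintegralZl//; apply: (@Rint_ae _ mR R mu) => //.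
- exact: intg_meas j1.
- by apply: measurable_funM => //; exact: intg_meas j2.
- apply: filterS h => y h By; rewrite mulN1r.
  exact: (ac1_test ab (h By)).
Qed.

Lemma sacx_mul a b c d f1 g1 f2 g2 : sacx a b c d f1 g1 -> sacx a b c d f2 g2 ->
  sacx a b c d (fun z => f1 z * f2 z) (fun z => g1 z * f2 z + f1 z * g2 z).
Proof. by apply: filterS2 => y h1 h2 By; exact: ac1_mul (h1 By) (h2 By). Qed.

End sectional.

(** * Test functions of the plane and their tensor products *)

Section test_functions.
Context {R : realType}.
Local Notation mR := (measurableTypeR R).
Local Notation mplane := (mR * mR)%type.
Local Notation area := (@area R).
Implicit Types (phi f g u v : R * R -> R) (al be : R -> R).

Lemma quotient_x phi (x y : R) :
  (fun h : R => h^-1 *: ((phi \o shift (x, y)) (h *: ((1, 0) : R * R)) - phi (x, y))) =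
  (fun h : R => h^-1 *: (((fun x => phi (x, y)) \o shift x) (h *: (1 : R)) - phi (x, y))).
Proof.
apply/funext => h /=; congr (_ *: (phi _ - _)).
by congr pair; rewrite /= scaler0 add0r.
Qed.

Lemma quotient_y phi (x y : R) :
  (fun h : R => h^-1 *: ((phi \o shift (x, y)) (h *: ((0, 1) : R * R)) - phi (x, y))) =
  (fun h : R => h^-1 *: (((fun y => phi (x, y)) \o shift y) (h *: (1 : R)) - phi (x, y))).
Proof.
apply/funext => h /=; congr (_ *: (phi _ - _)).
by congr pair; rewrite /= scaler0 add0r.
Qed.

Lemma is_derive_Dx phi (x y : R) : derivable phi (x, y) ((1, 0) : R * R) ->
  is_derive x (1:R) (fun x => phi (x, y)) (Dx phi (x, y)).
Proof.
by rewrite /derivable quotient_x => h; apply: DeriveDef => //; rewrite /Dx /derive quotient_x.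
Qed.

Lemma is_derive_Dy phi (x y : R) : derivable phi (x, y) ((0, 1) : R * R) ->
  is_derive y (1:R) (fun y => phi (x, y)) (Dy phi (x, y)).
Proof.
by rewrite /derivable quotient_y => h; apply: DeriveDef => //; rewrite /Dy /derive quotient_y.
Qed.

Lemma Dx_is_derive phi (x y d : R) : is_derive x (1:R) (fun x => phi (x, y)) d ->
  derivable phi (x, y) ((1, 0) : R * R) /\ Dx phi (x, y) = d.
Proof.
move=> [h1 <-]; split; last by rewrite /Dx /derive quotient_x.
by rewrite /derivable quotient_x.
Qed.

Lemma Dy_is_derive phi (x y d : R) : is_derive y (1:R) (fun y => phi (x, y)) d ->
  derivable phi (x, y) ((0, 1) : R * R) /\ Dy phi (x, y) = d.
Proof.
move=> [h1 <-]; split; last by rewrite /Dy /derive quotient_y.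
by rewrite /derivable quotient_y.
Qed.

Definition tensor (al be : R -> R) : R * R -> R := fun z => al z.1 * be z.2.

Lemma Dx_tensor al al' be : (forall x, is_derive x (1:R) al (al' x)) ->
  (forall z, derivable (tensor al be) z ((1, 0) : R * R)) /\ Dx (tensor al be) = tensor al' be.
Proof.
move=> dal; have H x y : is_derive x (1:R) (fun x => tensor al be (x, y)) (tensor al' be (x, y)).
  have := is_deriveZ (be y) (dal x); rewrite /tensor /= mulrC /GRing.scale/=.
  by congr (is_derive _ _ _ _); apply/funext => t; rewrite /= mulrC.
split; first by case=> x y; exact: (Dx_is_derive (H x y)).1.
by apply/funext => -[x y]; exact: (Dx_is_derive (H x y)).2.
Qed.

Lemma Dy_tensor al be be' : (forall x, is_derive x (1:R) be (be' x)) ->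
  (forall z, derivable (tensor al be) z ((0, 1) : R * R)) /\ Dy (tensor al be) = tensor al be'.
Proof.
move=> dbe; have H x y : is_derive y (1:R) (fun y => tensor al be (x, y)) (tensor al be' (x, y)).
  have := is_deriveZ (al x) (dbe y); rewrite /tensor /GRing.scale/=.
  by congr (is_derive _ _ _ _).
split; first by case=> x y; exact: (Dy_is_derive (H x y)).1.
by apply/funext => -[x y]; exact: (Dy_is_derive (H x y)).2.
Qed.

Lemma tensor_continuous al be : continuous al -> continuous be -> continuous (tensor al be).
Proof.
move=> ca cb z; apply: cvgM.
  by apply: (@continuous_comp _ _ _ fst al); [exact: cvg_fst|exact: ca].
by apply: (@continuous_comp _ _ _ snd be); [exact: cvg_snd|exact: cb].
Qed.

Lemma Ck_tensor k al be : smooth1 k al -> smooth1 k be -> Ck k (tensor al be).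
Proof.
elim: k al be => [|k IH] al be sa sb.
  by split => //; exact: tensor_continuous.
have [al' da sa'] := sa; have [be' db sb'] := sb.
split.
  by apply: tensor_continuous; [exact: smooth1_continuous sa|exact: smooth1_continuous sb].
have [d1 ->] := Dx_tensor be da; have [d2 ->] := Dy_tensor al db.
by split=> //; apply: IH => //; exact: smooth1W.
Qed.

Lemma tensor_test l al be : test1 0 pi al -> test1 (- l) l be -> test_function l (tensor al be).
Proof.
move=> [sa [r [s [ar sb supa]]]] [sbe [r' [s' [ar' sb' supb]]]].
split; first by move=> k; apply: Ck_tensor.
exists (`[r, s]%classic `*` `[r', s']%classic); split.
- by apply: compact_setX; exact: segment_compact.
- move=> [x y] [/=]; rewrite !in_itv/= => /andP[rx xs] /andP[ry ys].
  by split; rewrite /= in_itv/=; apply/andP; split;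
    [exact: lt_le_trans rx|exact: le_lt_trans sb|exact: lt_le_trans ry|exact: le_lt_trans sb'].
- move=> [x y] /= nK; rewrite /tensor /=.
  have [h1|/supa ->] := boolP (r < x < s); last by rewrite mul0r.
  have [h2|/supb ->] := boolP (r' < y < s'); last by rewrite mulr0.
  exfalso; apply: nK; split; rewrite /= in_itv/=.
    by case/andP: h1 => /ltW -> /ltW ->.
  by case/andP: h2 => /ltW -> /ltW ->.
Qed.

Lemma test_continuous l phi : test_function l phi -> continuous phi.
Proof. by move=> [/(_ 0%N)[]]. Qed.

Lemma test_out l phi z : test_function l phi -> ~ Omega l z -> phi z = 0.
Proof. by move=> [_ [K [_ KO K0]]] nO; apply: K0 => /KO. Qed.

Lemma test_near0 phi z (K : set (R * R)) : compact K -> (forall z, ~ K z -> phi z = 0) -> ~ K z ->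
  \near z, (cst 0 : R * R -> R) z = phi z.
Proof.
move=> cK K0 nK.
have oK : open (~` K).
  apply: closed_openC; apply: compact_closed => //; exact: norm_hausdorff.
have : nbhs z (~` K) by exact: open_nbhs_nbhs.
by apply: filterS => t /= /K0 ->.
Qed.

Lemma test_Dx l phi : test_function l phi -> test_function l (Dx phi).
Proof.
move=> [ck [K [cK KO K0]]]; split.
  by move=> k; have [_ []] := ck k.+1.
exists K; split=> // z nK; rewrite /Dx.
by rewrite -(near_eq_derive _ (test_near0 cK K0 nK)) derive_cst.
Qed.

Lemma test_Dy l phi : test_function l phi -> test_function l (Dy phi).
Proof.
move=> [ck [K [cK KO K0]]]; split.
  by move=> k; have [_ []] := ck k.+1.
exists K; split=> // z nK; rewrite /Dy.
by rewrite -(near_eq_derive _ (test_near0 cK K0 nK)) derive_cst.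
Qed.

Lemma test_iter l phi i j : test_function l phi ->
  test_function l (iter i Dx (iter j Dy phi)).
Proof.
move=> tphi; have : test_function l (iter j Dy phi).
  by elim: j => // j IH; exact: test_Dy.
by elim: i => // i IH /IH; exact: test_Dx.
Qed.

Lemma test_bounded l phi : test_function l phi -> exists M, forall z, `|phi z| <= M.
Proof.
move=> tphi; have cphi := test_continuous tphi; have [_ [K [cK _ K0]]] := tphi.
have cw : {within K, continuous phi} by exact: continuous_subspaceT.
have [M0 [_ hM]] := compact_bounded (continuous_compact cw cK).
exists (Num.max 0 (M0 + 1)) => z.
have [Kz|/K0 ->] := pselect (K z); last by rewrite normr0 le_max lexx.
rewrite le_max; apply/orP; right; apply: (hM (M0 + 1)); first lra.
by exists z.
Qed.

Lemma test_meas l phi (D : set mplane) : measurable D -> test_function l phi ->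
  measurable_fun D phi.
Proof. by move=> mD tphi; apply: continuous_plane_measurable => //; exact: test_continuous tphi. Qed.

Lemma intg_testM l phi f : test_function l phi -> intg area (Omega l) f ->
  intg area (Omega l) (fun z => f z * phi z).
Proof.
move=> tphi fi; have mO : measurable (Omega l : set mplane) by exact: measurable_rect.
have : intg area (Omega l) (fun z => phi z * f z).
  apply: intgMl => //; first exact: test_meas tphi.
  by have [M hM] := test_bounded tphi; exists M.
by congr (intg area _ _); apply/funext => z; rewrite mulrC.
Qed.

Lemma test_derx l phi x y : test_function l phi ->
  is_derive x (1:R) (fun x => phi (x, y)) (Dx phi (x, y)).
Proof. by move=> [/(_ 1%N)[_ [d _ _ _]] _]; exact: is_derive_Dx. Qed.

Lemma test_dery l phi x y : test_function l phi ->
  is_derive y (1:R) (fun y => phi (x, y)) (Dy phi (x, y)).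
Proof. by move=> [/(_ 1%N)[_ [_ d _ _]] _]; exact: is_derive_Dy. Qed.

Lemma continuous_secx phi y : continuous phi -> continuous (fun x => phi (x, y)).
Proof.
move=> cphi x; apply: (@continuous_comp _ _ _ (fun x : R => (x, y)) phi).
  by apply: (@cvg_pair _ _ _ _ (nbhs (x : R)) (nbhs (y : R))); [exact: cvg_id|exact: cvg_cst].
exact: cphi.
Qed.

Lemma continuous_secy phi x : continuous phi -> continuous (fun y => phi (x, y)).
Proof.
move=> cphi y; apply: (@continuous_comp _ _ _ (fun y : R => (x, y)) phi).
  by apply: (@cvg_pair _ _ _ _ (nbhs (x : R)) (nbhs (y : R))); [exact: cvg_cst|exact: cvg_id].
exact: cphi.
Qed.

Definition sx l f g := sacx 0 pi (- l) l f g.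
Definition sy l f g := sacx (- l) l 0 pi (f \o swp) (g \o swp).

Lemma sx_weak l f g phi : sx l f g -> intg area (Omega l) f -> intg area (Omega l) g ->
  test_function l phi ->
  \int[area]_(z in Omega l) (f z * Dx phi z) = - \int[area]_(z in Omega l) (g z * phi z).
Proof.
move=> h fi gi tphi; apply: (@sacx_weak _ 0 pi (- l) l f g phi (Dx phi)).
- exact: pi_ge0.
- exact: h.
- by move=> x y; exact: test_derx tphi.
- by move=> y; apply: continuous_secx; exact: test_continuous (test_Dx tphi).
- move=> y; apply: (test_out tphi) => -[/=]; rewrite in_itv/= ltxx//.
- move=> y; apply: (test_out tphi) => -[/=]; rewrite in_itv/= ltxx andbF//.
- exact: (intg_testM (test_Dx tphi)).
- exact: intg_testM.
Qed.

Lemma sy_weak l f g phi : 0 <= l -> sy l f g -> intg area (Omega l) f -> intg area (Omega l) g ->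
  test_function l phi ->
  \int[area]_(z in Omega l) (f z * Dy phi z) = - \int[area]_(z in Omega l) (g z * phi z).
Proof.
move=> l0 h fi gi tphi.
have i1 := intg_testM (test_Dy tphi) fi; have i2 := intg_testM tphi gi.
rewrite -(@Rint_swp _ 0 pi (- l) l _ i1) -(@Rint_swp _ 0 pi (- l) l _ i2).
apply: (@sacx_weak _ (- l) l 0 pi (f \o swp) (g \o swp) (phi \o swp) (Dy phi \o swp)).
- by lra.
- exact: h.
- by move=> x y; exact: test_dery tphi.
- by move=> y; apply: continuous_secy; exact: test_continuous (test_Dy tphi).
- move=> y; apply: (test_out tphi) => -[/= _]; rewrite in_itv/= ltxx//.
- move=> y; apply: (test_out tphi) => -[/= _]; rewrite in_itv/= ltxx andbF//.
- exact: (@intg_swp _ 0 pi (- l) l _ i1).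
- exact: (@intg_swp _ 0 pi (- l) l _ i2).
Qed.

Lemma weak_sx l f g : 0 < l -> intg area (Omega l) f -> intg area (Omega l) g ->
  (forall al al' be, test1 0 pi al -> test1 0 pi al' -> test1 (- l) l be ->
    (forall x, is_derive x (1:R) al (al' x)) ->
    \int[area]_(z in Omega l) (f z * tensor al' be z) =
    - \int[area]_(z in Omega l) (g z * tensor al be z)) -> sx l f g.
Proof.
move=> l0 fi gi H; apply: sacx_of_weak => //; first exact: pi_gt0.
lra.
Qed.

Lemma weak_sy l f g : 0 < l -> intg area (Omega l) f -> intg area (Omega l) g ->
  (forall al be be', test1 0 pi al -> test1 (- l) l be -> test1 (- l) l be' ->
    (forall x, is_derive x (1:R) be (be' x)) ->
    \int[area]_(z in Omega l) (f z * tensor al be' z) =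
    - \int[area]_(z in Omega l) (g z * tensor al be z)) -> sy l f g.
Proof.
move=> l0 fi gi H; apply: sacx_of_weak; [lra|exact: pi_gt0| | |].
- exact: (@intg_swp _ 0 pi (- l) l _ fi).
- exact: (@intg_swp _ 0 pi (- l) l _ gi).
move=> be be' al tb tb' ta db.
have tM k b : intg area (Omega l) k -> test1 (- l) l b ->
    intg area (Omega l) (fun z => k z * tensor al b z).
  by move=> ki tb0; apply: intg_testM => //; exact: tensor_test.
have := H al be be' ta tb tb' db.
rewrite -(@Rint_swp _ 0 pi (- l) l _ (tM _ _ fi tb')).
rewrite -(@Rint_swp _ 0 pi (- l) l _ (tM _ _ gi tb)) /tensor /=.
under eq_Rintegral do rewrite [al _ * _]mulrC.
by under [in X in _ = X -> _]eq_Rintegral do rewrite [al _ * _]mulrC.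
Qed.

End test_functions.

(** * Second-order jets of Sobolev functions *)

Section jets.
Context {R : realType}.
Local Notation mR := (measurableTypeR R).
Local Notation mplane := (mR * mR)%type.
Local Notation area := (@area R).
Variables (l : R) (l_gt0 : 0 < l).
Implicit Types (phi f g h u v : R * R -> R) (U V : nat -> nat -> R * R -> R).

Lemma measurable_Omega : measurable (Omega l : set mplane).
Proof. exact: (measurable_rect 0 pi (- l) l). Qed.
Hint Resolve measurable_Omega : core.

Lemma Omega_fin : (area (Omega l) < +oo)%E.
Proof. exact: area_rect_fin. Qed.

Lemma Lq2P f : Lq l 2%:E f <-> L2 area (Omega l) f.
Proof.
have E : (\int[area]_z (`|(EFin \o (f \_ (Omega l))) z| `^ 2) =
    \int[area]_(z in Omega l) ((f z) ^+ 2)%:E)%E.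
  rewrite [RHS]integral_mkcond; apply: eq_integral => z _ /=.
  rewrite !patchE; case: ifPn => _; last by rewrite normr0 powR0.
  by rewrite powR_mulrn// real_normK ?num_real.
split=> -[mf fi]; split=> //.
- apply/integrableP; split; first by apply/measurable_EFinP; exact: measurable_funX.
  move: fi; rewrite /LqNorm unlock => /lty_poweRy; rewrite E => h.
  have -> : (\int[area]_(z in Omega l) `|(EFin \o (fun x => (f x ^+ 2)%R)) z| =
      \int[area]_(z in Omega l) ((f z) ^+ 2)%:E)%E.
    by apply: eq_integral => z _; rewrite /= ger0_norm// sqr_ge0.
  by apply: h; rewrite invr_eq0.
- rewrite /LqNorm unlock; apply: poweR_lty; rewrite E.
  exact: (integrable_lty _ fi).
Qed.

Lemma L2_intgO f : L2 area (Omega l) f -> intg area (Omega l) f.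
Proof. by apply: L2_intg => //; exact: Omega_fin. Qed.

Lemma is_L2_derivD i j a u v g h : L2 area (Omega l) u -> L2 area (Omega l) v ->
  is_L2_deriv l i j u g -> is_L2_deriv l i j v h ->
  is_L2_deriv l i j (fun z => a * u z + v z) (fun z => a * g z + h z).
Proof.
move=> lu lv [/Lq2P lg wg] [/Lq2P lh wh]; split.
  by apply/Lq2P; apply: L2D => //; exact: L2Z.
move=> phi tphi; have ti := test_iter i j tphi.
have iu := L2_intgO lu; have iv := L2_intgO lv.
have ig := L2_intgO lg; have ih := L2_intgO lh.
have -> : \int[area]_(z in Omega l) ((a * u z + v z) * iter i Dx (iter j Dy phi) z) =
  \int[area]_(z in Omega l) (a * (u z * iter i Dx (iter j Dy phi) z) + v z * iter i Dx (iter j Dy phi) z).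
  by apply: eq_Rintegral => z _; ring.
have -> : \int[area]_(z in Omega l) ((a * g z + h z) * phi z) =
  \int[area]_(z in Omega l) (a * (g z * phi z) + h z * phi z).
  by apply: eq_Rintegral => z _; ring.
rewrite !RintegralD//.
- rewrite !RintegralZl//; [|exact: intg_testM|exact: intg_testM].
  by rewrite wg// wh//; ring.
- by apply: intgZ => //; exact: intg_testM.
- exact: intg_testM.
- by apply: intgZ => //; exact: intg_testM.
- exact: intg_testM.
Qed.

Lemma is_L2_deriv_ae i j u g h : is_L2_deriv l i j u g -> is_L2_deriv l i j u h ->
  {ae area, forall z, Omega l z -> g z = h z}.
Proof.
move=> [/Lq2P lg wg] [/Lq2P lh wh].
have ig := L2_intgO lg; have ih := L2_intgO lh.
have nl : - l < l by have := l_gt0; lra.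
have : {ae area, forall z, rect 0 pi (- l) l z -> g z - h z = 0}.
  apply: tensor_ae0 => //; first exact: pi_gt0.
    exact: intgB.
  move=> al be ta tb; have tt := tensor_test ta tb.
  have -> : \int[area]_(z in rect 0 pi (- l) l) ((g z - h z) * (al z.1 * be z.2)) =
    \int[area]_(z in Omega l) (g z * tensor al be z - h z * tensor al be z).
    by apply: eq_Rintegral => z _; rewrite mulrBl.
  rewrite RintegralB//; [|exact: intg_testM|exact: intg_testM].
  have := wg _ tt; rewrite wh//; move: (\int[area]_(z in Omega l) _) => x.
  move: (\int[area]_(z in Omega l) _) => y.
  by move=> /(congr1 (fun r => (-1) ^+ (i + j) * r)); rewrite !signrMK => ->; rewrite subrr.
by apply: filterS => z h0 Oz; apply/eqP; rewrite -subr_eq0 h0.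
Qed.

Lemma wDP i j u : H2 l u -> (i + j <= 2)%N -> is_L2_deriv l i j u (wD l i j u).
Proof.
move=> [_ H] /H [g hg]; rewrite /wD.
by have := @xgetPex _ (cst 0) [set g | is_L2_deriv l i j u g] (ex_intro _ g hg).
Qed.

Lemma wD_ae i j u g : H2 l u -> (i + j <= 2)%N -> is_L2_deriv l i j u g ->
  {ae area, forall z, Omega l z -> wD l i j u z = g z}.
Proof. by move=> Hu ij; exact: is_L2_deriv_ae (wDP Hu ij). Qed.

Lemma H2D a u v : H2 l u -> H2 l v -> H2 l (fun z => a * u z + v z).
Proof.
move=> Hu Hv; have /Lq2P lu := Hu.1; have /Lq2P lv := Hv.1; split.
  by apply/Lq2P; apply: L2D => //; exact: L2Z.
move=> i j ij; exists (fun z => a * wD l i j u z + wD l i j v z).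
by apply: is_L2_derivD => //; exact: wDP.
Qed.

Lemma wDD a u v i j : H2 l u -> H2 l v -> (i + j <= 2)%N ->
  {ae area, forall z, Omega l z ->
    wD l i j (fun z => a * u z + v z) z = a * wD l i j u z + wD l i j v z}.
Proof.
move=> Hu Hv ij; apply: wD_ae => //; first exact: H2D.
have /Lq2P lu := Hu.1; have /Lq2P lv := Hv.1.
by apply: is_L2_derivD => //; exact: wDP.
Qed.

(** Neighbouring entries are tied by derivatives on lines, not each entry to [U 0 0] by a weak
    derivative. In this form products and explicit functions are treated entry by entry; [jet_deriv]
    then recovers the weak derivatives. *)
Definition jet U := [/\ forall i j, (i + j <= 2)%N -> L2 area (Omega l) (U i j),
  forall i j, (i + j < 2)%N -> sx l (U i j) (U i.+1 j) &
  forall i j, (i + j < 2)%N -> sy l (U i j) (U i j.+1)].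

(** The entry of order zero is [u] itself, so that [wjet u 0 0] reduces to [u]; [wD l 0 0 u] would
    agree with it only almost everywhere. *)
Definition wjet u (i j : nat) : R * R -> R :=
  if (i + j == 0)%N then u else wD l i j u.

Lemma wjet_deriv u i j : H2 l u -> (i + j <= 2)%N -> is_L2_deriv l i j u (wjet u i j).
Proof.
move=> Hu ij; rewrite /wjet; case: ifPn => [|_]; last exact: wDP.
rewrite addn_eq0 => /andP[/eqP-> /eqP->]; split; first exact: Hu.1.
by move=> phi tphi; rewrite expr0 mul1r.
Qed.

(** [is_L2_deriv] relates every derivative to [u] alone. Consecutive ones are related by testing the
    lower one against a differentiated tensor product and comparing with the identity for the higher
    one. *)
Lemma H2_jet u : H2 l u -> jet (wjet u).
Proof.
move=> Hu.
have D i j : (i + j <= 2)%N -> is_L2_deriv l i j u (wjet u i j) by exact: wjet_deriv.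
have LD i j : (i + j <= 2)%N -> L2 area (Omega l) (wjet u i j).
  by move=> /D[/Lq2P].
have ID i j : (i + j <= 2)%N -> intg area (Omega l) (wjet u i j).
  by move=> /LD; exact: L2_intgO.
split=> //.
- case=> [|[|i]] [|[|j]] // ij.
  + apply: weak_sx => //; [exact: ID|exact: ID|].
    move=> al al' be ta ta' tb da; have [_ w] := D 1%N 0%N isT.
    have := w _ (tensor_test ta tb).
    by rewrite /= (Dx_tensor be da).2 addn0 expr1 mulN1r.
  + apply: weak_sx => //; [exact: ID|exact: ID|].
    move=> al al' be ta ta' tb da; have [_ w] := D 1%N 1%N isT.
    have [_ w'] := D 0%N 1%N isT.
    have [be' db sb'] := tb.1 1%N.
    have := w _ (tensor_test ta tb); have := w' _ (tensor_test ta' tb).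
    rewrite /= (Dy_tensor al db).2 (Dy_tensor al' db).2 (Dx_tensor be' da).2.
    by rewrite /= expr1 sqrrN expr1n mul1r mulN1r => -> /eqP; rewrite eqr_oppLR => /eqP.
  + apply: weak_sx => //; [exact: ID|exact: ID|].
    move=> al al' be ta ta' tb da; have [_ w] := D 2%N 0%N isT.
    have [_ w'] := D 1%N 0%N isT.
    have := w _ (tensor_test ta tb); have := w' _ (tensor_test ta' tb).
    rewrite /= (Dx_tensor be da).2.
    by rewrite /= expr1 sqrrN expr1n mul1r mulN1r => -> /eqP; rewrite eqr_oppLR => /eqP.
- case=> [|[|i]] [|[|j]] // ij.
  + apply: weak_sy => //; [exact: ID|exact: ID|].
    move=> al be be' ta tb tb' db; have [_ w] := D 0%N 1%N isT.
    have := w _ (tensor_test ta tb).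
    by rewrite /= (Dy_tensor al db).2 expr1 mulN1r.
  + apply: weak_sy => //; [exact: ID|exact: ID|].
    move=> al be be' ta tb tb' db; have [_ w] := D 0%N 2%N isT.
    have [_ w'] := D 0%N 1%N isT.
    have := w _ (tensor_test ta tb); have := w' _ (tensor_test ta tb').
    rewrite /= (Dy_tensor al db).2.
    by rewrite /= expr1 sqrrN expr1n mul1r mulN1r => -> /eqP; rewrite eqr_oppLR => /eqP.
  + apply: weak_sy => //; [exact: ID|exact: ID|].
    move=> al be be' ta tb tb' db; have [_ w] := D 1%N 1%N isT.
    have [_ w'] := D 1%N 0%N isT.
    have := w _ (tensor_test ta tb); have := w' _ (tensor_test ta tb').
    rewrite /= (Dy_tensor al db).2.
    by rewrite /= expr1 sqrrN expr1n mul1r mulN1r => -> /eqP; rewrite eqr_oppLR => /eqP.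
Qed.

Lemma jet_deriv U i j : jet U -> (i + j <= 2)%N -> is_L2_deriv l i j (U 0%N 0%N) (U i j).
Proof.
move=> [LU sX sY] ij; split; first exact/Lq2P/LU.
have IU i' j' : (i' + j' <= 2)%N -> intg area (Omega l) (U i' j').
  by move=> /LU; exact: L2_intgO.
have l0 : 0 <= l by exact: ltW.
have WX i' j' phi : (i' + j' < 2)%N -> test_function l phi ->
   \int[area]_(z in Omega l) (U i' j' z * Dx phi z) = - \int[area]_(z in Omega l) (U i'.+1 j' z * phi z).
  by move=> h tphi; apply: sx_weak => //; [exact: sX|exact/IU/ltnW|exact: IU].
have WY i' j' phi : (i' + j' < 2)%N -> test_function l phi ->
   \int[area]_(z in Omega l) (U i' j' z * Dy phi z) = - \int[area]_(z in Omega l) (U i' j'.+1 z * phi z).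
  by move=> h tphi; apply: sy_weak => //; [exact: sY|exact/IU/ltnW|apply: IU; rewrite addnS].
move=> phi tphi; move: i j ij => [|[|[|i]]] [|[|[|j]]] // ij; rewrite /= ?expr0 ?expr1 ?sqrrN ?expr1n ?mul1r ?mulN1r//.
- by rewrite WY.
- by rewrite WY ?WY ?opprK//; exact: test_Dy.
- by rewrite WX.
- by rewrite WX ?WY ?opprK//; exact: test_Dy.
- by rewrite WX ?WX ?opprK//; exact: test_Dx.
Qed.

Lemma jet_H2 U : jet U -> H2 l (U 0%N 0%N).
Proof.
move=> jU; have [LU _ _] := jU; split; first exact/Lq2P/LU.
by move=> i j ij; exists (U i j); exact: jet_deriv.
Qed.

Lemma jet_wD U i j : jet U -> (i + j <= 2)%N ->
  {ae area, forall z, Omega l z -> wD l i j (U 0%N 0%N) z = U i j z}.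
Proof. by move=> jU ij; apply: wD_ae => //; [exact: jet_H2|exact: jet_deriv]. Qed.

End jets.
#[global] Hint Resolve measurable_Omega : core.

(** * Continuous versions *)

Section density.
Context {R : realType}.
Local Notation mu := (@lebesgue_measure R).
Local Notation mR := (measurableTypeR R).
Local Notation mplane := (mR * mR)%type.
Local Notation area := (@area R).

(** Serves for sets of full measure and for rational points, both dense: almost everywhere relations
    between continuous functions hold up to the boundary. *)
Lemma closure_le (T : topologicalType) (A S : set T) (phi : T -> R) :
  {within A, continuous phi} -> A `<=` closure S -> (forall x, S x -> A x) ->
  (forall x, S x -> phi x <= 0) -> forall x, A x -> phi x <= 0.
Proof.
move=> /subspace_continuousP cphi AS SA S0 x Ax; rewrite leNgt; apply/negP => px.
have N : nbhs (phi x) [set t | 0 < t] by exact: lt_nbhsr.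
have W := cphi x Ax _ N.
have [s [Ss Ws]] := AS _ Ax _ W.
by have := Ws (SA _ Ss); rewrite /= ltNge S0.
Qed.

Lemma ae_ex d (T : measurableType d) (m : {measure set T -> \bar R}) (D : set T)
    (P : T -> Prop) : measurable D -> m D != 0%E ->
  {ae m, forall x, D x -> P x} -> exists x, D x /\ P x.
Proof.
move=> mD D0 aeP; apply: contrapT => /forallNP N.
have : m.-negligible D.
  apply: negligibleS aeP => x Dx /=; apply/not_implyP; split=> // Px.
  by apply: (N x).
by move/(measure_negligible mD)/eqP; exact/negP.
Qed.

Lemma clip_itv (a b x e : R) : a < b -> a <= x <= b -> 0 < e ->
  let r := Num.max a (x - e) in let s := Num.min b (x + e) in
  [/\ a <= r, r < s, s <= b & forall t, r < t < s -> `|x - t| < e].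
Proof.
move=> ab /andP[ax xb] e0 r s; rewrite /r /s; split.
- by rewrite le_max lexx.
- by rewrite lt_min !gt_max; apply/andP; split; apply/andP; split; lra.
- by rewrite ge_min lexx.
- move=> t; rewrite lt_min gt_max => /andP[/andP[_ h1] /andP[_ h2]].
  by rewrite ltr_norml; apply/andP; split; lra.
Qed.

Lemma mu_itvoo_neq0 (r s : R) : r < s -> mu `]r, s[%classic != 0%E.
Proof.
move=> rs; rewrite lebesgue_measure_itv/= lte_fin rs -EFinD eqe subr_eq0.
by rewrite gt_eqF.
Qed.

Lemma ae_itv_dense (a b : R) (P : R -> Prop) : a < b ->
  {ae mu, forall x, `]a, b[%classic x -> P x} ->
  `[a, b]%classic `<=` closure [set x | `]a, b[%classic x /\ P x].
Proof.
move=> ab aeP x; rewrite /= in_itv/= => xab B /nbhs_ballP[e /= e0 sB].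
have [ar rs sb sub] := clip_itv ab xab e0.
set r := Num.max _ _ in ar rs sub; set s := Num.min _ _ in rs sb sub.
have sI t : `]r, s[%classic t -> `]a, b[%classic t.
  rewrite /= !in_itv/= => /andP[rt ts].
  by rewrite (le_lt_trans ar rt) (lt_le_trans ts sb).
have [t [rst Pt]] : exists t, `]r, s[%classic t /\ P t.
  apply: (@ae_ex _ mR mu) => //; first exact: mu_itvoo_neq0.
  by apply: filterS aeP => t h /sI; exact: h.
exists t; split; first by split => //; exact: sI.
by apply: sB; apply: sub; move: rst; rewrite /= in_itv.
Qed.

Lemma ae_rect_dense (a b c d : R) (P : R * R -> Prop) : a < b -> c < d ->
  {ae area, forall z, rect a b c d z -> P z} ->
  `[a, b]%classic `*` `[c, d]%classic `<=` closure [set z | rect a b c d z /\ P z].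
Proof.
move=> ab cd aeP [x y] [/=]; rewrite !in_itv/= => xab ycd B /nbhs_ballP[e /= e0 sB].
have [ar rs sb sub] := clip_itv ab xab e0.
set r := Num.max _ _ in ar rs sub; set s := Num.min _ _ in rs sb sub.
have [ar' rs' sb' sub'] := clip_itv cd ycd e0.
set r' := Num.max _ _ in ar' rs' sub'; set s' := Num.min _ _ in rs' sb' sub'.
have sI t : rect r s r' s' t -> rect a b c d t.
  move=> [/=]; rewrite !in_itv/= => /andP[rt ts] /andP[rt' ts'].
  split; rewrite /= in_itv/=; apply/andP; split; [exact: le_lt_trans rt|
    exact: lt_le_trans sb|exact: le_lt_trans rt'|exact: lt_le_trans sb'].
have [t [rst Pt]] : exists t, rect r s r' s' t /\ P t.
  apply: (@ae_ex _ mplane area) => //.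
    have := area_rect_fine (ltW rs) (ltW rs'); case: (area _) => [z|//|//] /= ->.
    by rewrite eqe mulf_neq0// subr_eq0 gt_eqF.
  by apply: filterS aeP => t h /sI; exact: h.
exists t; split; first by split => //; exact: sI.
move: rst => [/=]; rewrite !in_itv/= => h h'.
by apply: sB; split; [exact: sub|exact: sub'].
Qed.

Lemma ae_within_le a b (f g : R -> R) : a < b ->
  {within `[a, b], continuous f} -> {within `[a, b], continuous g} ->
  {ae mu, forall x, `]a, b[%classic x -> f x <= g x} ->
  forall x, `[a, b]%classic x -> f x <= g x.
Proof.
move=> ab cf cg fg x Ix; rewrite -subr_le0.
apply: (@closure_le _ `[a, b]%classic _ (fun x => f x - g x) _ (ae_itv_dense ab fg)) => //.
- by move=> t; apply: continuousB; [exact: cf|exact: cg].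
- by move=> t [h _]; exact: subset_itv_oo_cc h.
- by move=> t [_ /=]; rewrite subr_le0.
Qed.

Lemma ae_within_eq a b (f g : R -> R) : a < b ->
  {within `[a, b], continuous f} -> {within `[a, b], continuous g} ->
  {ae mu, forall x, `]a, b[%classic x -> f x = g x} ->
  forall x, `[a, b]%classic x -> f x = g x.
Proof.
move=> ab cf cg fg x Ix; apply/eqP; rewrite eq_le.
by apply/andP; split; apply: (ae_within_le ab) => //; apply: filterS fg => t h It; rewrite h.
Qed.

Definition crect a b c d : set (R * R) := `[a, b]%classic `*` `[c, d]%classic.

Lemma crect_within_le a b c d (f g : R * R -> R) : a < b -> c < d ->
  {within crect a b c d, continuous f} -> {within crect a b c d, continuous g} ->
  {ae area, forall x, rect a b c d x -> f x <= g x} ->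
  forall x, crect a b c d x -> f x <= g x.
Proof.
move=> ab cd cf cg fg x Ix; rewrite -subr_le0.
apply: (@closure_le _ (crect a b c d) _ (fun x => f x - g x) _ (ae_rect_dense ab cd fg)) => //.
- by move=> t; apply: continuousB; [exact: cf|exact: cg].
- by move=> t [[h1 h2] _]; split; exact: subset_itv_oo_cc.
- by move=> t [_ /=]; rewrite subr_le0.
Qed.

Lemma crect_within_eq a b c d (f g : R * R -> R) : a < b -> c < d ->
  {within crect a b c d, continuous f} -> {within crect a b c d, continuous g} ->
  {ae area, forall x, rect a b c d x -> f x = g x} ->
  forall x, crect a b c d x -> f x = g x.
Proof.
move=> ab cd cf cg fg x Ix; apply/eqP; rewrite eq_le.
by apply/andP; split; apply: (crect_within_le ab cd) => //; apply: filterS fg => t h It; rewrite h.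
Qed.

Lemma closure_rect a b c d : a < b -> c < d ->
  closure (rect a b c d : set (R * R)) = crect a b c d.
Proof.
move=> ab cd; apply/seteqP; split.
  have : closed (crect a b c d).
    have -> : crect a b c d = (fst @^-1` `[a, b]%classic) `&` (snd @^-1` `[c, d]%classic).
      by apply/seteqP; split => -[x y] [].
    by apply: closedI; apply: closed_comp => //; try exact: interval_closed;
      move=> z _; [exact: cvg_fst|exact: cvg_snd].
  move/closure_id => ->; apply: closure_subset => z [h1 h2].
  by split; exact: subset_itv_oo_cc.
move=> z /(ae_rect_dense ab cd (P := fun=> True)) h B /h [|t [[]]]; last by exists t.
by apply: aeW.
Qed.

Lemma within_section a b c d (f : R * R -> R) y : `[c, d]%classic y ->
  {within crect a b c d, continuous f} -> {within `[a, b], continuous (fun x => f (x, y))}.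
Proof.
move=> cdy /subspace_continuousP cf; apply/subspace_continuousP => x abx.
apply: (@cvg_comp _ _ _ (fun x => (x, y)) f _ (within (crect a b c d) (nbhs (x, y)))); last exact: cf.
move=> B /= [[U V] [/= nU nV] UV]; have : nbhs x [set t | `[a, b]%classic t -> B (t, y)].
  apply: filterS nU => t Ut abt.
  by apply: UV => //; split => //=; exact: nbhs_singleton.
by [].
Qed.

Lemma within_swp a b c d (f : R * R -> R) :
  {within crect a b c d, continuous f} -> {within crect c d a b, continuous (f \o swp)}.
Proof.
move=> /subspace_continuousP cf; apply/subspace_continuousP => -[x y] [/= cdx aby].
apply: (@cvg_comp _ _ _ swp f _ (within (crect a b c d) (nbhs (y, x)))); last exact: cf.
move=> B /= [[U V] [/= nU nV] UV]; exists (V, U) => //= -[s t] [/= Vs Ut] [/= h1 h2].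
by apply: UV.
Qed.

Lemma within_measurable a b c d (f : R * R -> R) :
  {within crect a b c d, continuous f} -> measurable_fun (rect a b c d) f.
Proof.
move=> /subspace_continuousP cf.
apply: (measurability _ (RGenOpens.measurableE R)) => _ [_ [s [t ->] <-]].
apply: open_plane_measurable; rewrite openE => z [rz fz].
have oz : nbhs z (rect a b c d) by apply: open_nbhs_nbhs; split => //; exact: open_rect.
have cz : crect a b c d z by case: rz => h1 h2; split; exact: subset_itv_oo_cc.
have := cf z cz `]s, t[%classic; rewrite nbhs_filterE /fmap /=.
have nf : nbhs (f z) `]s, t[%classic.
  by apply: open_nbhs_nbhs; split => //; exact: interval_open.
move=> /(_ nf) W; rewrite /interior.
apply: filterS2 oz W => x rx Wx; split => //; apply: Wx.
by case: rx => h1 h2; split; exact: subset_itv_oo_cc.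
Qed.

Lemma withinD (T : topologicalType) (A : set T) (f g : T -> R) :
  {within A, continuous f} -> {within A, continuous g} ->
  {within A, continuous (fun x => f x + g x)}.
Proof. by move=> cf cg t; apply: continuousD; [exact: cf|exact: cg]. Qed.

Lemma withinB (T : topologicalType) (A : set T) (f g : T -> R) :
  {within A, continuous f} -> {within A, continuous g} ->
  {within A, continuous (fun x => f x - g x)}.
Proof. by move=> cf cg t; apply: continuousB; [exact: cf|exact: cg]. Qed.

Lemma holder_within (A : set (R * R)) (f : R * R -> R) (K : R) :
  (forall z z', A z -> A z' -> `|f z - f z'| <=
     K * (Num.sqrt `|z.1 - z'.1| + Num.sqrt `|z.2 - z'.2|)) ->
  {within A, continuous f}.
Proof.
move=> H; apply/subspace_continuousP => z Az; apply/cvgrPdist_le => e e0.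
have c : (fun z' : R * R => K * (Num.sqrt `|z.1 - z'.1| + Num.sqrt `|z.2 - z'.2|)) @ z --> (0 : R).
  have -> : 0 = K * (Num.sqrt `|z.1 - z.1| + Num.sqrt `|z.2 - z.2|).
    by rewrite !subrr normr0 sqrtr0 addr0 mulr0.
  apply: cvgM; first exact: cvg_cst.
  apply: cvgD; apply: continuous_cvg; try exact: sqrt_continuous;
    apply: cvg_norm; apply: cvgB; try exact: cvg_cst; [exact: cvg_fst|exact: cvg_snd].
move/cvgrPdist_le : c => /(_ _ e0) c.
have : nbhs z [set t | A t -> `|f z - f t| <= e].
  apply: filterS c => t h At.
  apply: le_trans (H _ _ Az At) _; move: h.
  by rewrite sub0r normrN; apply: le_trans; exact: ler_norm.
by [].
Qed.

End density.

(** * Marginals, and integrals over boxes as functions of a corner *)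

Section marginals.
Context {R : realType}.
Local Notation mu := (@lebesgue_measure R).
Local Notation mR := (measurableTypeR R).
Local Notation mplane := (mR * mR)%type.
Local Notation area := (@area R).
Implicit Types (a b c d x y : R) (f g h : R * R -> R) (F G : R -> R).

Lemma rat_dense a b : a < b ->
  `[a, b]%classic `<=` closure [set x : R | `]a, b[%classic x /\ exists q, x = ratr q].
Proof.
move=> ab x; rewrite /= in_itv/= => xab B /nbhs_ballP[e /= e0 sB].
have [ar rs sb sub] := clip_itv ab xab e0.
set r := Num.max _ _ in ar rs sub; set s := Num.min _ _ in rs sb sub.
have [q] := rat_in_itvoo rs; rewrite in_itv/= => /andP[rq qs].
exists (ratr q); split; last by apply: sB; apply: sub; rewrite rq.
split; last by exists q.
by rewrite /= in_itv/= (le_lt_trans ar rq) (lt_le_trans qs sb).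
Qed.

Lemma tailprim_cst1 a b x : x <= b -> tailprim b (cst 1) x = b - x.
Proof.
move=> xb; rewrite /tailprim Rintegral_cst//.
by rewrite itvoo_fine// mul1r.
Qed.

(** Expresses the value [k] at the left end by integrals over the whole interval, which unlike a
    point value can be handled by Fubini and L2 limits. *)
Lemma ac1_boundary a b F G k : a <= b ->
  measurable_fun (`]a, b[%classic : set mR) F -> intg mu `]a, b[%classic G ->
  {ae mu, forall x, `]a, b[%classic x -> F x = k + prim a G x} ->
  \int[mu]_(x in `]a, b[) F x =
  (b - a) * k + \int[mu]_(x in `]a, b[) ((b - x) * G x).
Proof.
move=> ab mF Gi FE; have i1 : intg mu `]a, b[%classic (cst 1 : R -> R).
  by apply: (@intg_bounded _ _ _ _ _ _ _ 1) => //; [exact: itvoo_fin|move=> x _; rewrite normr1].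
have ik : intg mu `]a, b[%classic (cst k : R -> R).
  by apply: (@intg_bounded _ _ _ _ _ _ _ `|k|) => //; exact: itvoo_fin.
have ip := intg_prim k Gi.
have -> : \int[mu]_(x in `]a, b[) F x = \int[mu]_(x in `]a, b[) (k + prim a G x).
  by apply: (@Rint_ae _ mR R mu) => //; exact: intg_meas ip.
rewrite RintegralD//; last by have := intg_prim 0 Gi; congr (intg _ _ _); apply/funext => x; rewrite add0r.
rewrite Rintegral_cst//.
rewrite itvoo_fine// mulrC; congr (_ + _).
have -> : \int[mu]_(x in `]a, b[) prim a G x = \int[mu]_(x in `]a, b[) (prim a G x * cst 1 x).
  by apply: eq_Rintegral => x _; rewrite mulr1.
rewrite triangle_fubini//; apply: eq_Rintegral => x; rewrite inE/= in_itv/= => /andP[_ xb].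
by rewrite tailprim_cst1 ?ltW// mulrC.
Qed.

Lemma rect_sub a b c d a' b' c' d' : a <= a' -> b' <= b -> c <= c' -> d' <= d ->
  (rect a' b' c' d' : set (R * R)) `<=` rect a b c d.
Proof.
move=> aa bb cc dd [x y] [/=]; rewrite !in_itv/= => /andP[h1 h2] /andP[h3 h4].
split; rewrite /= in_itv/=; apply/andP; split; [exact: le_lt_trans h1|
  exact: lt_le_trans bb|exact: le_lt_trans h3|exact: lt_le_trans dd].
Qed.

Lemma intg_rect_sub a b c d a' b' c' d' f : intg area (rect a b c d) f ->
  a <= a' -> b' <= b -> c <= c' -> d' <= d -> intg area (rect a' b' c' d') f.
Proof.
move=> fi aa bb cc dd; apply: (@integrableS _ mplane R area (rect a b c d)) => //.
exact: rect_sub.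
Qed.

Lemma fubini_rect_swp a b c d f : intg area (rect a b c d) f ->
  intg mu `]a, b[%classic (fun x => \int[mu]_(y in `]c, d[) f (x, y)) /\
  \int[area]_(z in rect a b c d) f z =
  \int[mu]_(x in `]a, b[) \int[mu]_(y in `]c, d[) f (x, y).
Proof.
move=> fi; have [_ h1 h2] := fubini_rect (intg_swp fi); split => //.
by rewrite -(Rint_swp fi).
Qed.

Lemma sqr_rect_le a b c d a' b' c' d' f : L2 area (rect a b c d) f ->
  a <= a' -> a' <= b' -> b' <= b -> c <= c' -> c' <= d' -> d' <= d ->
  `|\int[area]_(z in rect a' b' c' d') f z| <=
  Num.sqrt ((b' - a') * (d' - c') * n2 area (rect a b c d) f).
Proof.
move=> [mf fi] aa ab bb cc cd dd.
have sub : rect a' b' c' d' `<=` rect a b c d.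
  exact: rect_sub.
have l' : L2 area (rect a' b' c' d') f.
  split; first exact: measurable_funS mf.
  exact: (intg_rect_sub fi).
have i' : intg area (rect a' b' c' d') f by apply: L2_intg => //; exact: area_rect_fin.
apply: (le_trans (le_normr_Rintegral _ i')) => //.
rewrite -[leLHS]ger0_norm ?Rintegral_ge0//.
rewrite -sqrtr_sqr ler_sqrt; last first.
  by rewrite !mulr_ge0 ?subr_ge0 ?n2_ge0.
apply: (le_trans (Rint_abs_sqr_le (measurable_rect _ _ _ _) (area_rect_fin _ _ _ _) l')).
rewrite area_rect_fine// ler_wpM2l ?mulr_ge0 ?subr_ge0//.
rewrite /n2; apply: fine_le.
- by apply: integrable_fin_num => //; exact: l'.2.
- by apply: integrable_fin_num.
- apply: ge0_subset_integral => //; first by apply/measurable_EFinP; exact: measurable_funX.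
  by move=> x _; rewrite lee_fin sqr_ge0.
Qed.

(* The tensor products with one-dimensional test functions identify the weak
   derivative of a marginal. *)
Lemma sacx_marginal a b c d f h : c < d -> intg area (rect a b c d) f ->
  intg area (rect a b c d) h -> sacx c d a b (f \o swp) (h \o swp) ->
  ac1 c d (fun y => \int[mu]_(x in `]a, b[) f (x, y))
          (fun y => \int[mu]_(x in `]a, b[) h (x, y)).
Proof.
move=> cd fi hi S.
have [_ fm _] := fubini_rect fi; have [_ hm _] := fubini_rect hi.
have marg g (al : R -> R) : intg area (rect a b c d) g -> continuous al ->
    (exists M, forall x, `|al x| <= M) ->
    \int[mu]_(y in `]c, d[) ((\int[mu]_(x in `]a, b[) g (x, y)) * al y) =
    \int[area]_(z in rect c d a b) ((g \o swp) z * al z.1).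
  move=> gi ca ba; have ga := intg_mul_snd gi ca ba.
  rewrite -(Rint_swp (intg_swp ga)).
  have -> : \int[area]_(z in rect a b c d) ((fun z => g z * al z.2) \o swp) (swp z) =
      \int[area]_(z in rect a b c d) (g z * al z.2).
    by apply: eq_Rintegral => -[].
  have [ae1 _ ->] := fubini_rect ga.
  apply: (@Rint_ae _ mR R mu) => //.
  - apply: (@measurable_funM _ mR); first by have [_ /intg_meas] := fubini_rect gi.
    apply: measurable_funTS; exact: continuous_measurable_fun.
  - by have [_ /intg_meas] := fubini_rect ga.
  have [ae2 _ _] := fubini_rect gi.
  by apply: filterS ae2 => y h2 Cy; rewrite /= RintegralZr//; exact: h2.
apply: ac1_of_dubois => // i.
have ti := dubois_test1 i cd; have t0 := dubois_integral i cd.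
have [tp dp _] := tprimP ti t0.
have cdub : continuous (dubois c d i) by exact: smooth1_continuous (ti.1 0%N).
have ctp : continuous (tprim (dubois c d i)) by exact: smooth1_continuous (tp.1 0%N).
have bdub := test1_bounded ti; have btp := test1_bounded tp.
have [r [s [cr sd out]]] := tp.2.
rewrite !marg//; apply: (@sacx_weak _ c d a b _ _ (fun z => tprim (dubois c d i) z.1) (fun z => dubois c d i z.1)) => //.
- exact: ltW.
- by move=> y /=; apply: out; rewrite ltNge (ltW cr).
- by move=> y /=; apply: out; rewrite negb_and orbC -leNgt (ltW sd).
- by apply: intg_mul_fst => //; exact: intg_swp.
- by apply: intg_mul_fst => //; exact: intg_swp.
Qed.

Definition box a c f x y : R := \int[area]_(z in rect a x c y) f z.

Lemma box_left a c f y : box a c f a y = 0.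
Proof. by rewrite /box /rect set_itvoo0// set0X Rintegral_set0. Qed.

Lemma box_bottom a c f x : box a c f x c = 0.
Proof. by rewrite /box /rect set_itvoo0// setX0 Rintegral_set0. Qed.

Lemma box_fubini a c f x y : intg area (rect a x c y) f ->
  box a c f x y = prim c (fun t => \int[mu]_(s in `]a, x[) f (s, t)) y.
Proof. by move=> fi; have [_ _] := fubini_rect fi. Qed.

Lemma box_swp a c f x y : intg area (rect a x c y) f ->
  box a c f x y = box c a (f \o swp) y x.
Proof. by move=> fi; rewrite /box -(Rint_swp fi). Qed.

Lemma box_sub a b c d f x x' y : intg area (rect a b c d) f ->
  a <= x -> x <= x' -> x' <= b -> y <= d ->
  box a c f x' y - box a c f x y = \int[area]_(z in rect x x' c y) f z.
Proof.
move=> fi ax xx xb yd.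
have i u v : a <= u -> v <= b -> intg area (rect u v c y) f.
  by move=> au vb; exact: (intg_rect_sub fi).
have [m _] := fubini_rect_swp (i a b (lexx a) (lexx b)).
rewrite /box (fubini_rect_swp (i a x' _ _)).2// (fubini_rect_swp (i a x _ _)).2//; last exact: le_trans xb.
rewrite (fubini_rect_swp (i x x' _ _)).2//.
exact: (prim_sub m).
Qed.

(** The difference is the integral over a strip of width [|x - x'|], estimated by Cauchy-Schwarz. *)
Lemma box_holder_x a b c d f x x' y : L2 area (rect a b c d) f ->
  a <= x <= b -> a <= x' <= b -> c <= y <= d ->
  `|box a c f x y - box a c f x' y| <=
  Num.sqrt ((d - c) * n2 area (rect a b c d) f) * Num.sqrt `|x - x'|.
Proof.
move=> lf; wlog xx : x x' / x' <= x.
  move=> W h1 h2; case/orP: (le_total x' x) => h; first exact: W.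
  by rewrite distrC [`|x - _|]distrC; exact: W.
move=> /andP[ax xb] /andP[ax' xb'] /andP[cy yd].
have fi : intg area (rect a b c d) f by apply: L2_intg => //; exact: area_rect_fin.
rewrite (box_sub fi)// -sqrtrM ?mulr_ge0 ?subr_ge0 ?n2_ge0//; last exact: le_trans yd.
apply: (le_trans (sqr_rect_le lf _ _ _ _ _ _)) => //.
rewrite ler_sqrt ?mulr_ge0 ?subr_ge0 ?n2_ge0//; last exact: le_trans yd.
rewrite (ger0_norm (_ : 0 <= x - x')) ?subr_ge0// [leRHS]mulrC mulrA ler_wpM2r ?n2_ge0//.
by rewrite ler_wpM2l ?subr_ge0// lerD2r.
Qed.

Lemma L2_swp a b c d f : L2 area (rect a b c d) f ->
  L2 area (rect c d a b) (f \o swp) /\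
  n2 area (rect c d a b) (f \o swp) = n2 area (rect a b c d) f.
Proof.
move=> [mf fi]; split; first by split; [exact: meas_swp|exact: (intg_swp fi)].
exact: (Rint_swp fi).
Qed.

Lemma box_holder a b c d f z z' : L2 area (rect a b c d) f ->
  crect a b c d z -> crect a b c d z' ->
  `|box a c f z.1 z.2 - box a c f z'.1 z'.2| <=
  (Num.sqrt ((d - c) * n2 area (rect a b c d) f) +
   Num.sqrt ((b - a) * n2 area (rect a b c d) f)) *
  (Num.sqrt `|z.1 - z'.1| + Num.sqrt `|z.2 - z'.2|).
Proof.
case: z => x y; case: z' => x' y' lf [/=]; rewrite !in_itv/= => xab ycd [/=].
rewrite !in_itv/= => xab' ycd'.
have fi : intg area (rect a b c d) f by apply: L2_intg => //; exact: area_rect_fin.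
have -> : box a c f x y - box a c f x' y' =
  (box a c f x y - box a c f x' y) + (box a c f x' y - box a c f x' y') by ring.
apply: (le_trans (ler_normD _ _)).
have [ls ns] := L2_swp lf.
have i u v : u <= b -> v <= d -> intg area (rect a u c v) f.
  by move=> ub vd; exact: (intg_rect_sub fi).
have := box_holder_x lf xab xab' ycd; have := box_holder_x ls ycd ycd' xab'.
have [[_ xb'] [_ yd] [_ yd']] := And3 (andP xab') (andP ycd) (andP ycd').
rewrite -!box_swp ?ns; [|exact: i|exact: i].
move: (sqrtr_ge0 ((d - c) * n2 area (rect a b c d) f)) (sqrtr_ge0 ((b - a) * n2 area (rect a b c d) f)).
move: (sqrtr_ge0 `|x - x'|) (sqrtr_ge0 `|y - y'|).
move: (Num.sqrt _) => p; move: (Num.sqrt _) => q; move: (Num.sqrt _) => r; move: (Num.sqrt _) => s.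
nra.
Qed.

Lemma box_continuous a b c d f : L2 area (rect a b c d) f ->
  {within crect a b c d, continuous (fun z => box a c f z.1 z.2)}.
Proof.
move=> lf; apply: (@holder_within _ _ _ (Num.sqrt ((d - c) * n2 area (rect a b c d) f) +
  Num.sqrt ((b - a) * n2 area (rect a b c d) f))) => z z' Az Az'; exact: box_holder.
Qed.

Lemma box_edge_continuous a b c d f : c <= d -> L2 area (rect a b c d) f ->
  {within crect a b c d, continuous (fun z => box a c f z.1 d)}.
Proof.
move=> cd lf; apply: (@holder_within _ _ _ (Num.sqrt ((d - c) * n2 area (rect a b c d) f) +
   Num.sqrt ((b - a) * n2 area (rect a b c d) f))) => -[x y] [x' y'] [/= h1 h2] [/= h3 h4].
have e : `[c, d]%classic d by rewrite /= in_itv/= lexx cd.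
apply: (le_trans (@box_holder _ _ _ _ _ (x, d) (x', d) lf (conj h1 e) (conj h3 e))).
rewrite /= subrr normr0 sqrtr0 addr0 ler_wpM2l ?addr_ge0 ?sqrtr_ge0//.
by rewrite lerDl sqrtr_ge0.
Qed.

End marginals.

(** * The boundary condition and the gap *)

Section boundary.
Context {R : realType}.
Local Notation mu := (@lebesgue_measure R).
Local Notation mR := (measurableTypeR R).
Local Notation mplane := (mR * mR)%type.
Local Notation area := (@area R).
Local Notation pi := (@pi R).
Variables (l : R) (l_gt0 : 0 < l).
Implicit Types (u v w : R * R -> R) (U V : nat -> nat -> R * R -> R).

Lemma Nl_lt : - l < l. Proof. by have := l_gt0; lra. Qed.
Let nl := Nl_lt.
Let nle := ltW nl.
Let p0 := pi_gt0 R.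
Let p0' := pi_ge0 R.

(* The boundary condition on [u = U 0 0]: by [sx], [u (x, y) = k + \int_0^x U 1 0],
   and the second integral is [pi * u (pi, y)]. *)
Definition hinged U := {ae mu, forall y, `]- l, l[%classic y ->
  \int[mu]_(x in `]0, pi[) U 1%N 0%N (x, y) = 0 /\
  \int[mu]_(x in `]0, pi[) (U 0%N 0%N (x, y) + x * U 1%N 0%N (x, y)) = 0}.

Lemma hinged_prim U : sx l (U 0%N 0%N) (U 1%N 0%N) -> hinged U ->
  {ae mu, forall y, `]- l, l[%classic y ->
    [/\ intg mu `]0, pi[%classic (fun x => U 1%N 0%N (x, y)),
    prim 0 (fun x => U 1%N 0%N (x, y)) pi = 0 &
    {ae mu, forall x, `]0, pi[%classic x ->
       U 0%N 0%N (x, y) = prim 0 (fun x => U 1%N 0%N (x, y)) x}]}.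
Proof.
move=> S Z; apply: filterS2 S Z => y S Z ly.
have A := S ly; have Fi := ac1_intg A; have [mF Gi [k Fk]] := A.
have [Z1 Z2] := Z ly; split => //.
move: Z2; have ix : intg mu `]0, pi[%classic (fun x => x * U 1%N 0%N (x, y)).
  apply: (@intgMl _ mR R mu) => //.
  exists pi => x; rewrite /= in_itv/= => /andP[x0 xp].
  by rewrite ger0_norm ltW.
(* Since the integral of [U 1 0] over the line vanishes, the second condition reduces to
   [pi * k = 0]. *)
rewrite RintegralD// (ac1_boundary p0' mF Gi Fk).
have -> : \int[mu]_(x in `]0, pi[) ((pi - x) * U 1%N 0%N (x, y)) =
  \int[mu]_(x in `]0, pi[) (pi * U 1%N 0%N (x, y) - x * U 1%N 0%N (x, y)).
  by apply: eq_Rintegral => x _; rewrite mulrBl.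
rewrite RintegralB//; last exact: intgZ.
rewrite RintegralZl// Z1 mulr0 sub0r subrK subr0 => /eqP.
rewrite mulf_eq0 gt_eqF//= => /eqP k0; apply: filterS Fk => x h /h.
by rewrite k0 add0r.
Qed.

Lemma prim_hinged U : sx l (U 0%N 0%N) (U 1%N 0%N) ->
  {ae mu, forall y, `]- l, l[%classic y ->
    prim 0 (fun x => U 1%N 0%N (x, y)) pi = 0 /\
    {ae mu, forall x, `]0, pi[%classic x ->
       U 0%N 0%N (x, y) = prim 0 (fun x => U 1%N 0%N (x, y)) x}} -> hinged U.
Proof.
move=> S Z; apply: filterS2 S Z => y S Z ly.
have A := S ly; have Fi := ac1_intg A; have [mF Gi _] := A.
have [Z1 Fp] := Z ly; split => //.
have Fk : {ae mu, forall x, `]0, pi[%classic x ->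
    U 0%N 0%N (x, y) = 0 + prim 0 (fun x => U 1%N 0%N (x, y)) x}.
  by apply: filterS Fp => x h /h ->; rewrite add0r.
have ix : intg mu `]0, pi[%classic (fun x => x * U 1%N 0%N (x, y)).
  apply: (@intgMl _ mR R mu) => //.
  exists pi => x; rewrite /= in_itv/= => /andP[x0 xp].
  by rewrite ger0_norm ltW.
rewrite RintegralD// (ac1_boundary p0' mF Gi Fk).
have -> : \int[mu]_(x in `]0, pi[) ((pi - x) * U 1%N 0%N (x, y)) =
  \int[mu]_(x in `]0, pi[) (pi * U 1%N 0%N (x, y) - x * U 1%N 0%N (x, y)).
  by apply: eq_Rintegral => x _; rewrite mulrBl.
rewrite RintegralB//; last exact: intgZ.
rewrite RintegralZl//; move: Z1; rewrite /prim => ->.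
by rewrite !mulr0 sub0r add0r addNr.
Qed.

(* The function [\int_0^x U 1 0 (., y)] has y-derivative [\int_0^x U 1 1 (., y)];
   its value at [y = - l] is recovered from its mean over [y], which is the
   integral of [corr].  All pointwise values are thus integrals of square
   integrable functions over boxes, continuous in the corners of the box. *)
Definition corr U (z : R * R) := (2 * l)^-1 * (U 1%N 0%N z - (l - z.2) * U 1%N 1%N z).

Definition cversion U (z : R * R) : R :=
  box 0 (- l) (corr U) z.1 l + box 0 (- l) (U 1%N 1%N) z.1 z.2.

Lemma L2_snd f : L2 area (Omega l) f -> L2 area (Omega l) (fun z => (l - z.2) * f z).
Proof.
move=> lf; apply: (@L2_le _ mplane R area _ (measurable_Omega l) _ (fun z => 2 * l * `|f z|)).
- apply: measurable_funM lf.1; apply: measurable_funB => //.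
  exact: measurable_funTS measurable_snd.
- by apply: L2Z => //; exact: L2_abs.
- apply: aeW => z [_ /=]; rewrite in_itv/= => /andP[h1 h2].
  by rewrite normrM ler_wpM2r// ger0_norm; lra.
Qed.

Lemma L2_corr U : jet l U -> L2 area (Omega l) (corr U).
Proof.
move=> [LU _ _]; apply: L2Z => //; apply: L2B => //; first exact: LU.
by apply: L2_snd; exact: LU.
Qed.

Lemma prim_cversion U x : jet l U -> `[0, pi]%classic x ->
  {ae mu, forall y, `]- l, l[%classic y ->
    prim 0 (fun x => U 1%N 0%N (x, y)) x = cversion U (x, y)}.
Proof.
move=> jU; have [LU sX sY] := jU; rewrite /= in_itv/= => /andP[x0 xp].
have ig := L2_intgO (LU 1%N 0%N isT); have iq := L2_intgO (LU 1%N 1%N isT).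
have is_ f y : intg area (Omega l) f -> y <= l -> intg area (rect 0 x (- l) y) f.
  by move=> fi yl; exact: (intg_rect_sub fi).
have ig' := is_ _ _ ig (lexx l); have iq' := is_ _ _ iq (lexx l).
have S : sacx (- l) l 0 x (U 1%N 0%N \o swp) (U 1%N 1%N \o swp).
  apply: filterS (sY 1%N 0%N isT) => t h; rewrite /= in_itv/= => /andP[t0 tx].
  by apply: h; rewrite /= in_itv/= t0 (lt_le_trans tx xp).
have [mF Gi [k Fk]] := sacx_marginal nl ig' iq' S.
have B := ac1_boundary nle mF Gi Fk.
have ic := L2_intgO (L2_corr jU).
have iq2 := is_ _ _ (L2_intgO (L2_snd (LU 1%N 1%N isT))) (lexx l).
have [ae1 i1 E1] := fubini_rect ig'; have [ae2 i2 E2] := fubini_rect iq2.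
have K : k = box 0 (- l) (corr U) x l.
  rewrite /box /corr RintegralZl//; last exact: intgB.
  rewrite RintegralB// E1 E2 B.
  have -> : \int[mu]_(y in `]- l, l[) \int[mu]_(t in `]0, x[) ((l - y) * U 1%N 1%N (t, y)) =
      \int[mu]_(y in `]- l, l[) ((l - y) * \int[mu]_(t in `]0, x[) U 1%N 1%N (t, y)).
    have [ae3 i3 E3] := fubini_rect iq'.
    apply: (@Rint_ae _ mR R mu) => //; first exact: intg_meas i2.
      apply: (@measurable_funM _ mR); last exact: intg_meas i3.
      exact: measurable_funB.
    by apply: filterS ae3 => y h ly; rewrite RintegralZl//; exact: h.
  rewrite addrK; have -> : l - - l = 2 * l by ring.
  by rewrite mulrA mulVf ?mul1r// mulf_neq0// gt_eqF.
apply: filterS Fk => y h ly; rewrite /cversion /= -K.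
have yl : y <= l by move: ly; rewrite /= in_itv/= => /andP[_ /ltW].
by rewrite /prim (h ly) (box_fubini (is_ _ _ iq yl)).
Qed.

Lemma cversion_continuous U : jet l U -> {within crect 0 pi (- l) l, continuous (cversion U)}.
Proof.
move=> jU; have [LU _ _] := jU.
apply: withinD; first exact: (box_edge_continuous nle (L2_corr jU)).
exact: (box_continuous (LU 1%N 1%N isT)).
Qed.

(** Exchanges the quantifiers of [prim_cversion]: one null set of [y] serves all rational [x], and
    both sides are continuous in [x]. *)
Lemma ae_prim_cversion U : jet l U -> {ae mu, forall y, `]- l, l[%classic y ->
  forall x, `[0, pi]%classic x -> prim 0 (fun x => U 1%N 0%N (x, y)) x = cversion U (x, y)}.
Proof.
move=> jU; have [LU sX _] := jU.
have Q : {ae mu, forall y, forall q : rat, `]- l, l[%classic y -> `[0, pi]%classic (ratr q : R) ->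
    prim 0 (fun x => U 1%N 0%N (x, y)) (ratr q) = cversion U (ratr q, y)}.
  apply: ae_forall_count => q; have [qp|nq] := pselect (`[0, pi]%classic (ratr q : R)).
    by apply: filterS (prim_cversion jU qp) => y h /h.
  by apply: aeW.
have [ae1 _ _] := fubini_rect (L2_intgO (LU 1%N 0%N isT)).
apply: filterS2 ae1 Q => y gi Q ly x xp.
have c1 := prim_continuous p0' (gi ly).
have c2 : {within `[0, pi], continuous (fun x => cversion U (x, y))}.
  by apply: (within_section _ (cversion_continuous jU)); exact: subset_itv_oo_cc ly.
have SA t : (`]0, pi[%classic t /\ exists q, t = ratr q :> R) -> `[0, pi]%classic t.
  by move=> [h _]; exact: subset_itv_oo_cc h.
apply/eqP; rewrite eq_le -subr_le0 -[X in _ && X]subr_le0; apply/andP; split.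
  apply: (closure_le (phi := fun x => prim 0 (fun x => U 1%N 0%N (x, y)) x - cversion U (x, y)) _ (rat_dense p0) SA) => //.
    exact: withinB c1 c2.
  by move=> t St; have := SA _ St; case: St => _ [q ->] hq; rewrite Q// subrr.
apply: (closure_le (phi := fun x => cversion U (x, y) - prim 0 (fun x => U 1%N 0%N (x, y)) x) _ (rat_dense p0) SA) => //.
  exact: withinB c2 c1.
by move=> t St; have := SA _ St; case: St => _ [q ->] hq; rewrite Q// subrr.
Qed.

Lemma hinged_cversion U : jet l U -> hinged U ->
  {ae area, forall z, Omega l z -> U 0%N 0%N z = cversion U z}.
Proof.
move=> jU Z; have [LU sX sY] := jU.
have mc := within_measurable (cversion_continuous jU).
suff : {ae area, forall z, rect 0 pi (- l) l z -> U 0%N 0%N z - cversion U z = 0}.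
  by apply: filterS => z h /h /eqP; rewrite subr_eq0 => /eqP.
apply: ae_rect0; first by apply: measurable_funB mc; exact: (LU 0%N 0%N isT).1.
apply: filterS2 (hinged_prim (sX 0%N 0%N isT) Z) (ae_prim_cversion jU) => y h1 h2 ly.
have [_ _ h3] := h1 ly; apply: filterS h3 => x h xp.
by rewrite h// h2 ?subrr//; exact: subset_itv_oo_cc xp.
Qed.

Lemma cversion_left U y : cversion U (0, y) = 0.
Proof. by rewrite /cversion /= !box_left addr0. Qed.

Lemma cversion_right U y : jet l U -> hinged U -> `[- l, l]%classic y -> cversion U (pi, y) = 0.
Proof.
move=> jU Z ly; have [LU sX sY] := jU.
have pp : `[0, pi]%classic pi by rewrite /= in_itv/= p0' lexx.
apply: (@ae_within_eq _ (- l) l (fun y => cversion U (pi, y)) (fun=> 0)) => //.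
- exact: (within_section pp (within_swp (cversion_continuous jU))).
- by move=> t; exact: cst_continuous.
- apply: filterS2 (hinged_prim (sX 0%N 0%N isT) Z) (prim_cversion jU pp) => t h1 h2 lt.
  by have [_ h3 _] := h1 lt; rewrite -h2.
Qed.

Lemma continuous_version_cversion U : jet l U -> hinged U ->
  continuous_version l (U 0%N 0%N) (cversion U).
Proof.
move=> jU Z; split; last by apply: filterS (hinged_cversion jU Z) => z h /h.
by rewrite (closure_rect p0 nl); exact: cversion_continuous.
Qed.

Lemma hinged_H2star U : jet l U -> hinged U -> H2star l (U 0%N 0%N).
Proof.
move=> jU Z; split; first exact: jet_H2.
exists (cversion U); first exact: continuous_version_cversion.
by move=> y ly; split; [exact: cversion_left|apply: cversion_right => //; exact: subset_itv_oo_cc ly].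
Qed.

(** On almost every horizontal line, [w] and the constant plus primitive given by [ac1] are
    continuous and agree almost everywhere, hence up to the end points, where [w] vanishes. *)
Lemma H2star_hinged u : H2star l u -> hinged (wjet l u).
Proof.
move=> [Hu [w [cw wu] w0]]; have [LU sX sY] := H2_jet l_gt0 Hu.
apply: prim_hinged; first exact: sX.
rewrite (closure_rect p0 nl) in cw.
apply: filterS2 (sX 0%N 0%N isT) (ae_sec wu) => y A E ly.
have [mF Gi [k Fk]] := A ly; have Ey := E ly.
have [w1 w2] := w0 _ ly.
have W x : `[0, pi]%classic x -> w (x, y) = k + prim 0 (fun x => wjet l u 1 0 (x, y)) x.
  apply: (@ae_within_eq _ 0 pi (fun x => w (x, y)) (fun x => k + prim 0 (fun x0 => wjet l u 1 0 (x0, y)) x)) => //.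
  - by apply: (within_section _ cw); exact: subset_itv_oo_cc ly.
  - apply: withinD; first by move=> t; exact: cst_continuous.
    exact: (prim_continuous p0' Gi).
  - by apply: filterS2 Fk Ey => t h1 h2 pt; rewrite h2// -h1.
have k0 : k = 0.
  have := W 0; rewrite /= in_itv/= lexx p0' w1 /prim set_itvoo0// Rintegral_set0 addr0.
  by move=> /(_ isT).
split.
  by have := W pi; rewrite /= in_itv/= lexx p0' w2 k0 add0r => /(_ isT).
by apply: filterS Fk => x h /h; rewrite k0 add0r.
Qed.

Lemma cont_rep_eq u w z : continuous_version l u w -> closure (Omega l) z ->
  cont_rep l u z = w z.
Proof.
move=> cw; have : continuous_version l u (cont_rep l u).
  exact: (@xgetPex _ (cst 0) [set w | continuous_version l u w] (ex_intro _ w cw)).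
case: cw => cw wu [cr ru].
move: cw cr; rewrite (closure_rect p0 nl) => cw cr; apply: (crect_within_eq p0 nl) => //.
by apply: filterS2 wu ru => t h1 h2 Ot; rewrite h1// h2.
Qed.

Lemma gap_box U x : jet l U -> hinged U -> `[0, pi]%classic x ->
  gap l (U 0%N 0%N) x = box 0 (- l) (U 1%N 1%N) x l.
Proof.
move=> jU Z xp; have cv := continuous_version_cversion jU Z.
have cl y : `[- l, l]%classic y -> closure (Omega l) (x, y).
  by move=> ly; rewrite (closure_rect p0 nl).
rewrite /gap !(cont_rep_eq cv); [|apply: cl; rewrite /= in_itv/= lexx nle..] => //.
(* The [corr] term does not depend on [y] and cancels; at [y = - l] the other box is empty. *)
rewrite /cversion /= opprD addrACA subrr add0r.
rewrite [X in _ - X](_ : _ = 0) ?subr0//.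
exact: box_bottom.
Qed.

Lemma gap_right U : jet l U -> hinged U -> box 0 (- l) (U 1%N 1%N) pi l = 0.
Proof.
move=> jU Z; have := cversion_right jU Z (y := l); have := cversion_right jU Z (y := - l).
rewrite /cversion /= !in_itv/= !lexx nle => /(_ isT) h1 /(_ isT); rewrite -{}[RHS]h1 => /addrI ->.
exact: box_bottom.
Qed.

End boundary.

(** * Energy estimates *)

Section estimates.
Context {R : realType}.
Local Notation mu := (@lebesgue_measure R).
Local Notation mR := (measurableTypeR R).
Local Notation mplane := (mR * mR)%type.
Local Notation area := (@area R).
Lemma intg_le_ae disp (T : measurableType disp) (m : {measure set T -> \bar R}) (D : set T)
    (f g : T -> R) : measurable D -> measurable_fun D f ->
  {ae m, forall x : T, D x -> `|f x| <= g x} -> intg m D g -> intg m D f.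
Proof.
move=> mD mf fg gi; pose k (x : T) := Num.min `|f x| `|g x|.
have mg := intg_meas gi.
have mf' : measurable_fun D (fun x => `|f x|) by apply: measurableT_comp mf.
have mg' : measurable_fun D (fun x => `|g x|) by apply: measurableT_comp mg.
have ki : intg m D k.
  apply: (@intg_le _ _ _ _ _ mD _ (fun x => `|g x|)).
  - exact: measurable_minr.
  - by move=> x _; rewrite /k ger0_norm ?le_min ?normr_ge0// ge_min lexx orbT.
  - exact: intg_abs.
apply: (@intg_le _ _ _ _ _ mD _ (fun x => `|f x|)) => //.
apply: (intg_ae mD ki) => //.
apply: filterS fg => x h Dx; rewrite /k min_l//.
by apply: (le_trans (h Dx)); exact: ler_norm.
Qed.

Implicit Types (a b c d x y : R) (f g h : R * R -> R) (F G : R -> R).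

Lemma meas_fst a b c d (A : R -> R) : measurable_fun (`]a, b[%classic : set mR) A ->
  measurable_fun (rect a b c d) (fun z => A z.1).
Proof.
move=> mA; refine (@measurable_comp _ _ _ mplane mR _ `]a, b[%classic A _ fst _ _ _ _) => //.
- by move=> _ [z [h _] <-].
- by apply: measurable_funTS; exact: measurable_fst.
Qed.

Lemma meas_snd a b c d (A : R -> R) : measurable_fun (`]c, d[%classic : set mR) A ->
  measurable_fun (rect a b c d) (fun z => A z.2).
Proof.
move=> mA; refine (@measurable_comp _ _ _ mplane mR _ `]c, d[%classic A _ snd _ _ _ _) => //.
- by move=> _ [z [_ h] <-].
- by apply: measurable_funTS; exact: measurable_snd.
Qed.

Lemma L2_sec a b c d g : L2 area (rect a b c d) g ->
  {ae mu, forall y, `]c, d[%classic y -> L2 mu `]a, b[%classic (fun x => g (x, y)) /\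
    (\int[mu]_(x in `]a, b[) `|g (x, y)|) ^+ 2 <=
      fine (mu `]a, b[%classic) * \int[mu]_(x in `]a, b[) (g (x, y) ^+ 2)}.
Proof.
move=> [mg gi]; have [ae1 _ _] := fubini_rect gi.
apply: filterS ae1 => y h ly.
have l2 : L2 mu `]a, b[%classic (fun x => g (x, y)).
  by split; [exact: (meas_sec mg ly)|exact: h].
by split => //; apply: Rint_abs_sqr_le => //; exact: itvoo_fin.
Qed.

Lemma sacx_sqr_le a b c d f g : a < b -> L2 area (rect a b c d) g ->
  sacx a b c d f g ->
  {ae mu, forall y, `]c, d[%classic y -> {ae mu, forall x, `]a, b[%classic x ->
    f (x, y) ^+ 2 <= 2 * ((b - a)^-1 * \int[mu]_(x in `]a, b[) f (x, y)) ^+ 2 +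
      2 * ((b - a) * \int[mu]_(x in `]a, b[) (g (x, y) ^+ 2))}}.
Proof.
move=> ab lg S; apply: filterS2 (L2_sec lg) S => y h1 h2 ly.
have [l2 cs] := h1 ly; apply: filterS (ac1_sup_le ab (h2 ly)) => x h3 lx.
have {h3} := h3 lx; move: cs; rewrite (itvoo_fine (ltW ab)).
have I0 : 0 <= \int[mu]_(t in `]a, b[) `|g (t, y)| by apply: Rintegral_ge0.
have -> : ((b - a)^-1 * \int[mu]_(x in `]a, b[) f (x, y)) ^+ 2 =
  ((b - a)^-1 * `|\int[mu]_(x in `]a, b[) f (x, y)|) ^+ 2 by rewrite !exprMn real_normK ?num_real.
have m0 : 0 <= (b - a)^-1 * `|\int[mu]_(x in `]a, b[) f (x, y)|.
  by rewrite mulr_ge0// invr_ge0 subr_ge0 ltW.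
move: I0 m0; move: (\int[mu]_(t in `]a, b[) `|g (t, y)|) => I; move: (_^-1 * _) => p.
move: ((b - a) * _) => J I0 p0 IJ H.
rewrite -(real_normK (num_real (f (x, y)))).
have := normr_ge0 (f (x, y)); move: H; move: `|f (x, y)| => q H q0.
have : q ^+ 2 <= (p + I) ^+ 2 by rewrite ler_sqr ?nnegrE ?addr_ge0.
have := sqr_ge0 (p - I); nra.
Qed.

(** A Poincare inequality obtained by integrating [sacx_sqr_le]. The bound [m] on the line integrals
    is left open: it is 0 for [U 1 0], and for [U 0 1] it comes from a box integral. *)
Lemma sacx_poincare a b c d f g m : a < b -> c < d -> L2 area (rect a b c d) f ->
  L2 area (rect a b c d) g -> sacx a b c d f g ->
  {ae mu, forall y, `]c, d[%classic y -> `|\int[mu]_(x in `]a, b[) f (x, y)| <= m} ->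
  n2 area (rect a b c d) f <=
  2 * ((b - a)^-1 * (d - c)) * m ^+ 2 + 2 * (b - a) ^+ 2 * n2 area (rect a b c d) g.
Proof.
move=> ab cd lf lg S fm; have [_ i1 E1] := fubini_rect lf.2.
have [_ i2 E2] := fubini_rect lg.2.
have ba : 0 < b - a by rewrite subr_gt0.
rewrite /n2 E1 E2 -/(n2 _ _ _).
pose A := 2 * (b - a)^-1 * m ^+ 2.
have ci : intg mu `]c, d[%classic (cst A : R -> R).
  by apply: (@intg_bounded _ _ _ _ _ _ _ `|A|) => //; exact: itvoo_fin.
have zi : intg mu `]c, d[%classic (fun y => 2 * (b - a) ^+ 2 * \int[mu]_(x in `]a, b[) g (x, y) ^+ 2).
  exact: intgZ.
have -> : 2 * ((b - a)^-1 * (d - c)) * m ^+ 2 + 2 * (b - a) ^+ 2 *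
    (\int[mu]_(y in `]c, d[) \int[mu]_(x in `]a, b[) g (x, y) ^+ 2) =
  \int[mu]_(y in `]c, d[) (A + 2 * (b - a) ^+ 2 * \int[mu]_(x in `]a, b[) g (x, y) ^+ 2).
  rewrite RintegralD// Rintegral_cst// (itvoo_fine (ltW cd)) RintegralZl//.
  by congr (_ + _); rewrite /A; ring.
apply: (@Rint_le_ae _ mR R mu) => //; first exact: intgD.
apply: filterS3 (sacx_sqr_le ab lg S) (L2_sec lf) fm => y h1 h2 h3 ly.
have {}h1 := h1 ly; have [[mfy fyi] _] := h2 ly; have {}h3 := h3 ly.
set J := \int[mu]_(x in `]a, b[) g (x, y) ^+ 2 in h1 *.
set I := \int[mu]_(x in `]a, b[) f (x, y) in h1 h3.
pose B := 2 * ((b - a)^-1 * I) ^+ 2 + 2 * ((b - a) * J).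
have Bi : intg mu `]a, b[%classic (cst B : R -> R).
  by apply: (@intg_bounded _ _ _ _ _ _ _ `|B|) => //; exact: itvoo_fin.
apply: (@le_trans _ _ (\int[mu]_(x in `]a, b[) cst B x)).
  exact: (@Rint_le_ae _ mR R mu).
rewrite Rintegral_cst// (itvoo_fine (ltW ab)) /B /A exprMn.
have Im : I ^+ 2 <= m ^+ 2.
  rewrite -(real_normK (num_real I)) ler_sqr ?nnegrE//.
  exact: le_trans (normr_ge0 I) h3.
have -> : (2 * ((b - a)^-1 ^+ 2 * I ^+ 2) + 2 * ((b - a) * J)) * (b - a) =
  2 * (b - a)^-1 * I ^+ 2 * ((b - a)^-1 * (b - a)) + 2 * (b - a) ^+ 2 * J by ring.
rewrite mulVf ?gt_eqF// mulr1 lerD2r ler_wpM2l// mulr_ge0// invr_ge0 ltW//.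
Qed.

Lemma intg_tensor a b c d (A B : R -> R) : intg mu `]a, b[%classic A ->
  intg mu `]c, d[%classic B -> (forall x, 0 <= A x) -> (forall y, 0 <= B y) ->
  intg area (rect a b c d) (fun z => A z.1 * B z.2) /\
  \int[area]_(z in rect a b c d) (A z.1 * B z.2) =
  \int[mu]_(x in `]a, b[) A x * \int[mu]_(y in `]c, d[) B y.
Proof.
move=> Ai Bi A0 B0.
have mz : measurable_fun (rect a b c d) (fun z => A z.1 * B z.2).
  by apply: (@measurable_funM _ mplane); [apply: meas_fst; exact: intg_meas Ai|apply: meas_snd; exact: intg_meas Bi].
have inner y : \int[mu]_(x in `]a, b[) (A x * B y) = (\int[mu]_(x in `]a, b[) A x) * B y.
  by rewrite RintegralZr.
have ti : intg area (rect a b c d) (fun z => A z.1 * B z.2).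
  apply: (@intg_rect_of _ _ _ _ _ _ (fun y => (\int[mu]_(x in `]a, b[) A x) * B y)) => //.
    exact: intgZ.
  apply: aeW => y ly; split.
    have : intg mu `]a, b[%classic (fun x => B y * A x) by exact: intgZ.
    by congr (intg _ _ _); apply/funext => x; rewrite mulrC.
  rewrite -inner le_eqVlt; apply/orP; left; apply/eqP; apply: eq_Rintegral => x _.
  by rewrite ger0_norm// mulr_ge0.
split=> //; have [_ _ ->] := fubini_rect ti.
by under eq_Rintegral do rewrite inner; rewrite RintegralZl.
Qed.

(** The one-dimensional embedding on each line: the square is dominated by a function of [y] alone
    that is still integrable, which is the ingredient of [ladyzhenskaya]. *)
Lemma sacx_sup_sqr a b c d f g : a < b -> L2 area (rect a b c d) f ->
  L2 area (rect a b c d) g -> sacx a b c d f g ->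
  let K := 2 * (b - a)^-1 + 2 * (b - a) in
  let A y := K * \int[mu]_(x in `]a, b[) (f (x, y) ^+ 2 + g (x, y) ^+ 2) in
  [/\ forall y, 0 <= A y, intg mu `]c, d[%classic A,
   \int[mu]_(y in `]c, d[) A y = K * (n2 area (rect a b c d) f + n2 area (rect a b c d) g) &
   {ae area, forall z, rect a b c d z -> f z ^+ 2 <= A z.2}].
Proof.
move=> ab lf lg S K A.
have ba : 0 < b - a by rewrite subr_gt0.
have ba' : 0 < (b - a)^-1 by rewrite invr_gt0.
have K0 : 0 <= K by rewrite /K addr_ge0// mulr_ge0// ltW.
have si := intgD (measurable_rect a b c d) lf.2 lg.2.
have [ae1 i1 E1] := fubini_rect si.
have Ai : intg mu `]c, d[%classic A by exact: intgZ.
have A0 y : 0 <= A y.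
  by rewrite /A mulr_ge0//; apply: Rintegral_ge0 => x _; rewrite addr_ge0 ?sqr_ge0.
split => //.
  by rewrite /A RintegralZl// -E1 RintegralD//; [exact: lf.2|exact: lg.2].
have mA : measurable_fun (rect a b c d) (fun z => A z.2) by apply: meas_snd; exact: intg_meas Ai.
have mf2 : measurable_fun (rect a b c d) (fun z => f z ^+ 2) by apply: measurable_funX; exact: lf.1.
(* Taking the positive part turns the inequality into an equation, to which [ae_rect0] applies. *)
have : {ae area, forall z, rect a b c d z -> Num.max (f z ^+ 2 - A z.2) 0 = 0}.
  apply: ae_rect0.
    by apply: measurable_maxr => //; exact: measurable_funB.
  apply: filterS3 (L2_sec lf) (L2_sec lg) (sacx_sqr_le ab lg S) => y h1 h2 h3 ly.
  have [l1 c1] := h1 ly; have [l2 c2] := h2 ly; apply: filterS (h3 ly) => x h xl.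
  apply/eqP; rewrite eq_le le_max lexx orbT andbT ge_max lexx andbT subr_le0.
  apply: (le_trans (h xl)); rewrite /A /=.
  rewrite RintegralD//; [|exact: l1.2|exact: l2.2].
  move: c1; rewrite (itvoo_fine (ltW ab)).
  have : `|\int[mu]_(x0 in `]a, b[) f (x0, y)| <= \int[mu]_(x0 in `]a, b[) `|f (x0, y)|.
    apply: le_normr_Rintegral => //; apply: (@L2_intg _ mR R mu) => //; exact: itvoo_fin.
  have : 0 <= \int[mu]_(x0 in `]a, b[) (g (x0, y) ^+ 2) by exact: n2_ge0.
  have : 0 <= \int[mu]_(x0 in `]a, b[) (f (x0, y) ^+ 2) by exact: n2_ge0.
  move: (\int[mu]_(x in `]a, b[) f (x, y) ^+ 2) (\int[mu]_(x in `]a, b[) g (x, y) ^+ 2).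
  move: (\int[mu]_(x in `]a, b[) f (x, y)) (\int[mu]_(x in `]a, b[) `|f (x, y)|) => I J p q p0 q0 IJ Jp.
  have I2 : I ^+ 2 <= (b - a) * p.
    rewrite -(real_normK (num_real I)); apply: le_trans Jp.
    by rewrite ler_sqr ?nnegrE//; exact: le_trans (normr_ge0 I) IJ.
  have I3 : (b - a)^-1 ^+ 2 * I ^+ 2 <= (b - a)^-1 * p.
    rewrite expr2 -mulrA ler_pM2l//; apply: le_trans (_ : (b - a)^-1 * ((b - a) * p) <= _).
      by rewrite ler_pM2l.
    by rewrite mulrA mulVf ?mul1r// gt_eqF.
  rewrite /K exprMn.
  have := mulr_ge0 (ltW ba) p0; have := mulr_ge0 (ltW ba') q0; nra.
by apply: filterS => z h /h /eqP; rewrite eq_le ge_max subr_le0 => /andP[/andP[]].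
Qed.

(* Each factor is bounded on almost every line, in one direction for [f1] and
   in the other one for [f2]. *)
Lemma ladyzhenskaya a b c d f1 g1 f2 g2 : a < b -> c < d ->
  L2 area (rect a b c d) f1 -> L2 area (rect a b c d) g1 ->
  L2 area (rect a b c d) f2 -> L2 area (rect a b c d) g2 ->
  sacx a b c d f1 g1 -> sacx c d a b (f2 \o swp) (g2 \o swp) ->
  L2 area (rect a b c d) (fun z => f1 z * f2 z) /\
  n2 area (rect a b c d) (fun z => f1 z * f2 z) <=
  ((2 * (b - a)^-1 + 2 * (b - a)) * (n2 area (rect a b c d) f1 + n2 area (rect a b c d) g1)) *
  ((2 * (d - c)^-1 + 2 * (d - c)) * (n2 area (rect a b c d) f2 + n2 area (rect a b c d) g2)).
Proof.
move=> ab cd l1 k1 l2 k2 S1 S2.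
have [l2' e2] := L2_swp l2; have [k2' e2'] := L2_swp k2.
have [A0 Ai AE Ale] := sacx_sup_sqr ab l1 k1 S1.
have [B0 Bi BE Ble] := sacx_sup_sqr cd l2' k2' S2.
set A := (fun y => _ * _) in A0 Ai AE Ale.
set B := (fun y => _ * _) in B0 Bi BE Ble.
have [ti tE] := intg_tensor Bi Ai B0 A0.
have Ble' := ae_rect_swp Ble.
have m12 : measurable_fun (rect a b c d) (fun z => f1 z * f2 z).
  by apply: (@measurable_funM _ mplane); [exact: l1.1|exact: l2.1].
have le12 : {ae area, forall z, rect a b c d z -> (f1 z * f2 z) ^+ 2 <= B z.1 * A z.2}.
  apply: filterS2 Ale Ble' => -[x y] h1 h2 rz; rewrite exprMn mulrC.
  by apply: ler_pM; rewrite ?sqr_ge0//; [exact: h2|exact: h1].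
have i12 : intg area (rect a b c d) (fun z => (f1 z * f2 z) ^+ 2).
  apply: (@intg_le_ae _ mplane area _ _ (fun z => B z.1 * A z.2)) => //.
    exact: measurable_funX.
  by apply: filterS le12 => z h /h; rewrite ger0_norm ?sqr_ge0.
split=> //.
rewrite -AE -e2 -e2' -BE [leRHS]mulrC -tE.
exact: (@Rint_le_ae _ mplane R area).
Qed.

End estimates.

(** * Control of all derivatives by those of second order, under the boundary condition *)

Section energy.
Context {R : realType}.
Local Notation mu := (@lebesgue_measure R).
Local Notation mR := (measurableTypeR R).
Local Notation mplane := (mR * mR)%type.
Local Notation area := (@area R).
Local Notation pi := (@pi R).
Variables (l : R) (l_gt0 : 0 < l).
Implicit Types (u v w f g : R * R -> R) (U V : nat -> nat -> R * R -> R).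

Let nl : - l < l := Nl_lt l_gt0.
Let nle := ltW nl.
Let p0 := pi_gt0 R.
Let p0' := pi_ge0 R.
Local Notation nm f := (n2 area (Omega l) f).

Lemma n2B_le f g : L2 area (Omega l) f -> L2 area (Omega l) g ->
  nm (fun z => f z - g z) <= 2 * nm f + 2 * nm g.
Proof.
move=> lf lg; have lg' : L2 area (Omega l) (fun z => (-1) * g z) by exact: L2Z.
have -> : nm (fun z => f z - g z) = nm (fun z => f z + (-1) * g z).
  by apply: eq_Rintegral => z _; rewrite mulN1r.
by apply: (le_trans (n2D_le _ lf lg')) => //; rewrite (n2Z (measurable_Omega l) _ lg) sqrrN expr1n mul1r.
Qed.

Lemma L2_cst (M : R) : L2 area (Omega l) (cst M).
Proof.
split; first exact: measurable_cst.
apply: (@intg_bounded _ _ _ area _ (measurable_Omega l) (fun=> M ^+ 2) (M ^+ 2)).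
- exact: Omega_fin.
- exact: measurable_cst.
- by move=> z _; rewrite ger0_norm// sqr_ge0.
Qed.

Definition N2 U := nm (U 2%N 0%N) + nm (U 1%N 1%N) + nm (U 0%N 2%N).

(** [A] is the area of the rectangle. The factors of [N2] are [c10] for [U 1 0], [cc] for [corr],
    [cs] for the square of the supremum of [cversion], whence [cs * A] for [U 0 0], and [c01] for
    [U 0 1]. *)
Let A : R := pi * (2 * l).
Let c10 : R := 2 * pi ^+ 2.
Let cc : R := ((2 * l)^-1) ^+ 2 * (2 * c10 + 2 * (2 * l) ^+ 2).
Let cs : R := 2 * A * (cc + 1).
Let c01 : R := 2 * ((2 * l)^-1 * pi) * A + 2 * (2 * l) ^+ 2.
Definition Khinged : R := 1 + c10 + cs + cs * A + c01.

Let A0 : 0 <= A. Proof. by rewrite mulr_ge0// mulr_ge0// ltW. Qed.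
Let c100 : 0 <= c10. Proof. by rewrite mulr_ge0// sqr_ge0. Qed.
Let cc0 : 0 <= cc.
Proof. by rewrite mulr_ge0 ?sqr_ge0// addr_ge0// mulr_ge0// sqr_ge0. Qed.
Let cs0 : 0 <= cs. Proof. by rewrite mulr_ge0 ?addr_ge0// mulr_ge0. Qed.
Let c010 : 0 <= c01.
Proof.
rewrite addr_ge0// mulr_ge0 ?sqr_ge0// mulr_ge0// mulr_ge0// invr_ge0.
by rewrite mulr_ge0// ltW.
Qed.

Lemma N2_ge0 U : 0 <= N2 U.
Proof. by rewrite !addr_ge0// n2_ge0. Qed.

Lemma N2_le U : [/\ nm (U 2%N 0%N) <= N2 U, nm (U 1%N 1%N) <= N2 U & nm (U 0%N 2%N) <= N2 U].
Proof.
have := n2_ge0 area (Omega l) (U 2%N 0%N); have := n2_ge0 area (Omega l) (U 1%N 1%N).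
by have := n2_ge0 area (Omega l) (U 0%N 2%N); rewrite /N2; split; lra.
Qed.

Lemma sqrt_box_le f x y : L2 area (Omega l) f -> 0 <= x <= pi -> - l <= y <= l ->
  `|box 0 (- l) f x y| <= Num.sqrt (A * nm f).
Proof.
move=> lf /andP[x0 xp] /andP[yl ly].
apply: (le_trans (sqr_rect_le lf _ _ _ _ _ _)) => //.
apply/ler_wsqrtr/ler_pM => //; first by rewrite mulr_ge0// subr_ge0.
  exact: n2_ge0.
by apply: ler_pM; rewrite ?subr_ge0//; lra.
Qed.

(** [U 1 0] has mean zero on almost every horizontal line, so the Poincare inequality in [x] holds
    with [m = 0]. *)
Lemma hinged_U10 U : jet l U -> hinged l U -> nm (U 1%N 0%N) <= c10 * N2 U.
Proof.
move=> [LU sX sY] Z; have [h1 _ _] := N2_le U.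
have := @sacx_poincare _ 0 pi (- l) l (U 1%N 0%N) (U 2%N 0%N) 0 p0 nl
  (LU 1%N 0%N isT) (LU 2%N 0%N isT) (sX 1%N 0%N isT).
rewrite expr0n/= mulr0 add0r subr0 => H.
apply: le_trans (_ : c10 * nm (U 2%N 0%N) <= _); last by rewrite ler_wpM2l.
by apply: H; apply: filterS Z => y h /h [-> _]; rewrite normr0.
Qed.

Lemma hinged_corr U : jet l U -> hinged l U -> nm (corr l U) <= cc * N2 U.
Proof.
move=> jU Z; have [LU sX sY] := jU; have [_ h1 _] := N2_le U.
have lq := L2_snd (LU 1%N 1%N isT); have lg := LU 1%N 0%N isT.
have lB : L2 area (Omega l) (fun z => U 1%N 0%N z - (l - z.2) * U 1%N 1%N z) by exact: L2B.
have e : nm (corr l U) = ((2 * l)^-1) ^+ 2 * nm (fun z => U 1%N 0%N z - (l - z.2) * U 1%N 1%N z).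
  exact: n2Z.
rewrite e /cc -[leRHS]mulrA; apply: ler_wpM2l; first exact: sqr_ge0.
apply: (le_trans (n2B_le lg lq)); have := hinged_U10 jU Z.
have : nm (fun z => (l - z.2) * U 1%N 1%N z) <= (2 * l) ^+ 2 * nm (U 1%N 1%N).
  have lw : L2 area (Omega l) (fun z => 2 * l * `|U 1%N 1%N z|).
    by apply: L2Z => //; apply: L2_abs => //; exact: LU.
  have -> : (2 * l) ^+ 2 * nm (U 1%N 1%N) = nm (fun z => 2 * l * `|U 1%N 1%N z|).
    by rewrite n2Z ?n2_abs//; apply: L2_abs => //; exact: LU.
  apply: (@n2_le _ mplane R area) => //; first exact: lq.1.
  apply: aeW => z [_ /=]; rewrite in_itv/= => /andP[h3 h4].
  by rewrite normrM ler_wpM2r// ger0_norm; lra.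
have := mulr_ge0 (sqr_ge0 (2 * l)) (N2_ge0 U).
have : (2 * l) ^+ 2 * nm (U 1%N 1%N) <= (2 * l) ^+ 2 * N2 U by rewrite ler_wpM2l ?sqr_ge0.
move=> *; have -> : (2 * c10 + 2 * (2 * l) ^+ 2) * N2 U = 2 * (c10 * N2 U) + 2 * ((2 * l) ^+ 2 * N2 U) by ring.
by lra.
Qed.

Lemma hinged_sup U z : jet l U -> hinged l U -> crect 0 pi (- l) l z ->
  cversion l U z ^+ 2 <= cs * N2 U.
Proof.
case: z => x y jU Z [/=]; rewrite !in_itv/= => xp yl; have [LU _ _] := jU.
have [_ h1 _] := N2_le U; have h2 := hinged_corr jU Z.
have e1 := sqrt_box_le (y := l) (L2_corr jU) xp.
have e2 := sqrt_box_le (LU 1%N 1%N isT) xp yl.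
have ll : - l <= l <= l by rewrite lexx nle.
have {}e1 := e1 ll; rewrite /cversion /=.
move: e1 e2; have := sqr_sqrtr (mulr_ge0 A0 (n2_ge0 area (Omega l) (corr l U))).
have := sqr_sqrtr (mulr_ge0 A0 (n2_ge0 area (Omega l) (U 1%N 1%N))).
have := sqrtr_ge0 (A * nm (corr l U)); have := sqrtr_ge0 (A * nm (U 1%N 1%N)).
move: (Num.sqrt _) (Num.sqrt _) => s t s0 t0 sE tE.
move: (box _ _ _ _ _) (box _ _ _ _ _) => q p.
rewrite !ler_norml => /andP[p1 p2] /andP[q1 q2].
have ps : p ^+ 2 <= A * nm (corr l U) by rewrite -tE; nra.
have qs : q ^+ 2 <= A * nm (U 1%N 1%N) by rewrite -sE; nra.
have := ler_wpM2l A0 h2; have := ler_wpM2l A0 h1; have := sqr_ge0 (p - q).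
by rewrite /cs => *; nra.
Qed.

Lemma hinged_U00 U : jet l U -> hinged l U -> nm (U 0%N 0%N) <= cs * A * N2 U.
Proof.
move=> jU Z; have [LU _ _] := jU; pose M : R := Num.sqrt (cs * N2 U).
have M0 : 0 <= cs * N2 U by rewrite mulr_ge0// N2_ge0.
have lM := L2_cst M.
apply: le_trans (_ : nm (cst M) <= _).
  apply: (@n2_le _ mplane R area) => //; first exact: (LU 0%N 0%N isT).1.
  apply: filterS (hinged_cversion l_gt0 jU Z) => z h Oz; rewrite h//.
  rewrite -sqrtr_sqr ler_sqrt//; apply: hinged_sup => //.
  by case: Oz => h1 h2; split; exact: subset_itv_oo_cc.
rewrite /n2 /= Rintegral_cst//; last exact: measurable_Omega.
rewrite (@area_rect_fine _ 0 pi (- l) l)// sqr_sqrtr// subr0 opprK.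
by rewrite /A mulrAC (_ : l + l = 2 * l) //; ring.
Qed.

(** On a vertical line the integral of [U 0 1] is the difference of [cversion] at the two ends, that
    is, a box integral of [U 1 1], bounded by Cauchy-Schwarz. This is the [m] of the Poincare
    inequality in [y]. *)
Lemma hinged_U01 U : jet l U -> hinged l U -> nm (U 0%N 1%N) <= c01 * N2 U.
Proof.
move=> jU Z; have [LU sX sY] := jU; have [_ h1 h2] := N2_le U.
pose m : R := Num.sqrt (A * nm (U 1%N 1%N)).
have [l1 e1] := L2_swp (LU 0%N 1%N isT); have [l2 e2] := L2_swp (LU 0%N 2%N isT).
have M : {ae mu, forall y, `]0, pi[%classic y ->
    `|\int[mu]_(x in `]- l, l[) (U 0%N 1%N \o swp) (x, y)| <= m}.
  have E := ae_sec (ae_rect_swp (hinged_cversion l_gt0 jU Z)).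
  apply: filterS2 E (sY 0%N 0%N isT) => x h3 h4 xp.
  have {}h3 := h3 xp; have [_ Gi [k Fk]] := h4 xp.
  have xp' := subset_itv_oo_cc xp.
  have W y : `[- l, l]%classic y -> cversion l U (x, y) = k + prim (- l) (fun y => U 0%N 1%N (x, y)) y.
    apply: (@ae_within_eq _ (- l) l (fun y => cversion l U (x, y))
       (fun y => k + prim (- l) (fun y => U 0%N 1%N (x, y)) y)) => //.
    - exact: (within_section xp' (within_swp (cversion_continuous l_gt0 jU))).
    - apply: withinD; first by move=> t; exact: cst_continuous.
      exact: (prim_continuous nle Gi).
    - by apply: filterS2 h3 Fk => t a1 a2 tl; exact: etrans (esym (a1 tl)) (a2 tl).
  have ll : `[- l, l]%classic l by rewrite /= in_itv/= lexx nle.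
  have ll' : `[- l, l]%classic (- l) by rewrite /= in_itv/= lexx nle.
  have : box 0 (- l) (U 1%N 1%N) x l = prim (- l) (fun y => U 0%N 1%N (x, y)) l.
    have := W _ ll; have := W _ ll'; rewrite /cversion /= box_bottom /prim set_itvoo0// Rintegral_set0.
    by rewrite !addr0 => ->; move=> /addrI.
  rewrite /prim /= => <-; apply: sqrt_box_le; first exact: LU.
    by move: xp'; rewrite /= in_itv.
  by rewrite lexx nle.
have := sacx_poincare nl p0 l1 l2 (sY 0%N 1%N isT) M.
have m0 : 0 <= A * nm (U 1%N 1%N) by rewrite mulr_ge0// n2_ge0.
rewrite e1 e2 /m (sqr_sqrtr m0) subr0 opprK.
have -> : l + l = 2 * l by ring.
move=> H; apply: (le_trans H); rewrite /c01 [leRHS]mulrDl; apply: lerD.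
  rewrite -[leRHS]mulrA; apply: ler_wpM2l; last by rewrite ler_wpM2l.
  by rewrite !mulr_ge0// invr_ge0 mulr_ge0// ltW.
by rewrite ler_wpM2l// mulr_ge0// sqr_ge0.
Qed.

Lemma Khinged_ge0 : 0 <= Khinged.
Proof. have := mulr_ge0 cs0 A0; have := c010; have := c100; have := cs0; rewrite /Khinged.
by move=> *; lra. Qed.

Lemma KhingedM x : Khinged * x = x + c10 * x + cs * x + cs * A * x + c01 * x.
Proof. by rewrite /Khinged; ring. Qed.

Lemma hinged_bound U i j : jet l U -> hinged l U -> (i + j <= 2)%N -> nm (U i j) <= Khinged * N2 U.
Proof.
move=> jU Z ij; have [h1 h2 h3] := N2_le U; have N0 := N2_ge0 U.
have h4 := hinged_U10 jU Z; have h5 := hinged_U01 jU Z; have h6 := hinged_U00 jU Z.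
have q1 := mulr_ge0 c100 N0; have q2 := mulr_ge0 c010 N0; have q3 := mulr_ge0 cs0 N0.
have q4 := mulr_ge0 (mulr_ge0 cs0 A0) N0.
rewrite KhingedM.
by move: i j ij => [|[|[|i]]] [|[|[|j]]] // _; lra.
Qed.

Lemma hinged_sup_bound U z : jet l U -> hinged l U -> crect 0 pi (- l) l z ->
  cversion l U z ^+ 2 <= Khinged * N2 U.
Proof.
move=> jU Z hz; have N0 := N2_ge0 U; have h := hinged_sup jU Z hz.
have q1 := mulr_ge0 c100 N0; have q2 := mulr_ge0 c010 N0; have q3 := mulr_ge0 cs0 N0.
have q4 := mulr_ge0 (mulr_ge0 cs0 A0) N0.
by rewrite KhingedM; lra.
Qed.

End energy.

(** * The Hilbert space H2star *)

Lemma le_geometric0 (R : realType) (x M : R) :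
  (forall n, `|x| <= M * 2^-1 ^+ n) -> x = 0.
Proof.
move=> H; apply/normr0_eq0/eqP; rewrite eq_le normr_ge0 andbT.
have c : (fun n => M * 2^-1 ^+ n) @ \oo --> (0 : R).
  rewrite -[X in _ --> X](mulr0 M); apply: cvgM; first exact: cvg_cst.
  by apply: cvg_expr; rewrite ger0_norm ?invr_ge0// invf_lt1// ltr1n.
rewrite -(cvg_lim _ c)//; apply: limr_ge; first by apply/cvg_ex; exists 0.
by apply: nearW => n; exact: H.
Qed.

Section hilbert.
Context {R : realType}.
Local Notation mu := (@lebesgue_measure R).
Local Notation mR := (measurableTypeR R).
Local Notation mplane := (mR * mR)%type.
Local Notation area := (@area R).
Local Notation pi := (@pi R).
Variables (l sigma : R) (l_gt0 : 0 < l) (sigmaP : 0 < sigma < 1 / 2).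
Implicit Types (u v w f g : R * R -> R) (U V : nat -> nat -> R * R -> R) (i j n m : nat).

Let nl : - l < l := Nl_lt l_gt0.
Local Notation nm f := (n2 area (Omega l) f).
Local Notation wjet := (wjet l).
Local Notation prod := (H2star_prod l sigma).
Local Notation H2s := (H2star l).

Lemma L2_wjet u i j : H2 l u -> (i + j <= 2)%N -> L2 area (Omega l) (wjet u i j).
Proof. by move=> Hu; have [LU _ _] := H2_jet l_gt0 Hu; exact: LU. Qed.

Lemma djetD (a : R) u v i j : H2 l u -> H2 l v -> (i + j <= 2)%N ->
  {ae area, forall z, Omega l z ->
    wjet (fun z => a * u z + v z) i j z = a * wjet u i j z + wjet v i j z}.
Proof.
move=> Hu Hv ij; rewrite /wjet; case: ifP => _; first by apply: aeW.
exact: wDD.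
Qed.

Lemma Omega_sec (P : R * R -> Prop) : {ae area, forall z, Omega l z -> P z} ->
  {ae mu, forall y, `]- l, l[%classic y ->
    {ae mu, forall x, `]0, pi[%classic x -> P (x, y)}}.
Proof. exact: ae_sec. Qed.

(** The boundary condition speaks of continuous versions; read through primitives on lines it is
    visibly linear. *)
Lemma H2starD (a : R) u v : H2s u -> H2s v -> H2s (fun z => a * u z + v z).
Proof.
move=> Hu Hv; have H2w := H2D a Hu.1 Hv.1; set w := fun z => _ in H2w *.
have jw := H2_jet l_gt0 H2w; apply: (hinged_H2star l_gt0 jw).
have [Lu sXu _] := H2_jet l_gt0 Hu.1; have [Lv sXv _] := H2_jet l_gt0 Hv.1.
have [Lw sXw _] := jw.
have Zu := hinged_prim (sXu 0%N 0%N isT) (H2star_hinged l_gt0 Hu).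
have Zv := hinged_prim (sXv 0%N 0%N isT) (H2star_hinged l_gt0 Hv).
have E := Omega_sec (djetD a (i := 1) (j := 0) Hu.1 Hv.1 isT).
apply: prim_hinged; first exact: sXw.
apply: filterS3 (filterI Zu Zv) E (sXw 0%N 0%N isT) => y [h1 h2] h3 hw ly.
have [iu zu eu] := h1 ly; have [iv zv ev] := h2 ly; have {}h3 := h3 ly.
have [_ iw _] := hw ly.
have P x : x <= pi -> prim 0 (fun x => wjet w 1 0 (x, y)) x =
    a * prim 0 (fun x => wjet u 1 0 (x, y)) x + prim 0 (fun x => wjet v 1 0 (x, y)) x.
  move=> xp; have s (g : R -> R) : intg mu `]0, pi[%classic g -> intg mu `]0, x[%classic g.
    by move=> gi; exact: (intg_sub gi).
  rewrite /prim -RintegralZl//; last exact: s.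
  rewrite -RintegralD//; [|by apply: intgZ => //; exact: s|exact: s].
  apply: (@Rint_ae _ mR R mu) => //.
  - exact: intg_meas (s _ iw).
  - by apply: intg_meas; apply: intgD => //; [apply: intgZ => //|]; exact: s.
  apply: filterS h3 => t h; rewrite /= in_itv/= => /andP[t0 tx].
  by rewrite h//= in_itv/= t0 (lt_le_trans tx xp).
split; first by rewrite P// zu zv mulr0 addr0.
apply: filterS2 eu ev => x hu hv xp; rewrite P; last first.
  by move: xp; rewrite /= in_itv/= => /andP[_ /ltW].
by rewrite -hu// -hv.
Qed.

Definition density U V (z : R * R) : R :=
  (U 2%N 0%N z + U 0%N 2%N z) * (V 2%N 0%N z + V 0%N 2%N z) +
  (1 - sigma) * (2 * U 1%N 1%N z * V 1%N 1%N z
                 - U 2%N 0%N z * V 0%N 2%N z - U 0%N 2%N z * V 2%N 0%N z).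

Lemma prodE u v : prod u v = \int[area]_(z in Omega l) density (wjet u) (wjet v) z.
Proof. by []. Qed.

Lemma density_intg U V :
  (forall i j, (i + j <= 2)%N -> L2 area (Omega l) (U i j)) ->
  (forall i j, (i + j <= 2)%N -> L2 area (Omega l) (V i j)) ->
  intg area (Omega l) (density U V).
Proof.
move=> LU LV; have mO := measurable_Omega l.
have H i j i' j' : (i + j <= 2)%N -> (i' + j' <= 2)%N ->
    intg area (Omega l) (fun z => U i j z * V i' j' z).
  by move=> h h'; apply: L2M => //; [exact: LU|exact: LV].
have -> : density U V = fun z =>
   (U 2%N 0%N z * V 2%N 0%N z + U 0%N 2%N z * V 0%N 2%N z) +
   (sigma * (U 2%N 0%N z * V 0%N 2%N z + U 0%N 2%N z * V 2%N 0%N z) +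
    (2 * (1 - sigma)) * (U 1%N 1%N z * V 1%N 1%N z)).
  by apply/funext => z; rewrite /density; ring.
apply: intgD => //; first by apply: intgD => //; exact: H.
by apply: intgD => //; apply: intgZ => //; [apply: intgD => //|]; exact: H.
Qed.

Lemma prodD (a : R) u v w : H2s u -> H2s v -> H2s w ->
  prod (fun z => a * u z + v z) w = a * prod u w + prod v w.
Proof.
move=> Hu Hv Hw; have H2uv := H2D a Hu.1 Hv.1; rewrite !prodE.
have mO := measurable_Omega l.
have L u' : H2 l u' -> forall i j, (i + j <= 2)%N -> L2 area (Omega l) (wjet u' i j).
  by move=> h i j; exact: L2_wjet.
have iu := density_intg (L _ Hu.1) (L _ Hw.1).
have iv := density_intg (L _ Hv.1) (L _ Hw.1).
have iuv := density_intg (L _ H2uv) (L _ Hw.1).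
have izu := intgZ mO a iu.
rewrite -RintegralZl// -RintegralD//.
apply: (@Rint_ae _ mplane R area) => //.
- exact: intg_meas iuv.
- exact: intg_meas (intgD mO izu iv).
apply: filterS3 (djetD a (i := 2) (j := 0) Hu.1 Hv.1 isT)
  (djetD a (i := 1) (j := 1) Hu.1 Hv.1 isT)
  (djetD a (i := 0) (j := 2) Hu.1 Hv.1 isT) => z h1 h2 h3 Oz.
rewrite /density h1// h2// h3//.
move: (wjet u 2 0 z) (wjet u 1 1 z) (wjet u 0 2 z) (wjet v 2 0 z) (wjet v 1 1 z) (wjet v 0 2 z).
by move: (wjet w 2 0 z) (wjet w 1 1 z) (wjet w 0 2 z) => *; ring.
Qed.

Lemma prodC u v : prod u v = prod v u.
Proof.
rewrite !prodE; apply: eq_Rintegral => z _; rewrite /density.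
move: (wjet u 2 0 z) (wjet u 1 1 z) (wjet u 0 2 z) (wjet v 2 0 z) (wjet v 1 1 z) (wjet v 0 2 z).
by move=> *; ring.
Qed.

(** Coercivity and boundedness hold pointwise in the Hessian entries [a], [c], [b]: the two [ring]
    identities display the differences as sums of squares with coefficients that are nonnegative for
    [0 < sigma < 1]. *)
Lemma N2_density U : (forall i j, (i + j <= 2)%N -> L2 area (Omega l) (U i j)) ->
  (1 - sigma) * N2 l U <= \int[area]_(z in Omega l) density U U z <= 2 * N2 l U.
Proof.
move=> LU; have mO := measurable_Omega l.
have H i j : (i + j <= 2)%N -> intg area (Omega l) (fun z => U i j z ^+ 2).
  by move=> /LU[].
have -> : N2 l U = \int[area]_(z in Omega l) (U 2%N 0%N z ^+ 2 + U 1%N 1%N z ^+ 2 + U 0%N 2%N z ^+ 2).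
  rewrite RintegralD//; [|by apply: intgD => //; exact: H|exact: H].
  by rewrite RintegralD//; exact: H.
have iS : intg area (Omega l) (fun z => U 2%N 0%N z ^+ 2 + U 1%N 1%N z ^+ 2 + U 0%N 2%N z ^+ 2).
  by apply: intgD => //; [apply: intgD => //|]; exact: H.
have iD := density_intg LU LU.
rewrite -!RintegralZl//; apply/andP; split.
  apply: (@Rint_le_ae _ mplane R area) => //; first exact: intgZ.
  apply: aeW => z _; rewrite /density; have := sigmaP => /andP[s0 s1].
  move: (U 2%N 0%N z) (U 1%N 1%N z) (U 0%N 2%N z) => a c b.
  have -> : (a + b) * (a + b) + (1 - sigma) * (2 * c * c - a * b - b * a) =
    (1 - sigma) * (a ^+ 2 + c ^+ 2 + b ^+ 2) + (sigma * (a + b) ^+ 2 + (1 - sigma) * c ^+ 2) by ring.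
  by rewrite lerDl addr_ge0// mulr_ge0 ?sqr_ge0//; lra.
apply: (@Rint_le_ae _ mplane R area) => //; first exact: intgZ.
apply: aeW => z _; rewrite /density; have := sigmaP => /andP[s0 s1].
move: (U 2%N 0%N z) (U 1%N 1%N z) (U 0%N 2%N z) => a c b.
rewrite -subr_ge0.
have -> : 2 * (a ^+ 2 + c ^+ 2 + b ^+ 2) - ((a + b) * (a + b) + (1 - sigma) * (2 * c * c - a * b - b * a)) =
  sigma * ((a - b) ^+ 2 + 2 * c ^+ 2) + (1 - sigma) * (a ^+ 2 + b ^+ 2) by ring.
have s2 : 0 <= 1 - sigma by lra.
have k1 := mulr_ge0 (ltW s0) (sqr_ge0 (a - b)); have k2 := mulr_ge0 (ltW s0) (sqr_ge0 c).
have k3 := mulr_ge0 s2 (sqr_ge0 a); have k4 := mulr_ge0 s2 (sqr_ge0 b).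
by lra.
Qed.

Lemma prod_bounds u : H2s u ->
  (1 - sigma) * N2 l (wjet u) <= prod u u <= 2 * N2 l (wjet u).
Proof. by move=> Hu; apply: N2_density => i j; exact: L2_wjet Hu.1. Qed.

Lemma prod_ge0 u : H2s u -> 0 <= prod u u.
Proof.
move=> Hu; have /andP[h _] := prod_bounds Hu; apply: le_trans h.
by rewrite mulr_ge0 ?N2_ge0//; have := sigmaP => /andP[]; lra.
Qed.

(** As [sigma < 1 / 2], the coercivity constant [1 - sigma] exceeds [1 / 2]. *)
Lemma N2_le_prod u : H2s u -> N2 l (wjet u) <= 2 * prod u u.
Proof.
move=> Hu; have /andP[h _] := prod_bounds Hu; have := N2_ge0 l (wjet u).
have := sigmaP => /andP[s0 s1]; nra.
Qed.

Definition Kenergy : R := 2 * Khinged l.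

Lemma Kenergy_ge0 : 0 <= Kenergy.
Proof. by rewrite /Kenergy mulr_ge0//; exact: Khinged_ge0. Qed.

Lemma wjet_bound u i j : H2s u -> (i + j <= 2)%N -> nm (wjet u i j) <= Kenergy * prod u u.
Proof.
move=> Hu ij; apply: le_trans (hinged_bound l_gt0 (H2_jet l_gt0 Hu.1) (H2star_hinged l_gt0 Hu) ij) _.
apply: (le_trans (ler_wpM2l (Khinged_ge0 l_gt0) (N2_le_prod Hu))).
by rewrite /Kenergy mulrCA mulrA.
Qed.

Lemma test_L2 phi : test_function l phi -> L2 area (Omega l) phi.
Proof.
move=> tp; have mO := measurable_Omega l; have mp := test_meas mO tp.
have [M hM] := test_bounded tp; split => //.
apply: (@intg_bounded _ _ _ _ _ mO _ (M ^+ 2)); first exact: Omega_fin.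
  exact: measurable_funX.
move=> z _; rewrite ger0_norm ?sqr_ge0// -(real_normK (num_real (phi z))).
by rewrite ler_sqr ?nnegrE//; exact: le_trans (hM z).
Qed.

Lemma pairing_limit f phi (fn : nat -> R * R -> R) (C : R) n :
  L2 area (Omega l) f -> (forall n, L2 area (Omega l) (fn n)) ->
  L2 area (Omega l) phi -> 0 <= C ->
  nm (fun z => f z - fn n z) <= (C * 2^-1 ^+ n) ^+ 2 ->
  `|\int[area]_(z in Omega l) (f z * phi z) - \int[area]_(z in Omega l) (fn n z * phi z)| <=
  Num.sqrt (nm phi) * C * 2^-1 ^+ n.
Proof.
move=> lf lfn lphi C0 H; have mO := measurable_Omega l.
have i1 := L2M mO lf lphi; have i2 := L2M mO (lfn n) lphi.
rewrite -RintegralB//.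
have -> : \int[area]_(z in Omega l) (f z * phi z - fn n z * phi z) =
  \int[area]_(z in Omega l) ((f z - fn n z) * phi z).
  by apply: eq_Rintegral => z _; rewrite mulrBl.
have lB : L2 area (Omega l) (fun z => f z - fn n z) by exact: L2B.
have := cauchy_schwarz mO lB lphi; move: (\int[area]_(z in Omega l) _) => x.
move=> hx; rewrite -mulrA mulrC -sqrtr_sqr.
have C20 : 0 <= C * 2^-1 ^+ n by rewrite mulr_ge0.
rewrite -[X in X * _](ger0_norm C20) -sqrtr_sqr -sqrtrM ?sqr_ge0//.
apply: ler_wsqrtr; apply: (le_trans hx).
by rewrite ler_wpM2r ?n2_ge0.
Qed.

(** The L1 norm in [y] of the line integrals of [f] is at most the L1 norm of [f - fn n] over the
    rectangle, which tends to 0. This is why [hinged] is stated with line integrals. *)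
Lemma marginal_limit f (fn : nat -> R * R -> R) (C : R) : 0 <= C ->
  L2 area (Omega l) f -> (forall n, L2 area (Omega l) (fn n)) ->
  (forall n, {ae mu, forall y, `]- l, l[%classic y ->
     \int[mu]_(x in `]0, pi[) fn n (x, y) = 0}) ->
  (forall n, nm (fun z => f z - fn n z) <= (C * 2^-1 ^+ n) ^+ 2) ->
  {ae mu, forall y, `]- l, l[%classic y -> \int[mu]_(x in `]0, pi[) f (x, y) = 0}.
Proof.
move=> C0 lf lfn zfn H; have mO := measurable_Omega l.
have [ae1 i1 E1] := fubini_rect (L2_intgO lf).
apply: (@Rint_abs_eq0 _ mR R mu) => //.
apply: (@le_geometric0 _ _ (Num.sqrt (fine (area (Omega l))) * C)) => n.
have lB : L2 area (Omega l) (fun z => f z - fn n z) by exact: L2B.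
have iB := intg_abs (L2_intgO lB).
have [ae2 i2 E2] := fubini_rect iB.
have [ae3 i3 E3] := fubini_rect (L2_intgO (lfn n)).
have le1 : \int[mu]_(y in `]- l, l[) `|\int[mu]_(x in `]0, pi[) f (x, y)| <=
    \int[area]_(z in Omega l) `|f z - fn n z|.
  rewrite E2; apply: (@Rint_le_ae _ mR R mu) => //; first exact: intg_abs.
  apply: filterS3 (filterI ae1 ae2) ae3 (zfn n) => y [h1 h2] h3 h4 ly.
  have {}h1 := h1 ly; have {}h3 := h3 ly.
  have -> : \int[mu]_(x in `]0, pi[) f (x, y) = \int[mu]_(x in `]0, pi[) (f (x, y) - fn n (x, y)).
    by rewrite RintegralB// h4// subr0.
  by apply: le_normr_Rintegral => //; exact: intgB.
rewrite ger0_norm; last by apply: Rintegral_ge0.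
apply: (le_trans le1); rewrite -mulrA.
have J0 : 0 <= \int[area]_(z in Omega l) `|f z - fn n z| by apply: Rintegral_ge0.
have C20 : 0 <= C * 2^-1 ^+ n by rewrite mulr_ge0.
rewrite -[leLHS](ger0_norm J0) -[X in _ * X](ger0_norm C20) -!sqrtr_sqr -sqrtrM; last first.
  by rewrite fine_ge0.
apply: ler_wsqrtr; apply: (le_trans (Rint_abs_sqr_le mO (Omega_fin l) lB)).
by rewrite ler_wpM2l// fine_ge0.
Qed.

End hilbert.

(** * Completeness of the energy space, and continuity of the gap *)

Section completeness.
Context {R : realType}.
Local Notation mu := (@lebesgue_measure R).
Local Notation mR := (measurableTypeR R).
Local Notation mplane := (mR * mR)%type.
Local Notation area := (@area R).
Local Notation pi := (@pi R).
Variables (l sigma : R) (l_gt0 : 0 < l) (sigmaP : 0 < sigma < 1 / 2).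
Implicit Types (u v w f g : R * R -> R) (i j n m : nat).

Let nl : - l < l := Nl_lt l_gt0.
Let nle := ltW nl.
Let p0 := pi_gt0 R.
Let p0' := pi_ge0 R.
Local Notation nm f := (n2 area (Omega l) f).
Local Notation wjet := (wjet l).
Local Notation prod := (H2star_prod l sigma).
Local Notation H2s := (H2star l).
Let mO := measurable_Omega l.

Lemma L2_fst f : L2 area (Omega l) f -> L2 area (Omega l) (fun z => z.1 * f z) /\
  nm (fun z => z.1 * f z) <= pi ^+ 2 * nm f.
Proof.
move=> lf; have le : {ae area, forall z, Omega l z -> `|z.1 * f z| <= pi * `|f z|}.
  apply: aeW => z [/=]; rewrite in_itv/= => /andP[h1 h2] _.
  by rewrite normrM ler_wpM2r// ger0_norm; lra.
have lg : L2 area (Omega l) (fun z => pi * `|f z|) by apply: L2Z => //; exact: L2_abs.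
have mz : measurable_fun (Omega l : set mplane) (fun z => z.1 * f z).
  apply: measurable_funM lf.1; apply: measurable_funTS; exact: measurable_fst.
split; first exact: (L2_le mO mz lg).
have -> : pi ^+ 2 * nm f = nm (fun z => pi * `|f z|).
  by rewrite (n2Z mO _ (L2_abs lf)) n2_abs.
exact: (n2_le mO mz lg).
Qed.

Lemma sqr_sqrtM (K x y : R) : 0 <= K -> (Num.sqrt K * x * y) ^+ 2 = K * (x * y) ^+ 2.
Proof. by move=> K0; rewrite -mulrA exprMn sqr_sqrtr. Qed.

Lemma wjet_diff_nm u v i j : H2s u -> H2s v -> (i + j <= 2)%N ->
  nm (fun z => wjet v i j z - wjet u i j z) = nm (wjet (fun z => (-1) * u z + v z) i j).
Proof.
move=> Hu Hv ij; have Hw := H2starD l_gt0 (-1) Hu Hv.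
have lu := L2_wjet l_gt0 Hu.1 ij; have lv := L2_wjet l_gt0 Hv.1 ij.
have lw := L2_wjet l_gt0 Hw.1 ij.
apply: (@n2_ae _ mplane R area) => //; [exact: (L2B mO lv lu).1|exact: lw.1|].
apply: filterS (djetD l_gt0 (-1) Hu.1 Hv.1 ij) => z h Oz.
by rewrite h//; ring.
Qed.

Lemma N2_le3 (U : nat -> nat -> R * R -> R) (c : R) :
  (forall i j, (i + j = 2)%N -> nm (U i j) <= c) -> 2 * N2 l U <= 6 * c.
Proof.
move=> B; have := B 2%N 0%N erefl; have := B 1%N 1%N erefl; have := B 0%N 2%N erefl.
by rewrite /N2 => *; lra.
Qed.

(** The energy controls the whole jet by [wjet_bound], so every derivative has an L2 limit. The weak
    derivative identities pass to the limit by [pairing_limit], and the two line integrals of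
    [hinged] by [marginal_limit]. *)
Lemma H2star_complete (u : nat -> R * R -> R) (C : R) : 0 <= C ->
  (forall n, H2s (u n)) ->
  (forall n m, (n <= m)%N ->
    prod (fun z => (-1) * u n z + u m z) (fun z => (-1) * u n z + u m z) <=
    (C * 2^-1 ^+ n) ^+ 2) ->
  exists w C', [/\ 0 <= C', H2s w & forall n,
    prod (fun z => (-1) * u n z + w z) (fun z => (-1) * u n z + w z) <=
    (C' * 2^-1 ^+ n) ^+ 2].
Proof.
move=> C0 Hu cau; pose C1 : R := Num.sqrt (Kenergy l) * C.
have K0 : 0 <= Kenergy l := Kenergy_ge0 l_gt0.
have C10 : 0 <= C1 by rewrite mulr_ge0 ?sqrtr_ge0.
have cauj i j n m : (i + j <= 2)%N -> (n <= m)%N ->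
    nm (fun z => wjet (u m) i j z - wjet (u n) i j z) <= (C1 * 2^-1 ^+ n) ^+ 2.
  move=> ij nm; have Hd := H2starD l_gt0 (-1) (Hu n) (Hu m).
  rewrite wjet_diff_nm//; apply: (le_trans (wjet_bound l_gt0 sigmaP Hd ij)).
  by rewrite sqr_sqrtM// ler_wpM2l//; exact: cau.
(* Limits are chosen for all pairs of orders at once, vacuously outside [i + j <= 2]. *)
have G : forall ij : nat * nat, exists g, (ij.1 + ij.2 <= 2)%N ->
    [/\ L2 area (Omega l) g,
      {ae area, forall z, Omega l z -> (fun n => wjet (u n) ij.1 ij.2 z) @ \oo --> g z} &
      forall n, nm (fun z => g z - wjet (u n) ij.1 ij.2 z) <= (C1 * 2^-1 ^+ n) ^+ 2].
  move=> [i j]; case: (boolP (i + j <= 2)%N) => ij; last by exists (cst 0) => /= h; case: (negP ij).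
  have [g hg] := @L2_fast_cauchy _ mplane R area _ mO (Omega_fin l)
    (fun n => wjet (u n) i j) C1 C10 (fun n => L2_wjet l_gt0 (Hu n).1 ij) (fun n m => cauj i j n m ij).
  by exists g => _.
have [g hg] := boolp.choice G; pose w := g (0%N, 0%N).
have Lg i j : (i + j <= 2)%N -> L2 area (Omega l) (g (i, j)).
  by move=> ij; have [] := hg (i, j) ij.
have Bg i j n : (i + j <= 2)%N ->
    nm (fun z => g (i, j) z - wjet (u n) i j z) <= (C1 * 2^-1 ^+ n) ^+ 2.
  by move=> ij; have [_ _] := hg (i, j) ij; apply.
have Ld n i j : (i + j <= 2)%N -> L2 area (Omega l) (wjet (u n) i j).
  by move=> ij; exact: (L2_wjet l_gt0 (Hu n).1 ij).
have D i j : (i + j <= 2)%N -> is_L2_deriv l i j w (g (i, j)).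
  move=> ij; split; first exact/Lq2P/Lg.
  move=> phi tp; have tp' := test_iter i j tp.
  apply/eqP; rewrite -subr_eq0; apply/eqP.
  pose M := Num.sqrt (nm (iter i Dx (iter j Dy phi))) * C1 + Num.sqrt (nm phi) * C1.
  apply: (@le_geometric0 _ _ M) => n.
  have h1 := pairing_limit (Lg 0%N 0%N isT) (fun n => Ld n 0%N 0%N isT) (test_L2 tp') C10 (Bg 0%N 0%N n isT).
  have h2 := pairing_limit (Lg i j ij) (fun n => Ld n i j ij) (test_L2 tp) C10 (Bg i j n ij).
  have [_ /(_ phi tp) e] := wjet_deriv (Hu n).1 ij.
  move: h1; rewrite {1}/wjet/= e => h1.
  move: h1 h2; rewrite /M mulrDl -/w.
  move: (\int[area]_(z in Omega l) _) => Yn; move: (\int[area]_(z in Omega l) _) => Y.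
  move: (\int[area]_(z in Omega l) _) => X h1 h2.
  have -> : X - (-1) ^+ (i + j) * Y = (X - (-1) ^+ (i + j) * Yn) - (-1) ^+ (i + j) * (Y - Yn) by ring.
  apply: (le_trans (ler_normB _ _)); apply: lerD => //.
  by rewrite normrM normrX normrN1 expr1n mul1r.
have Hw : H2 l w by split; [exact/Lq2P/Lg|move=> i j ij; exists (g (i, j)); exact: D].
have E i j : (i + j <= 2)%N -> {ae area, forall z, Omega l z -> wjet w i j z = g (i, j) z}.
  move=> ij; rewrite /wjet; case: ifP => [|_]; last exact: wD_ae (D i j ij).
  by rewrite addn_eq0 => /andP[/eqP-> /eqP->]; apply: aeW.
have Lw i j : (i + j <= 2)%N -> L2 area (Omega l) (wjet w i j) by exact: L2_wjet.
have Zg : {ae mu, forall y, `]- l, l[%classic y -> \int[mu]_(x in `]0, pi[) g (1%N, 0%N) (x, y) = 0}.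
  apply: (marginal_limit C10 (Lg 1%N 0%N isT) (fun n => Ld n 1%N 0%N isT)) => n; last exact: Bg.
  by apply: filterS (H2star_hinged l_gt0 (Hu n)) => y h /h[].
have Zg2 : {ae mu, forall y, `]- l, l[%classic y ->
    \int[mu]_(x in `]0, pi[) (g (0%N, 0%N) (x, y) + x * g (1%N, 0%N) (x, y)) = 0}.
  (* The factor comes from [n2D_le] and the bound of [x] by [pi] on the rectangle. *)
  pose C2 : R := Num.sqrt (2 + 2 * pi ^+ 2) * C1.
  have P0 : 0 <= 2 + 2 * pi ^+ 2 :> R by rewrite addr_ge0// mulr_ge0 ?sqr_ge0.
  have C20 : 0 <= C2 by rewrite mulr_ge0 ?sqrtr_ge0.
  apply: (marginal_limit C20 (f := fun z => g (0%N, 0%N) z + z.1 * g (1%N, 0%N) z)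
    (fn := fun n z => wjet (u n) 0 0 z + z.1 * wjet (u n) 1 0 z)) => [|n|n|n].
  - by apply: L2D => //; [exact: Lg|exact: (L2_fst (Lg 1%N 0%N isT)).1].
  - by apply: L2D => //; [exact: Ld|exact: (L2_fst (Ld n 1%N 0%N isT)).1].
  - by apply: filterS (H2star_hinged l_gt0 (Hu n)) => y h /h[].
  - have l1 := L2B mO (Lg 0%N 0%N isT) (Ld n 0%N 0%N isT).
    have l2 := L2B mO (Lg 1%N 0%N isT) (Ld n 1%N 0%N isT).
    have [l3 n3] := L2_fst l2.
    have -> : nm (fun z => g (0%N, 0%N) z + z.1 * g (1%N, 0%N) z - (wjet (u n) 0 0 z + z.1 * wjet (u n) 1 0 z)) =
      nm (fun z => (g (0%N, 0%N) z - wjet (u n) 0 0 z) + z.1 * (g (1%N, 0%N) z - wjet (u n) 1 0 z)).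
      by apply: eq_Rintegral => z _; congr (_ ^+ 2); ring.
    apply: (le_trans (n2D_le mO l1 l3)); rewrite sqr_sqrtM//.
    have := Bg 0%N 0%N n isT; have := ler_wpM2l (sqr_ge0 pi) (Bg 1%N 0%N n isT).
    by move=> h1 h2; rewrite [leRHS]mulrDl; lra.
have Hws : H2s w.
  have jw := H2_jet l_gt0 Hw; apply: (hinged_H2star l_gt0 jw).
  apply: filterS3 (filterI Zg Zg2) (Omega_sec (E 1%N 0%N isT)) (ae_sec (E 0%N 0%N isT)) => y [z1 z2] e1 e2 ly.
  have m10 := meas_sec (Lw 1%N 0%N isT).1 ly; have m00 := meas_sec (Lw 0%N 0%N isT).1 ly.
  have m10' := meas_sec (Lg 1%N 0%N isT).1 ly; have m00' := meas_sec (Lg 0%N 0%N isT).1 ly.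
  split; [rewrite -[RHS](z1 ly)|rewrite -[RHS](z2 ly)]; apply: (@Rint_ae _ mR R mu) => //.
  - by apply: filterS (e1 ly) => x h /h.
  - by apply: (@measurable_funD _ mR) => //; apply: (@measurable_funM _ mR).
  - by apply: (@measurable_funD _ mR) => //; apply: (@measurable_funM _ mR).
  - by apply: filterS2 (e1 ly) (e2 ly) => x h1 h2 xp; rewrite h1// h2.
(* The energy is at most twice the sum of three second-order norms, each bounded by
   [(C1 * 2^-1 ^+ n) ^+ 2]. *)
exists w, (Num.sqrt 6 * C1); split => // [|n]; first by rewrite mulr_ge0 ?sqrtr_ge0.
have Hd := H2starD l_gt0 (-1) (Hu n) Hws.
have /andP[_ le1] := prod_bounds l_gt0 sigmaP Hd; apply: (le_trans le1).
have B i j : (i + j <= 2)%N -> nm (wjet (fun z => (-1) * u n z + w z) i j) <= (C1 * 2^-1 ^+ n) ^+ 2.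
  move=> ij; rewrite -wjet_diff_nm//.
  have -> : nm (fun z => wjet w i j z - wjet (u n) i j z) = nm (fun z => g (i, j) z - wjet (u n) i j z).
    apply: (@n2_ae _ mplane R area) => //.
    - exact: (L2B mO (Lw i j ij) (Ld n i j ij)).1.
    - exact: (L2B mO (Lg i j ij) (Ld n i j ij)).1.
    - by apply: filterS (E i j ij) => z h Oz; rewrite h.
  exact: Bg.
by rewrite sqr_sqrtM//; apply: N2_le3 => i j ij; apply: B; rewrite ij.
Qed.

Lemma H2star0 : H2s (fun=> 0).
Proof.
have L0 : L2 area (Omega l) (fun=> 0) by exact: L2_cst.
have D i j : is_L2_deriv l i j (fun=> 0 : R) (fun=> 0 : R).
  split; first exact/Lq2P.
  move=> phi _; have -> (psi : R * R -> R) : \int[area]_(z in Omega l) (0 * psi z) = 0.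
    by under eq_Rintegral do rewrite mul0r; rewrite Rintegral_cst// mul0r.
  have -> (psi : R * R -> R) : \int[area]_(z in Omega l) (0 * psi z) = 0.
    by under eq_Rintegral do rewrite mul0r; rewrite Rintegral_cst// mul0r.
  by rewrite mulr0.
split; first by split; [exact/Lq2P|move=> i j _; exists (fun=> 0)].
exists (fun=> 0) => //; split; last by apply: aeW.
by move=> z; exact: cst_continuous.
Qed.

Lemma H2star_riesz (F : (R * R -> R) -> R) (K : R) :
  (forall (a : R) u v, H2s u -> H2s v -> F (fun z => a * u z + v z) = a * F u + F v) ->
  (forall v, H2s v -> `|F v| <= K * Num.sqrt (prod v v)) ->
  exists u, is_weak_solution l sigma F u.
Proof.
move=> Flin Fbnd.
have [u su hu] := @riesz_representation R (R * R)%type H2s prod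
  (H2starD l_gt0) (ex_intro _ _ H2star0) (prodD sigma l_gt0)
  (fun u v _ _ => prodC l sigma u v) (prod_ge0 l_gt0 sigmaP) H2star_complete F K Flin Fbnd.
by exists u.
Qed.

Lemma gapE u x : H2s u -> `[0, pi]%classic x -> gap l u x = box 0 (- l) (wjet u 1 1) x l.
Proof.
by move=> Hu xp; have := gap_box l_gt0 (H2_jet l_gt0 Hu.1) (H2star_hinged l_gt0 Hu) xp.
Qed.

Lemma gap_endpoints u : H2s u -> gap l u 0 = 0 /\ gap l u pi = 0.
Proof.
move=> Hu; rewrite !gapE ?box_left//=; try by rewrite in_itv/= ?lexx p0'.
by split=> //; exact: (gap_right l_gt0 (H2_jet l_gt0 Hu.1) (H2star_hinged l_gt0 Hu)).
Qed.

Lemma gapD (a : R) u v x : H2s u -> H2s v -> `[0, pi]%classic x ->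
  gap l (fun z => a * u z + v z) x = a * gap l u x + gap l v x.
Proof.
move=> Hu Hv xp; have Hw := H2starD l_gt0 a Hu Hv; rewrite !gapE// /box.
move: xp; rewrite /= in_itv/= => /andP[x0 xp].
have I w : H2s w -> intg area (rect 0 x (- l) l) (wjet w 1 1).
  move=> H; have h := L2_intgO (L2_wjet l_gt0 H.1 (isT : (1 + 1 <= 2)%N)).
  exact: (intg_rect_sub h).
have mr := measurable_rect 0 x (- l) l.
have iu := intgZ mr a (I _ Hu); have iv := I _ Hv; have iw := I _ Hw.
rewrite -RintegralZl//; last exact: I.
rewrite -RintegralD//; apply: (@Rint_ae _ mplane R area) => //.
- exact: intg_meas iw.
- exact: intg_meas (intgD mr iu iv).
apply: filterS (djetD l_gt0 a (i := 1) (j := 1) Hu.1 Hv.1 isT) => z h rz.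
by apply: h; apply: (rect_sub (lexx 0) xp (lexx (- l)) (lexx l)) rz.
Qed.

(** Under the root, [2 * l] is the height of the strip between [x] and [x'], and the other factor 2
    is that of [N2_le_prod]. *)
Definition Kgap : R := Num.sqrt (4 * l).

Lemma gap_holder u x x' : H2s u -> `[0, pi]%classic x -> `[0, pi]%classic x' ->
  `|gap l u x - gap l u x'| <= Kgap * Num.sqrt `|x - x'| * Num.sqrt (prod u u).
Proof.
move=> Hu xp xp'; rewrite !gapE//.
have lq := L2_wjet l_gt0 Hu.1 (isT : (1 + 1 <= 2)%N).
move: xp xp'; rewrite /= !in_itv/= => xp xp'.
have ll : - l <= l <= l by rewrite lexx nle.
apply: (le_trans (box_holder_x lq xp xp' ll)).
have l4 : 0 <= 4 * l by rewrite mulr_ge0// ltW.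
rewrite mulrAC ler_wpM2r ?sqrtr_ge0// /Kgap -sqrtrM//.
apply: ler_wsqrtr; have [_ h _] := N2_le l (wjet u).
have h2 := N2_le_prod l_gt0 sigmaP Hu.
have -> : l - - l = 2 * l by ring.
have -> : 4 * l * prod u u = 2 * l * (2 * prod u u) by ring.
apply: ler_wpM2l; first by rewrite mulr_ge0// ltW.
exact: le_trans h h2.
Qed.

End completeness.

(** * Multiplication by a weight *)

Section leibniz.
Context {R : realType}.
Local Notation mu := (@lebesgue_measure R).
Local Notation mR := (measurableTypeR R).
Local Notation mplane := (mR * mR)%type.
Local Notation area := (@area R).
Local Notation pi := (@pi R).

Lemma ac1D (a b : R) (F1 G1 F2 G2 : R -> R) : ac1 a b F1 G1 -> ac1 a b F2 G2 ->
  ac1 a b (fun x => F1 x + F2 x) (fun x => G1 x + G2 x).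
Proof.
move=> [m1 i1 [k1 e1]] [m2 i2 [k2 e2]]; split.
- exact: (@measurable_funD _ mR).
- exact: intgD.
exists (k1 + k2); apply: filterS2 e1 e2 => x h1 h2 Ix; rewrite h1// h2//.
have xb : x <= b by move: Ix; rewrite /= in_itv/= => /andP[_ /ltW].
have -> : prim a (fun x => G1 x + G2 x) x = prim a G1 x + prim a G2 x.
  by rewrite /prim RintegralD//; [exact: (intg_sub i1)|exact: (intg_sub i2)].
by ring.
Qed.

Lemma sacxD (a b c d : R) (f1 g1 f2 g2 : R * R -> R) :
  sacx a b c d f1 g1 -> sacx a b c d f2 g2 ->
  sacx a b c d (fun z => f1 z + f2 z) (fun z => g1 z + g2 z).
Proof.
by move=> S1 S2; apply: filterS2 S1 S2 => y h1 h2 ly; apply: ac1D; [exact: h1|exact: h2].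
Qed.

Variables (l sigma : R) (l_gt0 : 0 < l) (sigmaP : 0 < sigma < 1 / 2).
Implicit Types (u v w f g : R * R -> R) (i j n m : nat).
Let nl : - l < l := Nl_lt l_gt0.
Let nle := ltW nl.
Let p0 := pi_gt0 R.
Let p0' := pi_ge0 R.
Local Notation nm f := (n2 area (Omega l) f).
Local Notation wjet := (wjet l).
Local Notation prod := (H2star_prod l sigma).
Local Notation H2s := (H2star l).
Let mO := measurable_Omega l.

Lemma L2_ae_boundedM f g (M : R) : L2 area (Omega l) f ->
  measurable_fun (Omega l : set mplane) g ->
  {ae area, forall z, Omega l z -> `|g z| <= M} -> 0 <= M ->
  L2 area (Omega l) (fun z => g z * f z) /\ nm (fun z => g z * f z) <= M ^+ 2 * nm f.
Proof.
move=> lf mg gM M0; have le : {ae area, forall z, Omega l z -> `|g z * f z| <= M * `|f z|}.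
  by apply: filterS gM => z h Oz; rewrite normrM ler_wpM2r// h.
have lg : L2 area (Omega l) (fun z => M * `|f z|) by apply: L2Z => //; exact: L2_abs.
have mz : measurable_fun (Omega l : set mplane) (fun z => g z * f z).
  exact: measurable_funM lf.1.
split; first exact: (L2_le mO mz lg).
have -> : M ^+ 2 * nm f = nm (fun z => M * `|f z|).
  by rewrite (n2Z mO _ (L2_abs lf)) n2_abs.
exact: (n2_le mO mz lg).
Qed.

(** The embedding into bounded functions, read off from the box formula for the continuous
    version. *)
Lemma H2star_sup v : H2s v ->
  {ae area, forall z, Omega l z -> `|v z| <= Num.sqrt (Kenergy l * prod v v)}.
Proof.
move=> Hv; have jv := H2_jet l_gt0 Hv.1; have Z := H2star_hinged l_gt0 Hv.
apply: filterS (hinged_cversion l_gt0 jv Z) => z h Oz.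
have -> : v z = cversion l (wjet v) z by exact: h.
rewrite -sqrtr_sqr; apply: ler_wsqrtr; apply: (le_trans (hinged_sup_bound l_gt0 jv Z _)).
  by case: Oz => h1 h2; split; exact: subset_itv_oo_cc.
apply: (le_trans (ler_wpM2l (Khinged_ge0 l_gt0) (N2_le_prod l_gt0 sigmaP Hv))).
by rewrite /Kenergy mulrCA mulrA.
Qed.

Lemma addfACA f1 f2 f3 f4 : (fun z => (f1 z + f2 z) + (f3 z + f4 z)) =
  (fun z => (f1 z + f3 z) + (f2 z + f4 z)).
Proof. by apply/funext => z; rewrite addrACA. Qed.

Definition jet_n2 (U : nat -> nat -> R * R -> R) : R :=
  nm (U 0%N 0%N) + nm (U 1%N 0%N) + nm (U 0%N 1%N) +
  nm (U 2%N 0%N) + nm (U 1%N 1%N) + nm (U 0%N 2%N).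

Lemma jet_n2_le (U : nat -> nat -> R * R -> R) i j : (i + j <= 2)%N ->
  nm (U i j) <= jet_n2 U.
Proof.
have N k k' := n2_ge0 area (Omega l) (U k k').
move: (N 0%N 0%N) (N 1%N 0%N) (N 0%N 1%N) (N 2%N 0%N) (N 1%N 1%N) (N 0%N 2%N); rewrite /jet_n2.
by move: i j => [|[|[|i]]] [|[|[|j]]] // *; lra.
Qed.

Section fixed_weight.
Variables (p : R * R -> R) (b : R).
Hypotheses (Hp : H2 l p) (pb : {ae area, forall z, Omega l z -> `|p z| <= b}) (b0 : 0 <= b).

Definition Nweight : R := jet_n2 (wjet p).
Definition Klady : R := (2 * (pi - 0)^-1 + 2 * (pi - 0)) * (2 * (l - - l)^-1 + 2 * (l - - l)).
(** The three summands are the three cases of [mul_jet_L2]: [p] undifferentiated, [v]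
    undifferentiated, one derivative on each. *)
Definition Kmul : R := (b ^+ 2 + Nweight + Klady * (2 * Nweight) * 2) * Kenergy l.

Lemma Nweight_le i j : (i + j <= 2)%N -> nm (wjet p i j) <= Nweight.
Proof. exact: jet_n2_le. Qed.

Lemma Klady_ge0 : 0 <= Klady.
Proof.
rewrite /Klady subr0; have -> : l - - l = 2 * l by ring.
have l2 : 0 <= 2 * l by rewrite mulr_ge0// ltW.
by rewrite mulr_ge0// addr_ge0// mulr_ge0// invr_ge0.
Qed.

(** As the total order is at most two, either a factor has order zero and is bounded, or both have
    order one. In the latter case one more [x]-derivative of the factor from [p] and one more
    [y]-derivative of the factor from [v] are available, as [ladyzhenskaya] demands. *)
Lemma mul_jet_L2 v i j k m : H2s v -> (i + j + (k + m) <= 2)%N ->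
  L2 area (Omega l) (fun z => wjet p i j z * wjet v k m z) /\
  nm (fun z => wjet p i j z * wjet v k m z) <= Kmul * prod v v.
Proof.
move=> Hv ijkm; have ij : (i + j <= 2)%N by exact: leq_trans (leq_addr _ _) ijkm.
have km : (k + m <= 2)%N by exact: leq_trans (leq_addl _ _) ijkm.
have S0 := prod_ge0 l_gt0 sigmaP Hv; have K0 := Kenergy_ge0 l_gt0.
have KS0 : 0 <= Kenergy l * prod v v by rewrite mulr_ge0.
have Np0 : 0 <= Nweight by apply: le_trans (Nweight_le (i := 0) (j := 0) isT); exact: n2_ge0.
have L0 := Klady_ge0.
have t1 : 0 <= b ^+ 2 * (Kenergy l * prod v v) by rewrite mulr_ge0 ?sqr_ge0.
have t2 : 0 <= Nweight * (Kenergy l * prod v v) by rewrite mulr_ge0.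
have t3 : 0 <= Klady * (2 * Nweight) * (2 * (Kenergy l * prod v v)).
  by apply: mulr_ge0; apply: mulr_ge0 => //; apply: mulr_ge0.
have KE : Kmul * prod v v = b ^+ 2 * (Kenergy l * prod v v) + Nweight * (Kenergy l * prod v v) +
  Klady * (2 * Nweight) * (2 * (Kenergy l * prod v v)) by rewrite /Kmul; ring.
have lp i' j' : (i' + j' <= 2)%N -> L2 area (Omega l) (wjet p i' j') by exact: L2_wjet.
have lv i' j' : (i' + j' <= 2)%N -> L2 area (Omega l) (wjet v i' j') by exact: (L2_wjet l_gt0 Hv.1).
have bv i' j' : (i' + j' <= 2)%N -> nm (wjet v i' j') <= Kenergy l * prod v v.
  exact: (wjet_bound l_gt0 sigmaP Hv).
have [/eqP|ijN] := boolP (i + j == 0)%N.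
  move=> /eqP; rewrite addn_eq0 => /andP[/eqP i0 /eqP j0]; rewrite i0 j0.
  have [L le] := L2_ae_boundedM (lv k m km) (lp 0%N 0%N isT).1 pb b0.
  split => //; apply: (le_trans le); rewrite KE.
  by apply: (le_trans (ler_wpM2l (sqr_ge0 b) (bv k m km))); lra.
have [/eqP|kmN] := boolP (k + m == 0)%N.
  move=> /eqP; rewrite addn_eq0 => /andP[/eqP k0 /eqP m0]; rewrite k0 m0.
  have [] := L2_ae_boundedM (lp i j ij) (lv 0%N 0%N isT).1 (H2star_sup Hv) (sqrtr_ge0 _).
  have -> : (fun z => wjet v 0 0 z * wjet p i j z) = (fun z => wjet p i j z * wjet v 0 0 z).
    by apply/funext => z; rewrite mulrC.
  rewrite sqr_sqrtr// => L le; split => //; apply: (le_trans le); rewrite KE mulrC.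
  by apply: (le_trans (ler_wpM2r KS0 (Nweight_le ij))); lra.
have ij1 : (i + j < 2)%N.
  by move: ijkm kmN ijN; case: (i + j)%N => [|[|[|?]]]; case: (k + m)%N => [|[|[|?]]].
have km1 : (k + m < 2)%N.
  by move: ijkm kmN ijN; case: (i + j)%N => [|[|[|?]]]; case: (k + m)%N => [|[|[|?]]].
have [_ sXp _] := H2_jet l_gt0 Hp; have [_ _ sYv] := H2_jet l_gt0 Hv.1.
have km' : (k + m.+1 <= 2)%N by rewrite addnS.
have [L le] := ladyzhenskaya p0 nl (lp i j ij) (lp i.+1 j ij1) (lv k m km) (lv k m.+1 km')
  (sXp i j ij1) (sYv k m km1).
split => //; apply: (le_trans le); rewrite KE.
have h1 := Nweight_le ij; have h2 := Nweight_le (i := i.+1) (j := j) ij1.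
have h3 := bv k m km; have h4 := bv k m.+1 km'.
apply: (@le_trans _ _ (Klady * (2 * Nweight) * (2 * (Kenergy l * prod v v)))); last by lra.
have n1 := n2_ge0 area (Omega l) (wjet p i j); have n2' := n2_ge0 area (Omega l) (wjet p i.+1 j).
have n3 := n2_ge0 area (Omega l) (wjet v k m); have n4 := n2_ge0 area (Omega l) (wjet v k m.+1).
rewrite mulrACA -/Klady -[leRHS]mulrA; apply: ler_wpM2l => //.
by apply: ler_pM; [exact: addr_ge0|exact: addr_ge0|lra|lra].
Qed.

(** Equal terms are not collected: each entry is literally what [sacx_mul] and [sacxD] produce from
    a lower one. The mixed entry is the [x]-derivative of the entry [0, 1]; as a [y]-derivative of
    the entry [1, 0] it is regrouped by [addfACA]. *)
Definition leibniz_jet v (i j : nat) : R * R -> R :=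
  match i, j with
  | 0%N, 0%N => fun z => wjet p 0 0 z * wjet v 0 0 z
  | 1%N, 0%N => fun z => wjet p 1 0 z * wjet v 0 0 z + wjet p 0 0 z * wjet v 1 0 z
  | 0%N, 1%N => fun z => wjet p 0 1 z * wjet v 0 0 z + wjet p 0 0 z * wjet v 0 1 z
  | 2%N, 0%N => fun z => (wjet p 2 0 z * wjet v 0 0 z + wjet p 1 0 z * wjet v 1 0 z) +
                     (wjet p 1 0 z * wjet v 1 0 z + wjet p 0 0 z * wjet v 2 0 z)
  | 1%N, 1%N => fun z => (wjet p 1 1 z * wjet v 0 0 z + wjet p 0 1 z * wjet v 1 0 z) +
                     (wjet p 1 0 z * wjet v 0 1 z + wjet p 0 0 z * wjet v 1 1 z)
  | 0%N, 2%N => fun z => (wjet p 0 2 z * wjet v 0 0 z + wjet p 0 1 z * wjet v 0 1 z) +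
                     (wjet p 0 1 z * wjet v 0 1 z + wjet p 0 0 z * wjet v 0 2 z)
  | _, _ => fun=> 0
  end.

Lemma n2D4_le f1 f2 f3 f4 (c : R) :
  L2 area (Omega l) f1 /\ nm f1 <= c -> L2 area (Omega l) f2 /\ nm f2 <= c ->
  L2 area (Omega l) f3 /\ nm f3 <= c -> L2 area (Omega l) f4 /\ nm f4 <= c ->
  L2 area (Omega l) (fun z => (f1 z + f2 z) + (f3 z + f4 z)) /\
  nm (fun z => (f1 z + f2 z) + (f3 z + f4 z)) <= 16 * c.
Proof.
move=> [l1 h1] [l2 h2] [l3 h3] [l4 h4].
have l12 := L2D mO l1 l2; have l34 := L2D mO l3 l4; split; first exact: L2D.
apply: (le_trans (n2D_le mO l12 l34)).
have := n2D_le mO l1 l2; have := n2D_le mO l3 l4; lra.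
Qed.

Lemma jet_leibniz v : H2s v -> jet l (leibniz_jet v).
Proof.
move=> Hv; have ML i j k m h := (@mul_jet_L2 v i j k m Hv h).1.
have M4 i j k m h := @mul_jet_L2 v i j k m Hv h.
have [_ pX pY] := H2_jet l_gt0 Hp; have [_ vX vY] := H2_jet l_gt0 Hv.1.
split.
- move=> [|[|[|i]]] [|[|[|j]]] // _.
  + exact: (ML 0 0 0 0)%N.
  + by apply: L2D => //; [exact: (ML 0 1 0 0)%N|exact: (ML 0 0 0 1)%N].
  + by apply: (n2D4_le (M4 0 2 0 0 _) (M4 0 1 0 1 _) (M4 0 1 0 1 _) (M4 0 0 0 2 _)).1%N.
  + by apply: L2D => //; [exact: (ML 1 0 0 0)%N|exact: (ML 0 0 1 0)%N].
  + by apply: (n2D4_le (M4 1 1 0 0 _) (M4 0 1 1 0 _) (M4 1 0 0 1 _) (M4 0 0 1 1 _)).1%N.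
  + by apply: (n2D4_le (M4 2 0 0 0 _) (M4 1 0 1 0 _) (M4 1 0 1 0 _) (M4 0 0 2 0 _)).1%N.
- move=> [|[|i]] [|[|j]] // _.
  + exact: sacx_mul (pX 0 0 isT)%N (vX 0 0 isT)%N.
  + by apply: sacxD; [exact: sacx_mul (pX 0 1 isT)%N (vX 0 0 isT)%N|
      exact: sacx_mul (pX 0 0 isT)%N (vX 0 1 isT)%N].
  + by apply: sacxD; [exact: sacx_mul (pX 1 0 isT)%N (vX 0 0 isT)%N|
      exact: sacx_mul (pX 0 0 isT)%N (vX 1 0 isT)%N].
- move=> [|[|i]] [|[|j]] // _.
  + exact: sacx_mul (pY 0 0 isT)%N (vY 0 0 isT)%N.
  + by apply: sacxD; [exact: sacx_mul (pY 0 1 isT)%N (vY 0 0 isT)%N|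
      exact: sacx_mul (pY 0 0 isT)%N (vY 0 1 isT)%N].
  + have -> : leibniz_jet v 1 1 = (fun z => (wjet p 1 1 z * wjet v 0 0 z + wjet p 1 0 z * wjet v 0 1 z) +
                     (wjet p 0 1 z * wjet v 1 0 z + wjet p 0 0 z * wjet v 1 1 z)).
      exact: addfACA.
    by apply: sacxD; [exact: sacx_mul (pY 1 0 isT)%N (vY 0 0 isT)%N|
      exact: sacx_mul (pY 0 0 isT)%N (vY 1 0 isT)%N].
Qed.

(** On almost every line the continuous versions [f] of [p v] and [g] of [v] satisfy
    [|f| <= b * |g|] almost everywhere, hence up to the end points. There [g] vanishes, and so does
    [f]. *)
Lemma hinged_leibniz v : H2s v -> hinged l (leibniz_jet v).
Proof.
move=> Hv; have jp := jet_leibniz Hv; have [_ pX _] := jp.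
have [_ vX _] := H2_jet l_gt0 Hv.1.
apply: prim_hinged; first exact: (pX 0 0 isT)%N.
apply: filterS3 ((pX 0 0 isT)%N) (hinged_prim ((vX 0 0 isT)%N) (H2star_hinged l_gt0 Hv))
  (Omega_sec pb) => y A Zv pby ly.
have [mF Gi [k Fk]] := A ly; have [iv zv ev] := Zv ly.
pose f x := k + prim 0 (fun x => leibniz_jet v 1 0 (x, y)) x.
pose g x := prim 0 (fun x => wjet v 1 0 (x, y)) x.
have cf : {within `[0, pi], continuous f}.
  by apply: withinD; [move=> t; exact: cst_continuous|exact: (prim_continuous p0' Gi)].
have cg : {within `[0, pi], continuous g} by exact: (prim_continuous p0' iv).
have cN (h q : R -> R) : continuous q -> {within `[0, pi], continuous h} ->
    {within `[0, pi], continuous (q \o h)}.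
  move=> cq /subspace_continuousP ch; apply/subspace_continuousP => t It.
  by apply: cvg_comp (ch t It) _; exact: cq.
have cb : continuous (fun r : R => b * `|r|).
  by move=> r; apply: continuousM; [exact: cst_continuous|exact: norm_continuous].
have le x : `[0, pi]%classic x -> `|f x| <= b * `|g x|.
  apply: (@ae_within_le _ 0 pi (fun x => `|f x|) (fun x => b * `|g x|)) => //.
    exact: (cN _ _ (@norm_continuous _ R) cf).
    exact: (cN _ _ cb cg).
  apply: filterS3 Fk ev (pby ly) => t h1 h2 h3 It.
  have -> : f t = p (t, y) * g t by rewrite /f -(h1 It) /g -(h2 It).
  by rewrite normrM ler_wpM2r//; exact: h3.
have z0 : f 0 = 0.
  have := le 0; rewrite /= in_itv/= lexx p0' => /(_ isT).
  rewrite /g /prim set_itvoo0// Rintegral_set0 normr0 mulr0 => h.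
  by apply/normr0_eq0/eqP; rewrite eq_le h normr_ge0.
have k0 : k = 0 by move: z0; rewrite /f /prim set_itvoo0// Rintegral_set0 addr0.
split.
  have := le pi; rewrite /= in_itv/= lexx p0' => /(_ isT).
  rewrite /g zv normr0 mulr0 /f k0 add0r => h.
  by apply/normr0_eq0/eqP; rewrite eq_le h normr_ge0.
by apply: filterS Fk => x h /h ->; rewrite k0 add0r.
Qed.

Lemma H2star_mul v : H2s v -> H2s (fun z => p z * v z).
Proof. by move=> Hv; exact: (hinged_H2star l_gt0 (jet_leibniz Hv) (hinged_leibniz Hv)). Qed.

(** The constant is [6 * 16]: a factor 6 from [N2_le3], and 16 from [n2D4_le], as each second-order
    entry is a sum of four products. *)
Lemma prod_mul_le v : H2s v ->
  prod (fun z => p z * v z) (fun z => p z * v z) <= 96 * Kmul * prod v v.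
Proof.
move=> Hv; have Hw := H2star_mul Hv; have jp := jet_leibniz Hv; have [Lp _ _] := jp.
have /andP[_ le] := prod_bounds l_gt0 sigmaP Hw; apply: (le_trans le).
have M4 i j k m h := @mul_jet_L2 v i j k m Hv h.
have E i j : (i + j <= 2)%N -> (0 < i + j)%N ->
    nm (wjet (fun z => p z * v z) i j) = nm (leibniz_jet v i j).
  move=> ij ij0; apply: (@n2_ae _ mplane R area) => //.
  - exact: (L2_wjet l_gt0 Hw.1 ij).1.
  - exact: (Lp i j ij).1.
  - have := jet_wD l_gt0 jp ij; rewrite /wjet; case: ifP => //.
    by move=> e; rewrite (eqP e) in ij0.
have B i j : (i + j = 2)%N -> nm (wjet (fun z => p z * v z) i j) <= 16 * (Kmul * prod v v).
  move=> ij; rewrite E ?ij//; move: i j ij => [|[|[|i]]] [|[|[|j]]] // _.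
  - exact: (n2D4_le (M4 0 2 0 0 isT) (M4 0 1 0 1 isT) (M4 0 1 0 1 isT) (M4 0 0 0 2 isT)).2%N.
  - exact: (n2D4_le (M4 1 1 0 0 isT) (M4 0 1 1 0 isT) (M4 1 0 0 1 isT) (M4 0 0 1 1 isT)).2%N.
  - exact: (n2D4_le (M4 2 0 0 0 isT) (M4 1 0 1 0 isT) (M4 1 0 1 0 isT) (M4 0 0 2 0 isT)).2%N.
apply: (le_trans (N2_le3 B)).
by rewrite -[leRHS]mulrA; move: (Kmul * _) => c; lra.
Qed.

End fixed_weight.
End leibniz.

(** * Optimal forces *)

Section attained.
Context {R : realType}.
Local Notation mR := (measurableTypeR R).
Local Notation mplane := (mR * mR)%type.
Local Notation area := (@area R).
Local Notation pi := (@pi R).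

Lemma sqrt_le_mul (x K s : R) : x <= K * s -> 0 <= s ->
  Num.sqrt x <= Num.sqrt K * Num.sqrt s.
Proof.
move=> xKs s0; have [K0|K0] := leP 0 K.
  by rewrite -sqrtrM//; exact: ler_wsqrtr.
(* For [K < 0] the number [x] is nonpositive, and its square root is 0 by convention. *)
rewrite (@ler0_sqrtr _ x) ?mulr_ge0 ?sqrtr_ge0//.
by apply: (le_trans xKs); rewrite nmulr_rle0.
Qed.

Lemma holder_itv_continuous (M : R -> R) (K a b : R) : 0 <= K ->
  (forall x x', `[a, b]%classic x -> `[a, b]%classic x' ->
     `|M x - M x'| <= K * Num.sqrt `|x - x'|) ->
  {within `[a, b], continuous M}.
Proof.
move=> K0 H; have i01 : `[0, 1]%classic (0 : R) by rewrite /= in_itv/= lexx ler01.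
(* The interval is taken as the section at height 0 of [crect a b 0 1], to which [holder_within]
   applies. *)
apply: (@within_section _ a b 0 1 (fun z => M z.1) 0 i01).
apply: (@holder_within _ _ _ K) => -[x y] [x' y'] [/= h1 _] [/= h2 _].
by apply: (le_trans (H _ _ h1 h2)); rewrite ler_wpM2l// lerDl sqrtr_ge0.
Qed.

(* The pointwise maximum over [A] is Hoelder continuous in [x], hence attains
   its maximum at some [c], and the force that is optimal at [c] is optimal. *)
Lemma sup_family_attained (T : Type) (A : set T) (G : T -> R -> R) (a b K : R) :
  a < b -> 0 <= K ->
  (forall f x x', A f -> `[a, b]%classic x -> `[a, b]%classic x' ->
     `|G f x - G f x'| <= K * Num.sqrt `|x - x'|) ->
  (forall f, A f -> G f a = 0 /\ G f b = 0) ->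
  (forall x, `[a, b]%classic x -> exists2 f0, A f0 & forall f, A f -> `|G f x| <= `|G f0 x|) ->
  exists2 f0, A f0 & forall f, A f ->
    sup [set `|G f x| | x in `]a, b[%classic] <= sup [set `|G f0 x| | x in `]a, b[%classic].
Proof.
move=> ab K0 GK G0 Gmax.
have : forall x, exists f0, `[a, b]%classic x -> A f0 /\ forall f, A f -> `|G f x| <= `|G f0 x|.
  have aa : `[a, b]%classic a by rewrite /= in_itv/= lexx ltW.
  have [f1 Af1 _] := Gmax a aa => x.
  by have [/Gmax[f0 Af0 h]|nx] := pselect (`[a, b]%classic x); [exists f0|exists f1].
move=> /boolp.choice[phi hphi]; pose M x := `|G (phi x) x|.
have Mle x x' : `[a, b]%classic x -> `[a, b]%classic x' -> M x <= M x' + K * Num.sqrt `|x - x'|.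
  move=> hx hx'; have [Ap _] := hphi _ hx; have [_ mx] := hphi _ hx'.
  apply: le_trans (_ : `|G (phi x) x'| + K * Num.sqrt `|x - x'| <= _); last first.
    by rewrite lerD2r; exact: mx.
  rewrite -lerBlDl; apply: le_trans (GK _ _ _ Ap hx hx'); exact: lerB_dist.
have cM : {within `[a, b], continuous M}.
  apply: (holder_itv_continuous K0) => x x' hx hx'.
  have := Mle _ _ hx hx'; have := Mle _ _ hx' hx; rewrite [`|x' - x|]distrC.
  by move=> h1 h2; rewrite ler_norml; apply/andP; split; lra.
have [c hc cmax] := EVT_max (ltW ab) cM.
have [Ac _] := hphi c hc; exists (phi c) => // f Af.
have half : `]a, b[%classic ((a + b) / 2) by rewrite /= in_itv/=; apply/andP; split; lra.
have sub x : `]a, b[%classic x -> `[a, b]%classic x by exact: subset_itv_oo_cc.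
have le_c g x : A g -> `]a, b[%classic x -> `|G g x| <= M c.
  move=> Ag /sub hx; have [_ mx] := hphi _ hx.
  by apply: (le_trans (mx _ Ag)); exact: cmax.
have ub : has_ubound [set `|G (phi c) x| | x in `]a, b[%classic].
  by exists (M c) => _ [x hx <-]; exact: le_c.
apply: (@le_trans _ _ (M c)).
  apply: ge_sup; first by exists `|G f ((a + b) / 2)|, ((a + b) / 2).
  by move=> _ [x hx <-]; exact: le_c.
(* The supremum runs over the open interval. If [c] is an end point then [M c = 0], and the value at
   the midpoint is already large enough. *)
have [coo|ncoo] := pselect (`]a, b[%classic c).
  by apply: (ub_le_sup ub); exists c.
have -> : M c = 0.
  have [Ga Gb] := G0 _ Ac; move: ncoo hc; rewrite /= !in_itv/= /M => /negP.
  rewrite negb_and -!leNgt => /orP[h|h] /andP[h1 h2].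
    have e : c = a by apply/le_anti; rewrite h h1.
    by move: Ga; rewrite -e => ->; rewrite normr0.
  have e : c = b by apply/le_anti; rewrite h h2.
  by move: Gb; rewrite -e => ->; rewrite normr0.
apply: le_trans (normr_ge0 (G (phi c) ((a + b) / 2))) _.
by apply: (ub_le_sup ub); exists ((a + b) / 2).
Qed.

Variables (l sigma : R) (l_gt0 : 0 < l) (sigmaP : 0 < sigma < 1 / 2).
Implicit Types (u v w : R * R -> R) (i j n m : nat).
Let nl : - l < l := Nl_lt l_gt0.
Let nle := ltW nl.
Let p0 := pi_gt0 R.
Let p0' := pi_ge0 R.
Local Notation nm f := (n2 area (Omega l) f).
Local Notation wjet := (wjet l).
Local Notation prod := (H2star_prod l sigma).
Local Notation H2s := (H2star l).
Let mO := measurable_Omega l.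

Lemma gap_representer x : `[0, pi]%classic x ->
  exists2 g, H2s g & forall v, H2s v -> prod g v = gap l v x.
Proof.
move=> xp; have z0 : `[0, pi]%classic 0 by rewrite /= in_itv/= lexx p0'.
have Flin (a : R) u v : H2s u -> H2s v ->
    gap l (fun z => a * u z + v z) x = a * gap l u x + gap l v x.
  by move=> Hu Hv; exact: gapD.
(* Boundedness is the Hoelder estimate between [x] and the end point 0, where the gap vanishes. *)
have Fb v : H2s v -> `|gap l v x| <= Kgap l * Num.sqrt `|x - 0| * Num.sqrt (prod v v).
  move=> Hv; have := gap_holder l_gt0 sigmaP Hv xp z0.
  by rewrite (gap_endpoints l_gt0 Hv).1 subr0.
have [u [Hu hu]] := H2star_riesz l_gt0 sigmaP Flin Fb.
by exists u.
Qed.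

Definition bounded_functional (C : R) (F : (R * R -> R) -> R) :=
  (forall (a : R) u v, H2s u -> H2s v -> F (fun z => a * u z + v z) = a * F u + F v) /\
  (forall v, H2s v -> `|F v| <= C * Num.sqrt (prod v v)).

Lemma weak_solutionP C F : bounded_functional C F ->
  is_weak_solution l sigma F (weak_solution l sigma F).
Proof.
move=> [Flin Fb]; have [u hu] := H2star_riesz l_gt0 sigmaP Flin Fb.
exact: (@xgetPex _ (cst 0) [set u | is_weak_solution l sigma F u] (ex_intro _ u hu)).
Qed.

Lemma weak_solution_energy C F : 0 <= C -> bounded_functional C F ->
  Num.sqrt (prod (weak_solution l sigma F) (weak_solution l sigma F)) <= C.
Proof.
move=> C0 bF; have [Hu hu] := weak_solutionP bF; have [_ Fb] := bF.
set u := weak_solution _ _ _ in Hu hu *.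
have := Fb _ Hu; rewrite -hu//; have P := prod_ge0 l_gt0 sigmaP Hu.
rewrite ger0_norm// -{1}(sqr_sqrtr P); move: (Num.sqrt _) (sqrtr_ge0 (prod u u)) => s s0.
have [->//|sN] := eqVneq s 0.
by rewrite expr2 ler_pM2r// lt_def sN.
Qed.

(** The type of forces is abstract, since they are functions in one case and functionals in the
    other. By symmetry of the scalar product the gap at [x] is [F f g], with [g] the representer at
    [x]; this reduces each case to the linear problem of the last hypothesis. *)
Lemma gap_max_attained (T : Type) (A : set T) (F : T -> (R * R -> R) -> R) (C : R) :
  0 <= C -> (forall f, A f -> bounded_functional C (F f)) ->
  (forall g, H2s g -> exists2 f0, A f0 & forall f, A f -> `|F f g| <= `|F f0 g|) ->
  exists2 f0, A f0 & forall f, A f ->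
    gap_max l (weak_solution l sigma (F f)) <= gap_max l (weak_solution l sigma (F f0)).
Proof.
move=> C0 bF Fmax.
have K0 : 0 <= Kgap l * C by rewrite mulr_ge0 ?sqrtr_ge0.
apply: (@sup_family_attained _ A (fun f => gap l (weak_solution l sigma (F f))) 0 pi _ p0 K0).
- move=> f x x' Af hx hx'; have [Hu hu] := weak_solutionP (bF _ Af).
  apply: (le_trans (gap_holder l_gt0 sigmaP Hu hx hx')).
  rewrite mulrAC ler_wpM2r ?sqrtr_ge0// ler_wpM2l ?sqrtr_ge0//.
  exact: weak_solution_energy (bF _ Af).
- by move=> f Af; have [Hu _] := weak_solutionP (bF _ Af); exact: gap_endpoints.
- move=> x hx; have [g Hg gE] := gap_representer hx.
  have E f : A f -> gap l (weak_solution l sigma (F f)) x = F f g.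
    move=> Af; have [Hu hu] := weak_solutionP (bF _ Af).
    by rewrite -gE// prodC hu.
  have [f0 Af0 h] := Fmax _ Hg; exists f0 => // f Af.
  by rewrite !E//; exact: h.
Qed.

(** Guarantees a unit functional in the dual case even when [p g] has zero energy. The witness
    [x * (pi - x)] vanishes at both ends and has the constant second derivative [- 2]. *)
Lemma H2star_nontrivial : exists2 u, H2s u & 0 < prod u u.
Proof.
pose U i j : R * R -> R := match i, j with
  | 0%N, 0%N => fun z => z.1 * (pi - z.1)
  | 1%N, 0%N => fun z => pi - 2 * z.1
  | 2%N, 0%N => fun=> - 2
  | _, _ => fun=> 0 end.
have ac1_C1 a b (f f' : R -> R) : a <= b -> (forall x, is_derive x (1:R) f (f' x)) ->
    continuous f -> continuous f' -> ac1 a b f f' /\ prim a f' b = f b - f a.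
  move=> ab df cf cf'; split; last exact: (Rint_FTC ab df cf').
  split; [exact: measurable_funTS (continuous_measurable_fun cf)|exact: continuous_intg|].
  exists (f a); apply: aeW => x; rewrite /= in_itv/= => /andP[/ltW ax _].
  by rewrite /prim (Rint_FTC ax df cf'); ring.
have d1 x : is_derive x (1:R) (fun x => x * (pi - x)) (pi - 2 * x).
  by apply: is_derive_eq; rewrite /GRing.scale/=; ring.
have d2 x : is_derive x (1:R) (fun x => pi - 2 * x) (- 2).
  by apply: is_derive_eq; rewrite /GRing.scale/=; ring.
have d0 c x : is_derive x (1:R) (fun=> c : R) 0 by exact: is_derive_cst.
have cc (c : R) : continuous ((fun=> c) : R -> R) by move=> ?; exact: cvg_cst.
have c1 := fun x => is_derive_continuous (d1 x); have c2 := fun x => is_derive_continuous (d2 x).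
have sX i j : (i + j < 2)%N -> sx l (U i j) (U i.+1 j).
  by move: i j => [|[|i]] [|[|j]] // _; apply: aeW => y _;
    [exact: (ac1_C1 _ _ _ _ p0' d1 c1 c2).1|exact: (ac1_C1 _ _ _ _ p0' (d0 0) (cc 0) (cc 0)).1|
     exact: (ac1_C1 _ _ _ _ p0' d2 c2 (cc _)).1].
have sY i j : (i + j < 2)%N -> sy l (U i j) (U i j.+1).
  by move: i j => [|[|i]] [|[|j]] // _; apply: aeW => y _;
    [exact: (ac1_C1 _ _ (fun=> y * (pi - y)) (fun=> 0) nle (d0 _) (cc _) (cc 0)).1|
     exact: (ac1_C1 _ _ (fun=> 0) (fun=> 0) nle (d0 _) (cc _) (cc 0)).1|
     exact: (ac1_C1 _ _ (fun=> pi - 2 * y) (fun=> 0) nle (d0 _) (cc _) (cc 0)).1].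
have LU i j : (i + j <= 2)%N -> L2 area (Omega l) (U i j).
  have L (f : R -> R) : continuous f -> (exists M, forall x, 0 < x < pi -> `|f x| <= M) ->
      L2 area (Omega l) (fun z => f z.1).
    move=> cf [M fM]; have mf : measurable_fun (Omega l : set mplane) (fun z => f z.1).
      by apply: meas_fst; exact: measurable_funTS (continuous_measurable_fun cf).
    split=> //; apply: (@intg_bounded _ _ _ _ _ mO _ (M ^+ 2)); first exact: Omega_fin.
      exact: measurable_funX.
    move=> z [/=]; rewrite in_itv/= => hz _.
    rewrite ger0_norm ?sqr_ge0// -(real_normK (num_real (f z.1))).
    by have h := fM _ hz; rewrite ler_sqr ?nnegrE//; exact: le_trans h.
  move: i j => [|[|[|i]]] [|[|[|j]]] // _; try exact: L2_cst.
    apply: (L (fun x => x * (pi - x))) => //; exists (pi * pi) => x /andP[x0 xp].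
    by rewrite normrM; apply: ler_pM => //; rewrite ger0_norm; lra.
  apply: (L (fun x => pi - 2 * x)) => //; exists (3 * pi) => x /andP[x0 xp].
  by rewrite ler_norml; apply/andP; split; lra.
have jU : jet l U by split.
have Z : hinged l U.
  apply: prim_hinged; first exact: sX.
  apply: aeW => y _; split; first by rewrite (ac1_C1 0 pi _ _ p0' d1 c1 c2).2; ring.
  apply: aeW => x; rewrite /= in_itv/= => /andP[/ltW x0 _].
  by rewrite (ac1_C1 0 x _ _ x0 d1 c1 c2).2; ring.
have Hu := hinged_H2star l_gt0 jU Z; exists (U 0%N 0%N) => //.
have /andP[h _] := prod_bounds l_gt0 sigmaP Hu; apply: lt_le_trans h.
have /andP[s0 s1] := sigmaP; apply: mulr_gt0; first by lra.
have [h _ _] := N2_le l (wjet (U 0%N 0%N)); apply: lt_le_trans h.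
have -> : nm (wjet (U 0%N 0%N) 2 0) = nm (U 2%N 0%N).
  apply: (@n2_ae _ mplane R area) => //.
  - exact: (L2_wjet l_gt0 Hu.1 (isT : (2 + 0 <= 2)%N)).1.
  - exact: (LU 2%N 0%N isT).1.
  - exact: (jet_wD l_gt0 jU (isT : (2 + 0 <= 2)%N)).
rewrite /n2 /= Rintegral_cst//.
rewrite (@area_rect_fine _ 0 pi (- l) l)// mulr_gt0//; first by rewrite sqrrN exprn_gt0.
by rewrite mulr_gt0// subr_gt0.
Qed.

Lemma prod_abs_le u v : H2s u -> H2s v ->
  `|prod u v| <= H2star_norm l sigma u * H2star_norm l sigma v.
Proof.
exact: (@form_abs_le R (R * R)%type H2s prod (H2starD l_gt0) (prodD sigma l_gt0)
  (fun u v _ _ => prodC l sigma u v) (prod_ge0 l_gt0 sigmaP) u v).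
Qed.

Lemma prodZ (a : R) u v : H2s u -> H2s v -> prod (fun z => a * u z) v = a * prod u v.
Proof.
move=> Hu Hv; have H0 := H2star0 l.
have E0 : prod (fun=> 0) v = 0.
  have := prodD sigma l_gt0 1 H0 H0 Hv.
  have -> : (fun z : R * R => 1 * 0 + 0) = (fun=> 0 : R) by apply/funext => z; rewrite mulr0 addr0.
  by rewrite mul1r => /eqP; rewrite -subr_eq0 opprD addrA subrr sub0r oppr_eq0 => /eqP.
have := prodD sigma l_gt0 a Hu H0 Hv; rewrite E0 addr0 => <-.
by have -> : (fun z => a * u z + 0) = (fun z => a * u z) by apply/funext => z; rewrite addr0.
Qed.

Lemma H2starZ (a : R) u : H2s u -> H2s (fun z => a * u z).
Proof.
move=> Hu; have := H2starD l_gt0 a Hu (H2star0 l).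
by have -> : (fun z => a * u z + 0) = (fun z => a * u z) by apply/funext => z; rewrite addr0.
Qed.

Lemma dual_scale (f : (R * R -> R) -> R) (a : R) u : H2star_dual l sigma f -> H2s u ->
  f (fun z => a * u z) = a * f u.
Proof.
move=> [flin _] Hu; have H0 := H2star0 l.
have E0 : f (fun=> 0) = 0.
  have := flin 1 _ _ H0 H0.
  have -> : (fun z : R * R => 1 * 0 + 0) = (fun=> 0 : R) by apply/funext => z; rewrite mulr0 addr0.
  by rewrite mul1r => /eqP; rewrite -subr_eq0 opprD addrA subrr sub0r oppr_eq0 => /eqP.
have := flin a _ _ Hu H0; rewrite E0 addr0 => <-.
by have -> : (fun z => a * u z + 0) = (fun z => a * u z) by apply/funext => z; rewrite addr0.
Qed.

Lemma H2star_normZ (a : R) u : H2s u ->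
  H2star_norm l sigma (fun z => a * u z) = `|a| * H2star_norm l sigma u.
Proof.
move=> Hu; rewrite /H2star_norm prodZ//; last exact: H2starZ.
by rewrite prodC prodZ// mulrA -expr2 sqrtrM ?sqr_ge0// sqrtr_sqr.
Qed.

(** The supremum defining the dual norm has no absolute value, so both signs of the normalized [v]
    are tested. If [v] has norm 0 it cannot be normalized, but boundedness of [f] forces
    [f v = 0]. *)
Lemma dual_norm_bound f v : H2star_dual l sigma f -> H2s v ->
  `|f v| <= H2star_dual_norm l sigma f * H2star_norm l sigma v.
Proof.
move=> df Hv; have [_ [C fC]] := df; set N := H2star_norm l sigma v.
have N0 : 0 <= N by exact: sqrtr_ge0.
have [Nz|Nz] := eqVneq N 0.
  by have := fC _ Hv; rewrite -/N Nz !mulr0.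
have Nweight : 0 < N by rewrite lt_def Nz.
have ub : has_ubound [set f v | v in [set v | H2s v /\ H2star_norm l sigma v = 1]].
  exists C => _ [w [Hw Nw] <-]; apply: (le_trans (ler_norm _)).
  by apply: (le_trans (fC _ Hw)); rewrite Nw mulr1.
have unit (s : R) : `|s| = 1 -> s * f v <= H2star_dual_norm l sigma f * N.
  move=> s1; have Hw := H2starZ (s / N) Hv.
  have : f (fun z => s / N * v z) <= H2star_dual_norm l sigma f.
    apply: (ub_le_sup ub); exists (fun z => s / N * v z) => //; split => //.
    by rewrite H2star_normZ// normrM s1 mul1r ger0_norm ?invr_ge0// mulVf.
  by rewrite dual_scale// mulrAC ler_pdivrMr.
rewrite ler_norml; apply/andP; split.
  by have := unit (-1); rewrite normrN1 => /(_ erefl); rewrite mulN1r lerNl.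
by have := unit 1; rewrite normr1 => /(_ erefl); rewrite mul1r.
Qed.

(** The supremum is reached at [h] divided by its norm, the equality case of Cauchy-Schwarz. *)
Lemma representer_force h : H2s h -> 0 < prod h h ->
  forces_dual l sigma (fun v => (H2star_norm l sigma h)^-1 * prod h v).
Proof.
move=> Hh hp; set N := H2star_norm l sigma h.
have Nweight : 0 < N by rewrite sqrtr_gt0.
have NN : prod h h = N ^+ 2 by rewrite sqr_sqrtr// ltW.
pose f v := N^-1 * prod h v.
have fb v : H2s v -> `|f v| <= 1 * H2star_norm l sigma v.
  move=> Hv; rewrite /f normrM ger0_norm ?invr_ge0 ?(ltW Nweight)// mul1r ler_pdivrMl//.
  exact: prod_abs_le.
have df : H2star_dual l sigma f.
  split; last by exists 1.
  move=> a u v Hu Hv; rewrite /f prodC (prodD sigma l_gt0 a Hu Hv Hh) [prod u h]prodC [prod v h]prodC.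
  by move: (prod h u) (prod h v) => x y; ring.
split => //; apply/eqP; rewrite eq_le; apply/andP; split.
  apply: ge_sup.
    exists (f (fun z => N^-1 * h z)), (fun z => N^-1 * h z) => //; split; first exact: H2starZ.
    by rewrite H2star_normZ// ger0_norm ?invr_ge0 ?(ltW Nweight)// mulVf// gt_eqF.
  move=> _ [v [Hv Nv] <-]; apply: (le_trans (ler_norm _)).
  by apply: (le_trans (fb _ Hv)); rewrite Nv mulr1.
apply: ub_le_sup.
  exists 1 => _ [v [Hv Nv] <-]; apply: (le_trans (ler_norm _)).
  by apply: (le_trans (fb _ Hv)); rewrite Nv mulr1.
exists (fun z => N^-1 * h z).
  split; first exact: H2starZ.
  by rewrite H2star_normZ// ger0_norm ?invr_ge0 ?(ltW Nweight)// mulVf// gt_eqF.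
have Hw := H2starZ N^-1 Hh.
by rewrite prodC prodZ// NN; field; rewrite gt_eqF.
Qed.

Lemma dual_max_attained p (b : R) : H2 l p -> 0 <= b ->
  {ae area, forall z, Omega l z -> `|p z| <= b} ->
  exists2 f, forces_dual l sigma f & forall g, forces_dual l sigma g ->
    gap_max_dual l sigma p g <= gap_max_dual l sigma p f.
Proof.
move=> Hp b0 pb; have HM v : H2s v -> H2s (fun z => p z * v z).
  exact: (H2star_mul l_gt0 sigmaP Hp pb b0).
apply: (@gap_max_attained _ (forces_dual l sigma) (pairing_dual p) (Num.sqrt (96 * Kmul l p b))).
- exact: sqrtr_ge0.
- move=> f [df f1]; split.
    move=> a u v Hu Hv; rewrite /pairing_dual -df.1; [|exact: HM|exact: HM].
    by congr (f _); apply/funext => z; ring.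
  move=> v Hv; rewrite /pairing_dual; apply: (le_trans (dual_norm_bound df (HM _ Hv))).
  rewrite f1 mul1r /H2star_norm; have le := prod_mul_le l_gt0 sigmaP Hp pb b0 Hv.
  exact: sqrt_le_mul le (prod_ge0 l_gt0 sigmaP Hv).
- move=> g Hg; have Hh := HM _ Hg; set h := fun z => p z * g z in Hh.
  have [hp|hn] := ltP 0 (prod h h).
    exists (fun v => (H2star_norm l sigma h)^-1 * prod h v); first exact: representer_force.
    move=> f [df f1]; rewrite /pairing_dual -/h; apply: (le_trans (dual_norm_bound df Hh)).
    have Nweight : 0 < H2star_norm l sigma h by rewrite sqrtr_gt0.
    rewrite f1 mul1r -[X in _ * X](sqr_sqrtr (ltW hp)) -/(H2star_norm l sigma h).
    by rewrite expr2 mulKf ?gt_eqF// ler_norm.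
  (* Here every force gives the pairing 0, so any unit functional is optimal. *)
  have [u Hu up] := H2star_nontrivial.
  exists (fun v => (H2star_norm l sigma u)^-1 * prod u v); first exact: representer_force.
  move=> f [df f1]; apply: (le_trans (dual_norm_bound df Hh)).
  move: hn; rewrite /H2star_norm; move: (prod h h) => x hx.
  by rewrite (ler0_sqrtr hx) mulr0.
Qed.

End attained.

(** * Extremal forces in Lebesgue spaces *)

Section lebesgue_forces.
Context {R : realType}.
Local Notation mR := (measurableTypeR R).
Local Notation mplane := (mR * mR)%type.
Local Notation area := (@area R).
Local Notation pi := (@pi R).
Variables (l : R) (l_gt0 : 0 < l).
Implicit Types (f g h k : R * R -> R).
Let mO := measurable_Omega l.

Lemma area_Omega_gt0 : 0 < fine (area (Omega l)).
Proof.
have nl := Nl_lt l_gt0; rewrite (@area_rect_fine _ 0 pi (- l) l) ?pi_ge0 ?ltW//.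
by rewrite mulr_gt0 ?subr_gt0 ?pi_gt0.
Qed.

Lemma measurable_abs_powR f (r : R) : measurable_fun (Omega l : set mplane) f ->
  measurable_fun (Omega l : set mplane) (fun z => `|f z| `^ r).
Proof.
move=> mf; apply: (@measurableT_comp _ _ _ _ _ _ (fun x : R => x `^ r)).
  exact: measurable_powR.
exact: measurableT_comp mf.
Qed.

Lemma intg_ae_boundedM f g (M : R) : intg area (Omega l) f ->
  measurable_fun (Omega l : set mplane) g ->
  {ae area, forall z, Omega l z -> `|g z| <= M} ->
  intg area (Omega l) (fun z => g z * f z).
Proof.
move=> fi mg gM; apply: (@intg_le_ae _ _ mplane area _ _ (fun z => M * `|f z|)) => //.
- by apply: measurable_funM => //; exact: intg_meas fi.
- by apply: filterS gM => z h Oz; rewrite normrM ler_wpM2r// h.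
- by apply: intgZ => //; exact: intg_abs.
Qed.

Lemma LqNorm_powR f (r : R) : r != 0 ->
  (LqNorm l r%:E f `^ r = \int[area]_(z in Omega l) (`|f z| `^ r)%:E)%E.
Proof.
move=> r0; rewrite /LqNorm poweR_Lnorm// [RHS]integral_mkcond; apply: eq_integral => z _ /=.
by rewrite !patchE; case: ifPn => _ //; rewrite normr0 powR0.
Qed.

Lemma forces_LrP f (r : R) : 0 < r -> forces_Lq l r%:E f <->
  [/\ measurable_fun (Omega l : set mplane) f, intg area (Omega l) (fun z => `|f z| `^ r) &
      \int[area]_(z in Omega l) (`|f z| `^ r) = 1].
Proof.
move=> r0; have rN : r != 0 by rewrite gt_eqF.
split=> [[[mf _] N1]|[mf fi I1]].
- have E := LqNorm_powR f rN; rewrite N1 poweR1r in E.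
  split=> //; last by rewrite /Rintegral -E.
  apply/integrableP; split; first by apply/measurable_EFinP; exact: measurable_abs_powR.
  have -> : (\int[area]_(z in Omega l) `|(EFin \o (fun z => (`|f z| `^ r)%R)) z| =
      \int[area]_(z in Omega l) (`|f z| `^ r)%:E)%E.
    by apply: eq_integral => z _; rewrite /= ger0_norm// powR_ge0.
  by rewrite -E ltry.
- have E : (LqNorm l r%:E f `^ r = 1)%E.
    rewrite LqNorm_powR// -[RHS]/(1%:E)%E -I1 /Rintegral fineK//.
    exact: integrable_fin_num.
  have N1 : LqNorm l r%:E f = 1%E.
    have N0 : (0 <= LqNorm l r%:E f)%E by exact: Lnorm_ge0.
    have := congr1 (fun x => (x `^ r^-1)%E) E.
    by rewrite -poweRrM mulfV// poweRe1// poweR1r.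
  by split=> //; split=> //; rewrite N1 ltry.
Qed.

(** With [k] rescaled to [q] of norm one in the conjugate space, Young's inequality integrates to
    the bound [r^-1 + s^-1 = 1], and [f0 = q * |q| ^ (s - 2)] attains it because
    [(s - 1) * r = s]. *)
Lemma extremal_Lr (r : R) k : 1 < r -> measurable_fun (Omega l : set mplane) k ->
  (exists M, {ae area, forall z, Omega l z -> `|k z| <= M}) ->
  ~ {ae area, forall z, Omega l z -> k z = 0} ->
  exists2 f0, forces_Lq l r%:E f0 &
    forall f, forces_Lq l r%:E f ->
      `|\int[area]_(z in Omega l) (f z * k z)| <= `|\int[area]_(z in Omega l) (f0 z * k z)|.
Proof.
move=> r1 mk [M kM] kN0; have r0 : 0 < r by exact: lt_trans r1.
pose s := r / (r - 1); have rm : 0 < r - 1 by rewrite subr_gt0.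
have s0 : 0 < s by rewrite divr_gt0.
have rs : r^-1 + s^-1 = 1 by rewrite /s invf_div; field; rewrite !gt_eqF.
have s1 : (s - 1) * r = s by rewrite /s; field; rewrite gt_eqF.
have sm : 0 < s - 1 by rewrite -(pmulr_lgt0 _ r0) s1.
have mks := measurable_abs_powR s mk.
have ki : intg area (Omega l) (fun z => `|k z| `^ s).
  apply: (@intg_le_ae _ _ mplane area _ _ (cst (M `^ s))) => //.
    apply: filterS kM => z h Oz; rewrite ger0_norm ?powR_ge0//.
    by apply: ge0_ler_powR; rewrite ?nnegrE ?(ltW s0)//; [exact: le_trans (h Oz)|exact: h].
  apply: (@intg_bounded _ _ _ _ _ mO _ `|M `^ s|) => //; exact: Omega_fin.
pose I := \int[area]_(z in Omega l) (`|k z| `^ s).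
have I0 : 0 < I.
  rewrite lt_def; apply/andP; split; last by apply: Rintegral_ge0 => z _; exact: powR_ge0.
  apply/eqP => Iz; apply: kN0.
  have : {ae area, forall z, Omega l z -> `|k z| `^ s = 0}.
    apply: (@Rint_abs_eq0 _ mplane R area) => //; rewrite -[RHS]Iz.
    by apply: eq_Rintegral => z _; rewrite ger0_norm// powR_ge0.
  by apply: filterS => z h /h /powR_eq0_eq0 /normr0_eq0.
pose c := I `^ s^-1; have c0 : 0 < c by rewrite powR_gt0.
have cs : c `^ s = I by rewrite -powRrM mulVf ?gt_eqF// powRr1// ltW.
pose q z := k z / c; have qE z : `|q z| `^ s = I^-1 * `|k z| `^ s.
  have ci : 0 <= c^-1 by rewrite invr_ge0 ltW.
  rewrite /q normrM (ger0_norm ci) powRM// mulrC; congr (_ * _).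
  by rewrite -(powR_inv1 (ltW c0)) -powRrM mulrC powRrM cs powR_inv1// ltW.
have qi : intg area (Omega l) (fun z => `|q z| `^ s).
  have -> : (fun z => `|q z| `^ s) = (fun z => I^-1 * `|k z| `^ s) by apply/funext.
  exact: intgZ.
have q1 : \int[area]_(z in Omega l) (`|q z| `^ s) = 1.
  under eq_Rintegral do rewrite qE.
  by rewrite RintegralZl// mulVf// gt_eqF.
have mq : measurable_fun (Omega l : set mplane) q by exact: measurable_funM.
(* The exponent is negative for [s < 2]; where [q z = 0] the first factor makes the product 0
   whatever the power is. *)
pose f0 z := q z * `|q z| `^ (s - 2).
have abs0 z : `|f0 z| = `|q z| `^ (s - 1).
  rewrite /f0 normrM (ger0_norm (powR_ge0 _ _)).
  have [->|qN] := eqVneq (q z) 0; first by rewrite normr0 mul0r powR0// gt_eqF.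
  rewrite -{1}[`|q z|]powRr1// -powRD; last by rewrite normr_eq0 qN implybT.
  by congr (_ `^ _); ring.
have f0q z : f0 z * q z = `|q z| `^ s.
  have -> : f0 z * q z = `|f0 z| * `|q z|.
    rewrite -normrM [RHS]ger0_norm// /f0 mulrAC -expr2 mulr_ge0 ?sqr_ge0 ?powR_ge0//.
  rewrite abs0; have [->|qN] := eqVneq (q z) 0; first by rewrite normr0 mulr0 powR0// gt_eqF.
  rewrite -{2}[`|q z|]powRr1// -powRD; last by rewrite normr_eq0 qN implybT.
  by congr (_ `^ _); ring.
have f0r z : `|f0 z| `^ r = `|q z| `^ s by rewrite abs0 -powRrM s1.
have force0 : forces_Lq l r%:E f0.
  apply/(forces_LrP _ r0); split.
  - by apply: measurable_funM => //; exact: measurable_abs_powR.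
  - by have -> : (fun z => `|f0 z| `^ r) = (fun z => `|q z| `^ s) by apply/funext.
  - by under eq_Rintegral do rewrite f0r.
exists f0 => // f /(forces_LrP _ r0)[mf fi f1].
have young z : `|f z * q z| <= r^-1 * `|f z| `^ r + s^-1 * `|q z| `^ s.
  by rewrite normrM ![_^-1 * _]mulrC; exact: conjugate_powR.
have yi : intg area (Omega l) (fun z => r^-1 * `|f z| `^ r + s^-1 * `|q z| `^ s).
  by apply: intgD => //; exact: intgZ.
have fqi : intg area (Omega l) (fun z => f z * q z).
  apply: (@intg_le _ _ _ _ _ mO _ _ _ _ yi); first exact: measurable_funM.
  by move=> z _; exact: young.
have kq g : intg area (Omega l) (fun z => g z * q z) ->
    \int[area]_(z in Omega l) (g z * k z) = c * \int[area]_(z in Omega l) (g z * q z).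
  move=> gq; rewrite -RintegralZl//; apply: eq_Rintegral => z _.
  by rewrite mulrCA /q [c * _]mulrC divfK// gt_eqF.
have f0qi : intg area (Omega l) (fun z => f0 z * q z).
  by have -> : (fun z => f0 z * q z) = (fun z => `|q z| `^ s) by apply/funext.
rewrite !kq// !normrM ler_wpM2l ?normr_ge0//.
under [X in _ <= `|X|]eq_Rintegral do rewrite f0q.
rewrite q1 normr1; apply: (le_trans (le_normr_Rintegral _ fqi)) => //.
have <- : \int[area]_(z in Omega l) (r^-1 * `|f z| `^ r + s^-1 * `|q z| `^ s) = 1.
  rewrite RintegralD//; [|exact: intgZ|exact: intgZ].
  by rewrite !RintegralZl// f1 q1 !mulr1.
apply: (@Rint_le_ae _ mplane R area) => //; first exact: intg_abs.
by apply: aeW => z _; exact: young.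
Qed.

Lemma forces_Linfty_le f : forces_Lq l +oo%E f ->
  {ae area, forall z, Omega l z -> `|f z| <= 1}.
Proof.
(* The norm is defined as 0 when the whole space is null; that branch contradicts norm one. *)
move=> [[mf _]]; rewrite /LqNorm unlock; case: ifP => [_|_ /eqP]; last first.
  by rewrite eq_sym onee_eq0.
move=> E; have := @ess_sup_ge _ mplane R area (abse \o (EFin \o (f \_ (Omega l)))).
by rewrite E; apply: filterS => z /=; rewrite patchE => h Oz; move: h; rewrite mem_set.
Qed.

Lemma forces_Linfty_abs1 f : measurable_fun (Omega l : set mplane) f ->
  (forall z, `|f z| = 1) -> forces_Lq l +oo%E f.
Proof.
move=> mf f1; suff N1 : LqNorm l +oo%E f = 1%E by split=> //; split=> //; rewrite N1 ltry.
have aO : area (Omega l) != 0%E.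
  by have := area_Omega_gt0; case: (area (Omega l)) => [x /= x0|//|//]; rewrite eqe gt_eqF.
rewrite /LqNorm unlock; case: ifPn => [_|]; last first.
  rewrite -leNgt => h; move: aO; rewrite -measure_le0 => /negP; case.
  by apply: le_trans h; apply: le_measure; rewrite ?inE.
apply/eqP; rewrite eq_le; apply/andP; split.
  apply/ess_supP; apply: aeW => z /=; rewrite lee_fin patchE.
  by case: ifP => _; rewrite ?f1// normr0.
have [z [Oz]] : exists z, Omega l z /\ ((abse \o (EFin \o (f \_ (Omega l)))) z <=
    ess_sup area (abse \o (EFin \o (f \_ (Omega l)))))%E.
  apply: (@ae_ex _ _ mplane area) => //.
  by apply: filterS (@ess_sup_ge _ mplane R area (abse \o (EFin \o (f \_ (Omega l))))).
by rewrite /= patchE mem_set// f1.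
Qed.

Lemma extremal_Linfty k : measurable_fun (Omega l : set mplane) k ->
  (exists M, {ae area, forall z, Omega l z -> `|k z| <= M}) ->
  exists2 f0, forces_Lq l +oo%E f0 &
    forall f, forces_Lq l +oo%E f ->
      `|\int[area]_(z in Omega l) (f z * k z)| <= `|\int[area]_(z in Omega l) (f0 z * k z)|.
Proof.
(* The sign of [k], with the value 1 at its zeros: the norm is then one even if [k] vanishes
   identically. *)
move=> mk [M kM]; pose f0 z : R := if 0 <= k z then 1 else -1.
have mf0 : measurable_fun (Omega l : set mplane) f0.
  apply: measurable_fun_if => //; first exact: measurable_fun_ler.
have ki : intg area (Omega l) k.
  apply: (@intg_le_ae _ _ mplane area _ _ (cst M)) => //.
  apply: (@intg_bounded _ _ _ _ _ mO _ `|M|) => //; exact: Omega_fin.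
exists f0.
  by apply: forces_Linfty_abs1 => // z; rewrite /f0; case: ifP => _; rewrite ?normrN1 ?normr1.
move=> f ff; have f1 := forces_Linfty_le ff; have [[mf _] _] := ff.
have fki := intg_ae_boundedM ki mf f1.
have E : \int[area]_(z in Omega l) (f0 z * k z) = \int[area]_(z in Omega l) `|k z|.
  apply: eq_Rintegral => z _; rewrite /f0; case: ifPn => [h|].
    by rewrite mul1r ger0_norm.
  by rewrite -ltNge => h; rewrite mulN1r ltr0_norm.
rewrite E [leRHS]ger0_norm; last by apply: Rintegral_ge0.
apply: (le_trans (le_normr_Rintegral _ fki)) => //.
apply: (@Rint_le_ae _ mplane R area) => //; [exact: intg_abs|exact: intg_abs|].
by apply: filterS f1 => z h Oz; rewrite normrM ler_piMl// h.
Qed.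

(** A uniform L1 bound makes the functionals uniformly bounded, since [p v] is bounded by
    [H2star_sup] and the bound on [p]. For finite exponents it comes from comparing [|f|] with
    [|f| ^ r + 1]. *)
Lemma forces_L1_bound (q : \bar R) : (1%:E < q)%E ->
  exists2 C, 0 <= C & forall f, forces_Lq l q f ->
    intg area (Omega l) f /\ \int[area]_(z in Omega l) `|f z| <= C.
Proof.
have c1 : intg area (Omega l) (cst 1 : R * R -> R).
  by apply: L2_intgO; exact: L2_cst.
have E1 : \int[area]_(z in Omega l) (cst 1 z : R) = fine (area (Omega l)).
  by rewrite Rintegral_cst// mul1r.
have a0 := ltW area_Omega_gt0.
case: q => [r|_|//]; last first.
  exists (fine (area (Omega l))) => // f ff; have f1 := forces_Linfty_le ff.
  have fi : intg area (Omega l) f by apply: (@intg_le_ae _ _ mplane area _ _ (cst 1)) => //; exact: ff.1.1.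
  split => //; rewrite -E1; apply: (@Rint_le_ae _ mplane R area) => //; exact: intg_abs.
rewrite lte_fin => r1; have r0 : 0 < r by exact: lt_trans r1.
exists (1 + fine (area (Omega l))); first by rewrite addr_ge0.
move=> f /(forces_LrP _ r0)[mf fi f1].
have le z : `|f z| <= `|f z| `^ r + 1.
  have [h|h] := leP `|f z| 1; first by apply: (le_trans h); rewrite lerDr powR_ge0.
  apply: le_trans (_ : `|f z| `^ r <= _); last by rewrite lerDl.
  by rewrite -{1}[`|f z|]powRr1//; apply: ler_powR; exact: ltW.
have si : intg area (Omega l) (fun z => `|f z| `^ r + 1) by exact: intgD.
have fi' : intg area (Omega l) f.
  by apply: (@intg_le _ _ _ _ _ mO _ _ _ _ si).
split => //; rewrite -f1 -E1 -RintegralD//.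
by apply: (@Rint_le_ae _ mplane R area) => //; [exact: intg_abs|apply: aeW => z _; exact: le].
Qed.

Lemma extremal_Lq (q : \bar R) k : (1%:E < q)%E ->
  measurable_fun (Omega l : set mplane) k ->
  (exists M, {ae area, forall z, Omega l z -> `|k z| <= M}) ->
  exists2 f0, forces_Lq l q f0 &
    forall f, forces_Lq l q f ->
      `|\int[area]_(z in Omega l) (f z * k z)| <= `|\int[area]_(z in Omega l) (f0 z * k z)|.
Proof.
case: q => [r r1|_|//] mk kM; last exact: extremal_Linfty.
move: r1; rewrite lte_fin => r1; have r0 : 0 < r by exact: lt_trans r1.
have [kz|kN] := pselect {ae area, forall z, Omega l z -> k z = 0}; last exact: extremal_Lr.
have m1 : measurable_fun (Omega l : set mplane) (cst 1 : R * R -> R) by exact: measurable_cst.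
(* For [k = 0] every force is optimal; [extremal_Lr] for the constant 1 merely supplies one of norm
   one. *)
have [||f0 ff0 _] := @extremal_Lr r (cst 1) r1 m1.
- by exists 1; apply: aeW => z _; rewrite normr1.
- move=> h; have [|z [_ /=]] := @ae_ex _ _ mplane area (Omega l) _ mO _ h.
    by have := area_Omega_gt0; case: (area (Omega l)) => [x /= x0|//|//]; rewrite eqe gt_eqF.
  by move/eqP; rewrite oner_eq0.
exists f0 => // f /(forces_LrP _ r0)[mf _ _].
have -> : \int[area]_(z in Omega l) (f z * k z) = \int[area]_(z in Omega l) (cst 0 z).
  apply: (@Rint_ae _ mplane R area) => //; first exact: measurable_funM.
  by apply: filterS kz => z h Oz; rewrite h// mulr0.
by rewrite Rintegral_cst// mul0r normr0.
Qed.

End lebesgue_forces.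

(** * Attainment of the maximal gap for forces in Lebesgue spaces *)

Section lebesgue_attained.
Context {R : realType}.
Local Notation mR := (measurableTypeR R).
Local Notation mplane := (mR * mR)%type.
Local Notation area := (@area R).
Variables (l sigma : R) (l_gt0 : 0 < l) (sigmaP : 0 < sigma < 1 / 2).
Let mO := measurable_Omega l.
Local Notation prod := (H2star_prod l sigma).

Lemma Lq_max_attained (q : \bar R) (p : R * R -> R) (b : R) : (1%:E < q)%E ->
  measurable_fun (Omega l : set mplane) p -> 0 <= b ->
  {ae area, forall z, Omega l z -> `|p z| <= b} ->
  exists2 f, forces_Lq l q f & forall g, forces_Lq l q g ->
    gap_max_Lq l sigma p g <= gap_max_Lq l sigma p f.
Proof.
move=> q1 mp b0 pb; have [C C0 L1] := forces_L1_bound l_gt0 q1.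
have mv v : H2star l v -> measurable_fun (Omega l : set mplane) v.
  by move=> Hv; exact: (L2_wjet l_gt0 Hv.1 (isT : (0 + 0 <= 2)%N)).1.
have mpv v : H2star l v -> measurable_fun (Omega l : set mplane) (fun z => p z * v z).
  by move=> Hv; apply: measurable_funM => //; exact: mv.
have bpv v : H2star l v -> {ae area, forall z, Omega l z ->
    `|p z * v z| <= b * Num.sqrt (Kenergy l * prod v v)}.
  move=> Hv; apply: filterS2 pb (H2star_sup l_gt0 sigmaP Hv) => z h1 h2 Oz.
  by rewrite normrM; apply: ler_pM => //; [exact: h1|exact: h2].
have E f v : pairing_Lq l p f v =
    \int[area]_(z in Omega l) ((p z * v z) * f z).
  by apply: eq_Rintegral => z _; rewrite mulrAC.
have K0 := Kenergy_ge0 l_gt0.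
apply: (@gap_max_attained _ _ _ l_gt0 sigmaP _ (forces_Lq l q) (pairing_Lq l p)
  (b * Num.sqrt (Kenergy l) * C)).
- by rewrite !mulr_ge0 ?sqrtr_ge0.
- move=> f /L1[fi fC]; split.
    move=> a u v Hu Hv; rewrite !E.
    have iu := intg_ae_boundedM fi (mpv _ Hu) (bpv _ Hu).
    have iv := intg_ae_boundedM fi (mpv _ Hv) (bpv _ Hv).
    rewrite -RintegralZl// -RintegralD//; last exact: intgZ.
    by apply: eq_Rintegral => z _; ring.
  move=> v Hv; rewrite E; have iv := intg_ae_boundedM fi (mpv _ Hv) (bpv _ Hv).
  apply: (le_trans (le_normr_Rintegral _ iv)) => //.
  have B0 : 0 <= b * Num.sqrt (Kenergy l * prod v v) by rewrite mulr_ge0 ?sqrtr_ge0.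
  apply: le_trans (_ : b * Num.sqrt (Kenergy l * prod v v) * \int[area]_(z in Omega l) `|f z| <= _).
    have fi' := intg_abs fi.
    rewrite -RintegralZl//; apply: (@Rint_le_ae _ mplane R area) => //; [exact: intg_abs|exact: intgZ|].
    by apply: filterS (bpv _ Hv) => z h Oz; rewrite normrM ler_wpM2r// h.
  apply: (le_trans (ler_wpM2l B0 fC)).
  by rewrite sqrtrM// mulrA mulrAC.
- move=> g Hg; have mk := mpv _ Hg.
  have bk : exists M, {ae area, forall z, Omega l z -> `|p z * g z| <= M}.
    by eexists; exact: bpv.
  have [f0 ff0 h] := extremal_Lq l_gt0 q1 mk bk.
  have E' f : pairing_Lq l p f g = \int[area]_(z in Omega l) (f z * (p z * g z)).
    by rewrite /pairing_Lq; apply: eq_Rintegral => z _; ring.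
  by exists f0 => // f ff; rewrite !E'; exact: h.
Qed.

End lebesgue_attained.

Lemma weight_bound (R : realType) (l alpha beta : R) (p : R * R -> R) :
  0 < alpha -> weights_Linfty l alpha beta p ->
  {ae area, forall z, Omega l z -> `|p z| <= beta}.
Proof.
move=> a0 [_ pb _ _]; apply: filterS pb => z h /h /andP[ap pb].
by rewrite ger0_norm//; exact: le_trans (ltW a0) ap.
Qed.

Theorem theorem3p1 (R : realType) (l sigma kappa alpha beta : R)
    (hl : 0 < l) (hsigma : 0 < sigma < 1 / 2) (hkappa : 1 < kappa)
    (halpha : 0 < alpha < 1) (hbeta : 1 < beta) :
  (forall (q : \bar R) (p : R * R -> R),
     (1%:E < q)%E -> weights_Linfty l alpha beta p ->
     exists2 f, forces_Lq l q f &
       forall g, forces_Lq l q g ->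
         gap_max_Lq l sigma p g <= gap_max_Lq l sigma p f)
  /\
  (forall p : R * R -> R,
     weights_H2 l kappa alpha beta p ->
     exists2 f, forces_dual l sigma f &
       forall g, forces_dual l sigma g ->
         gap_max_dual l sigma p g <= gap_max_dual l sigma p f).
Proof.
have /andP[a0 _] := halpha; have b0 : 0 <= beta by lra.
split=> [q p q1 wp|p [Hp wp _]]; have pb := weight_bound a0 wp.
  by have [[mp _] _ _ _] := wp; exact: (Lq_max_attained hl hsigma q1 mp b0 pb).
exact: (dual_max_attained hl hsigma Hp b0 pb).
Qed.
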